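(* Let $\alpha\ge0$, $\gamma>0$, $0\le\xi\le1$, let $\mu\ge1$ and $\nu>0$ satisfy $\mu+\nu=\alpha-\gamma$ and $\mu\nu=\gamma$. Let $A,B,C$ be real numbers with $B<1$ and $$B<\min\left\{2+\frac1\mu,\ C-A-1\right\}.$$ Let $\phi$ be a twice differentiable function on $(0,1)$ with $\phi>0$, $\phi'>0$, $\phi''>0$ there, and let $k>0$ be a constant such that $\lambda(t)=k\,t^{B-1}(1-t)^{C-A-B}\phi(1-t)$ is integrable on $(0,1)$ with $\int_0^1\lambda(t)\,dt=1$. Let $\beta<1$ satisfy $$\frac{\beta-1/2}{1-\beta}=-\int_0^1\lambda(t)q(t)\,dt .$$ If $f\in W_\beta(\alpha,\gamma)$, then the function $$V_\lambda(f)(z)=k\int_0^1t^{B-1}(1-t)^{C-A-B}\phi(1-t)\frac{f(tz)}{t}\,dt$$ belongs to $M(\xi)$.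
   Context: $\mathbb{D}=\{z\in\mathbb{C}:|z|<1\}$. $\mathcal{A}$ is the class of analytic functions $f$ in $\mathbb{D}$ with $f(0)=f'(0)-1=0$. For $0\le\xi\le1$, the Pascu class $M(\xi)$ consists of the $f\in\mathcal{A}$ with $\mathrm{Re}\,\dfrac{\xi z(zf'(z))'+(1-\xi)zf'(z)}{\xi zf'(z)+(1-\xi)f(z)}>0$ in $\mathbb{D}$, i.e. $\xi zf'+(1-\xi)f$ is starlike with respect to the origin. For $\alpha\ge0,\gamma\ge0,\beta<1$, $W_\beta(\alpha,\gamma)$ is the class of $f\in\mathcal{A}$ for which there is $\theta\in\mathbb{R}$ with $\mathrm{Re}\left(e^{i\theta}\left((1-\alpha+2\gamma)\frac{f(z)}{z}+(\alpha-2\gamma)f'(z)+\gamma zf''(z)-\beta\right)\right)>0$ for all $z\in\mathbb{D}$. $q$ is the solution of $\frac{d}{dt}\left[t^{1/\nu}q(t)\right]=\frac{1}{\mu\nu}t^{1/\nu-1}\int_0^1 s^{1/\mu-1}\frac{1-st}{(1+st)^3}\,ds$ with $q(0)=1$, with series $q(t)=\sum_{n=0}^\infty\frac{(n+1)^2(-1)^nt^n}{(1+\mu n)(1+\nu n)}$. *)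

(* Defs.v *)
From Stdlib Require Import Reals.
From Coquelicot Require Import Coquelicot.

Local Open Scope R_scope.

Definition in_disk (z : C) : Prop := Cmod z < 1.

(* [ex_derive] is taken over the field of complex numbers, so this is complex
   differentiability at every point of the open unit disk. *)
Definition analytic_in_disk (f : C -> C) : Prop :=
  forall z : C, in_disk z -> ex_derive (K := C_AbsRing) (V := C_NormedModule) f z.

Definition class_A (f : C -> C) : Prop :=
  analytic_in_disk f /\ f (RtoC 0) = RtoC 0 /\ C_derive f (RtoC 0) = RtoC 1.

(* f(z)/z for f(0) = 0, extended to the removable singularity z = 0 by f'(0). *)
Definition div_by_z (f : C -> C) (z : C) : C :=
  if Ceq_dec z (RtoC 0) then C_derive f (RtoC 0) else (f z / z)%C.

Definition class_W (alpha gamma beta : R) (f : C -> C) : Prop :=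
  class_A f /\
  exists theta : R, forall z : C, in_disk z ->
    0 < Re ((cos theta, sin theta) *
            (RtoC (1 - alpha + 2 * gamma)%R * div_by_z f z
             + RtoC (alpha - 2 * gamma)%R * C_derive f z
             + RtoC gamma * z * C_derive (C_derive f) z
             - RtoC beta))%C.

(* At z = 0 the quotient has a removable singularity with value 1, so the
   condition holds there; Coquelicot's 0 / 0 = 0 would make it fail, whence the
   guard z <> 0.  Where z <> 0 the same convention makes the inequality
   force the denominator to be nonzero. *)
Definition class_M (xi : R) (f : C -> C) : Prop :=
  class_A f /\
  forall z : C, in_disk z -> z <> RtoC 0 ->
    0 < Re ((RtoC xi * z * C_derive (fun w => w * C_derive f w) z
             + RtoC (1 - xi)%R * z * C_derive f z)
            / (RtoC xi * z * C_derive f z + RtoC (1 - xi)%R * f z))%C.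

(* Possibly improper integral over (0,1). *)
Definition int01 {V : CompleteNormedModule R_AbsRing} (g : R -> V) : V :=
  RInt_gen g (at_right 0) (at_left 1).

(* The equation is singular at t = 0, where the homogeneous solutions
   c * t ^ (- 1 / nu) blow up; the initial condition q(0) = 1 selects a solution
   only together with continuity at 0. *)
Definition is_q (mu nu : R) (q : R -> R) : Prop :=
  q 0 = 1 /\
  filterlim q (at_right 0) (locally (q 0)) /\
  forall t : R, 0 < t < 1 ->
    is_derive (fun t => Rpower t (1 / nu) * q t) t
      (1 / (mu * nu) * Rpower t (1 / nu - 1) *
       int01 (fun s => Rpower s (1 / mu - 1) * ((1 - s * t) / (1 + s * t) ^ 3))).

(* lambda(t) / k *)
Definition weight (A B C0 : R) (phi : R -> R) (t : R) : R :=
  Rpower t (B - 1) * Rpower (1 - t) (C0 - A - B) * phi (1 - t).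

Definition lambda (k A B C0 : R) (phi : R -> R) (t : R) : R :=
  k * weight A B C0 phi t.

Definition V_op (k A B C0 : R) (phi : R -> R) (f : C -> C) (z : C) : C :=
  (RtoC k *
   int01 (V := C_R_CompleteNormedModule)
     (fun t : R => RtoC (weight A B C0 phi t) * (f (RtoC t * z) / RtoC t)))%C.

(* Main.v *)
Require Import Defs.
From Stdlib Require Import Reals Lra Lia Classical ClassicalEpsilon.
From Coquelicot Require Import Coquelicot.

Local Open Scope R_scope.

(** The proof is by duality.  Let [f(z) = z + a_2 z^2 + ...] be in the class [W],
    let [τ_n] be the moments of [λ], and put
    [L f = ∑ (1 + μ n) (1 + ν n) a_(n+1) z^n]; by the choice of [μ] and [ν] this is
    the operator that defines the class, so [e^(i θ) (L f - β)] has positive real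
    part.  Integrating term by term, [F = V_λ(f)] is [z ∑ τ_n a_(n+1) z^n].

    For [g = ξ z F' + (1 - ξ) F], positivity of [Re (z g' / g)] at [z] means that
    [(1 + x) / 2 z g' + (1 - x) / 2 g] vanishes for no [|x| <= 1]
    ([Re_quotient_pos]).  Up to the factor [z] this expression is
    [ξ T_1 + (1 - ξ) T_0], where
    [T_0 = ∑ τ_n a_(n+1) (1 + n (1 + x) / 2) z^n] and [T_1] has the additional
    factor [n + 1] in its coefficients.  Now [T_0] is the mean of [T_1] along the
    segment from [0] to [z].  Hence as soon as [e^(i θ) T_1] has positive real part
    so have [e^(i θ) T_0] and all convex combinations, which is why the constant
    [β] adapted to convexity, [ξ = 1], serves for every [ξ] ([pascu_quotient_pos]).

    [T_1] is the Hadamard product of [L f] with the kernel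
    [∑ τ_n (n + 1) (1 + n (1 + x) / 2) / ((1 + μ n) (1 + ν n)) z^n].  By the
    positivity of Hadamard products ([hadamard_positivity]) it suffices that the
    real part of the kernel is at least [∫ λ q], and the equation for [β] says
    exactly that the constants match ([convex_functional_ge_0]).

    For the kernel ([kernel_lower_bound]): because [μ >= 1], multiplying
    coefficients by [(n + 1) / ((1 + μ n) (1 + ν n))] averages over dilations
    ([averaged_ge_0]), and [q] is the average of the functions [1 / (1 + r t)^2].
    This leaves the inequality
    [∫ λ(t) (Re h(t ζ) - 1 / (1 + t)^2) dt >= 0] for [|ζ| = 1] and
    [h(w) = (1 + (x - 1) / 2 w) / (1 - w)^2], also with [t] replaced by [ρ t] in
    the bracket.  As [C - A - B > 1], [B < 1] and [φ] increases, [λ(t) / (1 - t)]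
    decreases, so by the second mean value theorem one only needs
    [∫_0^u (1 - t) (Re h(t ζ) - 1 / (1 + t)^2) dt >= 0] for [0 < u < 1]; the
    explicit rational function [minorant] is a lower bound of that integral.

    The function theory behind this is the Taylor expansion of complex
    differentiable functions ([taylor]), obtained from Goursat's theorem for the
    contraction of a circle to an interior point, and term-by-term differentiation
    ([is_derive_CPSeries]) and integration ([is_RInt_gen_power_series]). *)

(* [C] is a normed module over both fields; the suffix tells the source and the
   target of the functions concerned. *)
Notation is_derive_CC := (is_derive (K := C_AbsRing) (V := C_NormedModule)).
Notation ex_derive_CC := (ex_derive (K := C_AbsRing) (V := C_NormedModule)).
Notation is_derive_RC := (is_derive (V := C_R_NormedModule)).
Notation continuous_RC := (continuous (U := C_UniformSpace)).
Notation is_RInt_RC := (is_RInt (V := C_R_NormedModule)).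
Notation is_int01 g := (is_RInt_gen g (at_right 0) (at_left 1)).
Notation Csum_n := (sum_n (G := C_AbelianMonoid)).

(** * Absolutely convergent complex series *)

Definition abs_summable (a : nat -> C) : Prop := ex_series (fun n => Cmod (a n)).

Definition CSeries (a : nat -> C) : C :=
  (Series (fun n => Re (a n)), Series (fun n => Im (a n))).

Lemma C_eq (z w : C) : Re z = Re w -> Im z = Im w -> z = w.
Proof. apply injective_projections. Qed.

Lemma im_le_Cmod (z : C) : Rabs (Im z) <= Cmod z.
Proof. eapply Rle_trans; [apply Rmax_r | apply Rmax_Cmod]. Qed.

Lemma Cmod_le_Re_Im (z : C) : Cmod z <= Rabs (Re z) + Rabs (Im z).
Proof.
  replace z with (RtoC (Re z) + Ci * RtoC (Im z))%C at 1.
  - eapply Rle_trans; [apply Cmod_triangle|].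
    rewrite Cmod_mult, Cmod_Ci, !Cmod_R. lra.
  - apply C_eq; unfold Re, Im, Ci, RtoC; simpl; ring.
Qed.

Lemma ex_series_le_R (a b : nat -> R) :
  (forall n, Rabs (a n) <= b n) -> ex_series b -> ex_series a.
Proof. intros H. apply (ex_series_le a b H). Qed.

Lemma Series_nonneg (a : nat -> R) :
  (forall n, 0 <= a n) -> ex_series a -> 0 <= Series a.
Proof.
  intros H Ha. replace 0 with (0 * Series a) by ring.
  rewrite <- Series_scal_l. apply Series_le; [|exact Ha].
  intros n. specialize (H n). lra.
Qed.

Lemma Rabs_Series_le (a b : nat -> R) :
  (forall n, Rabs (a n) <= b n) -> ex_series b -> Rabs (Series a) <= Series b.
Proof.
  intros H Hb. eapply Rle_trans.
  - apply Series_Rabs, ex_series_le_R with (2 := Hb).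
    intros n. now rewrite Rabs_Rabsolu.
  - apply Series_le; [|exact Hb]. intros n; split; [apply Rabs_pos | apply H].
Qed.

Lemma Series_le_dominated (a b : nat -> R) :
  (forall n, Rabs (a n) <= b n) -> ex_series b -> Series a <= Series b.
Proof.
  intros H Hb. eapply Rle_trans; [apply Rle_abs | now apply Rabs_Series_le].
Qed.

Lemma ex_series_mult_l (k : R) (a : nat -> R) :
  ex_series a -> ex_series (fun n => k * a n).
Proof. exact (ex_series_scal_l k a). Qed.

Lemma abs_summable_le (a : nat -> C) (b : nat -> R) :
  (forall n, Cmod (a n) <= b n) -> ex_series b -> abs_summable a.
Proof.
  intros H Hb. apply ex_series_le_R with (2 := Hb). intros n.
  rewrite Rabs_pos_eq; [apply H | apply Cmod_ge_0].
Qed.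

Lemma abs_summable_Re a : abs_summable a -> ex_series (fun n => Re (a n)).
Proof. apply ex_series_le_R. intros n. apply re_le_Cmod. Qed.

Lemma abs_summable_Im a : abs_summable a -> ex_series (fun n => Im (a n)).
Proof. apply ex_series_le_R. intros n. apply im_le_Cmod. Qed.

Lemma abs_summable_ext a b : (forall n, a n = b n) -> abs_summable a -> abs_summable b.
Proof. intros H. apply ex_series_ext. intros n. now rewrite H. Qed.

Lemma abs_summable_plus a b :
  abs_summable a -> abs_summable b -> abs_summable (fun n => a n + b n)%C.
Proof.
  intros Ha Hb.
  apply abs_summable_le with (fun n => Cmod (a n) + Cmod (b n)).
  - intros n. apply Cmod_triangle.
  - exact (ex_series_plus _ _ Ha Hb).
Qed.

Lemma abs_summable_scal (c : C) a : abs_summable a -> abs_summable (fun n => c * a n)%C.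
Proof.
  intros Ha.
  apply abs_summable_le with (fun n => Cmod c * Cmod (a n)).
  - intros n. rewrite Cmod_mult. lra.
  - exact (ex_series_mult_l (Cmod c) _ Ha).
Qed.

Lemma abs_summable_incr a : abs_summable a -> abs_summable (fun n => a (S n)).
Proof. intros Ha. exact (proj1 (ex_series_incr_1 _) Ha). Qed.

Lemma CSeries_ext a b : (forall n, a n = b n) -> CSeries a = CSeries b.
Proof.
  intros H. apply C_eq; simpl; apply Series_ext; intros n; now rewrite H.
Qed.

Lemma CSeries_plus a b : abs_summable a -> abs_summable b ->
  CSeries (fun n => a n + b n)%C = (CSeries a + CSeries b)%C.
Proof.
  intros Ha Hb. apply C_eq; simpl.
  - rewrite <- Series_plus by (now apply abs_summable_Re).
    apply Series_ext; intros n; apply re_plus.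
  - rewrite <- Series_plus by (now apply abs_summable_Im).
    apply Series_ext; intros n; apply im_plus.
Qed.

Lemma CSeries_scal c a : abs_summable a ->
  CSeries (fun n => c * a n)%C = (c * CSeries a)%C.
Proof.
  intros Ha.
  assert (HR := abs_summable_Re a Ha). assert (HI := abs_summable_Im a Ha).
  apply C_eq.
  - rewrite re_mult. cbn [CSeries Re Im fst snd].
    rewrite <- !Series_scal_l, <- Series_minus;
      [| now apply (@ex_series_scal R_AbsRing) ..].
    apply Series_ext; intros n; apply re_mult.
  - rewrite im_mult. cbn [CSeries Re Im fst snd].
    rewrite <- !Series_scal_l, <- Series_plus;
      [| now apply (@ex_series_scal R_AbsRing) ..].
    apply Series_ext; intros n; apply im_mult.
Qed.

Lemma CSeries_minus a b : abs_summable a -> abs_summable b ->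
  CSeries (fun n => a n - b n)%C = (CSeries a - CSeries b)%C.
Proof.
  intros Ha Hb.
  rewrite (CSeries_ext _ (fun n => a n + (-(1)) * b n)%C) by (intros n; ring).
  rewrite CSeries_plus, CSeries_scal; [ring | assumption .. | ].
  now apply abs_summable_scal.
Qed.

Lemma CSeries_incr a : abs_summable a ->
  CSeries a = (a 0%nat + CSeries (fun n => a (S n)))%C.
Proof.
  intros Ha. apply C_eq; simpl; rewrite Series_incr_1; auto.
  - now apply abs_summable_Re.
  - now apply abs_summable_Im.
Qed.

Lemma Cmod_CSeries_le a : abs_summable a ->
  Cmod (CSeries a) <= Series (fun n => Cmod (a n)).
Proof.
  intros Ha. set (S0 := CSeries a).
  destruct (Ceq_dec S0 0) as [E|N].
  - rewrite E, Cmod_0. apply Series_nonneg; [intros n; apply Cmod_ge_0 | exact Ha].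
  - assert (P := proj1 (Cmod_gt_0 S0) N).
    (* rotate the sum onto the positive axis *)
    set (u := (Cconj S0 / Cmod S0)%C).
    assert (Nz : RtoC (Cmod S0) <> 0) by (intros E; apply RtoC_inj in E; lra).
    assert (Hu : Cmod u = 1).
    { unfold u. rewrite Cmod_div by exact Nz.
      rewrite Cmod_conj, Cmod_R, (Rabs_pos_eq (Cmod S0)) by lra. field; lra. }
    assert (E : RtoC (Cmod S0) = (u * S0)%C).
    { unfold u. replace (Cconj S0 / Cmod S0 * S0)%C with (S0 * Cconj S0 / Cmod S0)%C
        by (field; exact Nz).
      rewrite <- Cmod2_conj, RtoC_pow. field; exact Nz. }
    replace (Cmod S0) with (Re (u * S0)%C) by (rewrite <- E; reflexivity).
    unfold S0 at 1. rewrite <- CSeries_scal by exact Ha. unfold CSeries, Re at 1. cbn [fst].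
    apply Series_le_dominated; [|exact Ha].
    intros n. eapply Rle_trans; [apply re_le_Cmod|].
    rewrite Cmod_mult, Hu. lra.
Qed.

Lemma CSeries_single (c : C) : CSeries (fun n => match n with O => c | _ => 0 end) = c.
Proof.
  assert (H : forall x : R, is_series (fun n => match n with O => x | _ => 0 end) x).
  { intros x. apply (is_series_decr_1 (fun n => match n with O => x | _ => 0 end)).
    replace (plus x _) with 0 by (unfold plus, opp; simpl; ring).
    unfold is_series. apply filterlim_ext with (fun _ => 0).
    - intros n. rewrite sum_n_const. ring.
    - apply filterlim_const. }
  apply C_eq; unfold CSeries; simpl.
  - rewrite (Series_ext _ (fun n => match n with O => Re c | _ => 0 end)).
    + apply is_series_unique, H.
    + now intros [|n].
  - rewrite (Series_ext _ (fun n => match n with O => Im c | _ => 0 end)).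
    + apply is_series_unique, H.
    + now intros [|n].
Qed.

(** * Complex power series *)

Lemma Rdiv_lt_1 s r : 0 <= s < r -> 0 <= s / r < 1.
Proof.
  intros H. split; [apply Rmult_le_pos; [lra | left; apply Rinv_0_lt_compat; lra]|].
  apply Rmult_lt_reg_r with r; [lra|]. unfold Rdiv. rewrite Rmult_assoc, Rinv_l; lra.
Qed.

Definition converges_in (r : R) (c : nat -> C) : Prop :=
  forall s, 0 <= s < r -> ex_series (fun n => Cmod (c n) * s ^ n).

Definition CPSeries (c : nat -> C) (z : C) : C := CSeries (fun n => c n * z ^ n)%C.

Lemma converges_in_abs r c z :
  converges_in r c -> Cmod z < r -> abs_summable (fun n => c n * z ^ n)%C.
Proof.
  intros H Hz. apply abs_summable_le with (fun n => Cmod (c n) * Cmod z ^ n).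
  - intros n. rewrite Cmod_mult, Cmod_pow. lra.
  - apply H. split; [apply Cmod_ge_0 | exact Hz].
Qed.

Lemma converges_in_le_mult r c (d : nat -> C) M :
  (forall n, Cmod (d n) <= M * Cmod (c n)) -> converges_in r c -> converges_in r d.
Proof.
  intros H Hc s Hs.
  apply ex_series_le_R with (fun n => M * (Cmod (c n) * s ^ n)).
  - intros n. assert (P := pow_le s n (proj1 Hs)).
    rewrite Rabs_pos_eq by (apply Rmult_le_pos; [apply Cmod_ge_0 | exact P]).
    rewrite <- Rmult_assoc. apply Rmult_le_compat_r; auto.
  - exact (ex_series_mult_l M _ (Hc s Hs)).
Qed.

Lemma converges_in_bounded r c M :
  0 < r -> (forall n, Cmod (c n) * r ^ n <= M) -> converges_in r c.
Proof.
  intros Hr HM s Hs.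
  assert (Hq := Rdiv_lt_1 s r Hs).
  apply ex_series_le_R with (fun n => M * (s / r) ^ n).
  - intros n. assert (P := pow_le s n (proj1 Hs)).
    rewrite Rabs_pos_eq by (apply Rmult_le_pos; [apply Cmod_ge_0 | exact P]).
    replace (Cmod (c n) * s ^ n) with (Cmod (c n) * r ^ n * (s / r) ^ n).
    + apply Rmult_le_compat_r; [apply pow_le; lra | apply HM].
    + rewrite Rmult_assoc, <- Rpow_mult_distr. do 2 f_equal. field; lra.
  - apply (ex_series_mult_l M). apply ex_series_geom. rewrite Rabs_pos_eq; lra.
Qed.

(** Among the [n] terms [1, q, ..., q^(n-1)] each is at least [q^n]. *)
Lemma INR_pow_le q n : 0 <= q < 1 -> INR n * q ^ n <= / (1 - q).
Proof.
  intros Hq.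
  assert (H : INR n * q ^ n * (1 - q) <= 1 - q ^ n).
  { induction n as [|n IH]; [simpl; lra|].
    rewrite S_INR. simpl. assert (P := pow_le q n (proj1 Hq)).
    assert (Pn := pos_INR n).
    assert (q * (INR n * q ^ n * (1 - q)) <= q * (1 - q ^ n)) by (apply Rmult_le_compat_l; lra).
    assert (0 <= q ^ n * (1 - q)) by (apply Rmult_le_pos; lra).
    assert (q * (q ^ n * (1 - q)) <= 1 * (q ^ n * (1 - q))) by (apply Rmult_le_compat_r; lra).
    assert (q * (1 - q ^ n) = q - q * q ^ n) by ring. nra. }
  apply Rmult_le_reg_r with (1 - q); [lra|]. rewrite Rinv_l by lra.
  assert (P := pow_le q n (proj1 Hq)). lra.
Qed.

Lemma converges_in_INR r c :
  converges_in r c -> converges_in r (fun n => INR n * c n)%C.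
Proof.
  intros H s Hs. set (s' := (s + r) / 2).
  assert (Hs' : 0 < s' /\ s < s' < r) by (unfold s'; lra).
  assert (Hq := Rdiv_lt_1 s s' ltac:(lra)).
  apply ex_series_le_R with (fun n => / (1 - s / s') * (Cmod (c n) * s' ^ n)).
  - intros n. assert (P := pow_le s n (proj1 Hs)).
    rewrite Rabs_pos_eq by (apply Rmult_le_pos; [apply Cmod_ge_0 | exact P]).
    rewrite Cmod_mult, Cmod_R, Rabs_pos_eq by apply pos_INR.
    replace (INR n * Cmod (c n) * s ^ n)
      with (INR n * (s / s') ^ n * (Cmod (c n) * s' ^ n)).
    + apply Rmult_le_compat_r; [|now apply INR_pow_le].
      apply Rmult_le_pos; [apply Cmod_ge_0 | apply pow_le; lra].
    + replace (s ^ n) with ((s / s') ^ n * s' ^ n); [ring|].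
      rewrite <- Rpow_mult_distr. f_equal. field; lra.
  - apply (ex_series_mult_l (/ (1 - s / s'))). apply H. lra.
Qed.

Lemma converges_in_incr r c : 
  converges_in r c -> converges_in r (fun n => c (S n)).
Proof.
  intros H s Hs. set (s' := (s + r) / 2).
  assert (Hs' : 0 < s' /\ s < s' < r) by (unfold s'; lra).
  apply ex_series_le_R with (fun n => / s' * (Cmod (c (S n)) * s' ^ S n)).
  - intros n. assert (P := pow_le s n (proj1 Hs)).
    rewrite Rabs_pos_eq by (apply Rmult_le_pos; [apply Cmod_ge_0 | exact P]).
    replace (/ s' * (Cmod (c (S n)) * s' ^ S n)) with (Cmod (c (S n)) * s' ^ n)
      by (simpl; field; lra).
    apply Rmult_le_compat_l; [apply Cmod_ge_0 | apply pow_incr; lra].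
  - apply (ex_series_mult_l (/ s')).
    apply (proj1 (ex_series_incr_1 (fun n => Cmod (c n) * s' ^ n))). apply H. lra.
Qed.

Definition CPS_derive (c : nat -> C) (n : nat) : C := (INR (S n) * c (S n))%C.

Lemma converges_in_derive r c : converges_in r c -> converges_in r (CPS_derive c).
Proof.
  intros H. exact (converges_in_incr r _ (converges_in_INR r c H)).
Qed.

Lemma converges_in_plus r c d :
  converges_in r c -> converges_in r d -> converges_in r (fun n => c n + d n)%C.
Proof.
  intros Hc Hd s Hs.
  apply ex_series_le_R with (fun n => Cmod (c n) * s ^ n + Cmod (d n) * s ^ n).
  - intros n. assert (P := pow_le s n (proj1 Hs)).
    rewrite Rabs_pos_eq by (apply Rmult_le_pos; [apply Cmod_ge_0 | exact P]).
    rewrite <- Rmult_plus_distr_r. apply Rmult_le_compat_r; [exact P | apply Cmod_triangle].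
  - exact (ex_series_plus _ _ (Hc s Hs) (Hd s Hs)).
Qed.

Lemma converges_in_scal r k c : converges_in r c -> converges_in r (fun n => k * c n)%C.
Proof. apply converges_in_le_mult with (Cmod k). intros n. rewrite Cmod_mult. lra. Qed.

Lemma converges_in_succ r c : converges_in r c -> converges_in r (fun n => (INR n + 1) * c n)%C.
Proof.
  intros H. assert (A := converges_in_plus r _ _ (converges_in_INR r c H) H).
  intros s Hs. generalize (A s Hs). apply ex_series_ext. intros n. do 2 f_equal. ring.
Qed.

Lemma CPSeries_0 c : CPSeries c 0 = c 0%nat.
Proof.
  unfold CPSeries. rewrite <- (CSeries_single (c 0%nat)). apply CSeries_ext.
  intros [|n]; [|rewrite Cpow_S]; simpl; ring.
Qed.

Lemma CPSeries_incr r c z : converges_in r c -> Cmod z < r ->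
  CPSeries c z = (c 0%nat + z * CPSeries (fun n => c (S n)) z)%C.
Proof.
  intros H Hz. unfold CPSeries.
  rewrite CSeries_incr by (now apply converges_in_abs with r).
  rewrite <- CSeries_scal by (apply converges_in_abs with r; [now apply converges_in_incr | exact Hz]).
  f_equal; [simpl; ring|]. apply CSeries_ext. intros n. rewrite Cpow_S. ring.
Qed.

(** The derivative of [z^n] up to an error of second order, with a constant
    that is still summable against the coefficients of a power series. *)
Lemma Cpow_second_order s z w n :
  0 < s -> Cmod z <= s -> Cmod w <= s ->
  Cmod (w ^ n - z ^ n - (w - z) * (INR n * z ^ pred n)) * s ^ 2
    <= INR n * INR n * s ^ n * Cmod (w - z) ^ 2.
Proof.
  intros Hs Hz Hw. assert (P2 := pow2_ge_0 (Cmod (w - z))).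
  induction n as [|n IH].
  - replace (w ^ 0 - z ^ 0 - (w - z) * (INR 0 * z ^ pred 0))%C with (RtoC 0)
      by (cbn [Cpow pred INR]; ring).
    rewrite Cmod_0. simpl. lra.
  - assert (E : (w ^ S n - z ^ S n - (w - z) * (INR (S n) * z ^ pred (S n)))%C
      = (w * (w ^ n - z ^ n - (w - z) * (INR n * z ^ pred n))
         + INR n * z ^ pred n * ((w - z) * (w - z)))%C).
    { rewrite !Cpow_S, S_INR, RtoC_plus. cbn [pred].
      destruct n as [|n]; [cbn [Cpow pred INR]; ring|]. cbn [pred]. rewrite !Cpow_S. ring. }
    rewrite E. clear E.
    eapply Rle_trans.
    { apply Rmult_le_compat_r; [apply pow2_ge_0|]. apply Cmod_triangle. }
    rewrite !Cmod_mult, Cmod_R, Rabs_pos_eq by apply pos_INR. rewrite Cmod_pow.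
    set (e := Cmod (w ^ n - z ^ n - (w - z) * (INR n * z ^ pred n))) in *.
    set (d := Cmod (w - z)) in *.
    assert (He : 0 <= e) by apply Cmod_ge_0.
    assert (Hd : 0 <= d) by apply Cmod_ge_0.
    assert (A1 : Cmod w * e * s ^ 2 <= s * (INR n * INR n * s ^ n * d ^ 2)).
    { apply Rle_trans with (s * (e * s ^ 2)).
      - rewrite Rmult_assoc. apply Rmult_le_compat_r; [|exact Hw].
        apply Rmult_le_pos; [exact He | apply pow2_ge_0].
      - apply Rmult_le_compat_l; lra. }
    assert (A2 : INR n * Cmod z ^ pred n * (d * d) * s ^ 2 <= INR n * s ^ S n * d ^ 2).
    { destruct n as [|n]; [simpl; lra|]. cbn [pred].
      replace (INR (S n) * s ^ S (S n) * d ^ 2) with (INR (S n) * s ^ n * (d * d) * s ^ 2)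
        by (simpl; ring).
      apply Rmult_le_compat_r; [apply pow2_ge_0|].
      apply Rmult_le_compat_r; [nra|].
      apply Rmult_le_compat_l; [apply pos_INR|].
      apply pow_incr. split; [apply Cmod_ge_0 | exact Hz]. }
    assert (Pn := pos_INR n). assert (Ps := pow_lt s n Hs).
    rewrite S_INR. simpl (s ^ S n) in *.
    set (u := INR n) in *. set (v := s * s ^ n). set (d2 := d ^ 2) in *.
    assert (Pv : 0 <= v) by (apply Rmult_le_pos; lra).
    replace (s * (u * u * s ^ n * d2)) with (u * u * (v * d2)) in A1 by (unfold v; ring).
    replace (u * v * d2) with (u * (v * d2)) in A2 by ring.
    assert (0 <= v * d2) by (apply Rmult_le_pos; assumption).
    replace ((u + 1) * (u + 1) * v * d2) with (u * u * (v * d2) + u * (v * d2) + (u + 1) * (v * d2)) by ring.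
    assert (0 <= (u + 1) * (v * d2)) by (apply Rmult_le_pos; lra).
    fold v in A2. lra.
Qed.

Lemma is_C_derive_second_order (f : C -> C) (z l : C) (d K : R) :
  0 < d -> (forall w, Cmod (w - z) < d -> Cmod (f w - f z - (w - z) * l) <= K * Cmod (w - z) ^ 2) ->
  is_derive_CC f z l.
Proof.
  intros Hd H. split; [apply is_linear_scal_l|].
  intros x Hx eps.
  assert (E : x = z).
  { symmetry. exact (@is_filter_lim_locally_unique C_AbsRing (AbsRing_NormedModule C_AbsRing) z x Hx). }
  subst x.
  assert (HK : 0 < Rmax K 1) by (eapply Rlt_le_trans; [apply Rlt_0_1 | apply Rmax_r]).
  assert (Hp : 0 < Rmin d (eps / Rmax K 1)).
  { apply Rmin_glb_lt; [exact Hd|]. apply Rdiv_lt_0_compat; [apply cond_pos | exact HK]. }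
  exists (mkposreal _ Hp). intros w Hw.
  change (Cmod (w - z) < Rmin d (eps / Rmax K 1)) in Hw.
  assert (H1 : Cmod (w - z) < d) by (eapply Rlt_le_trans; [exact Hw | apply Rmin_l]).
  assert (H2 : Cmod (w - z) < eps / Rmax K 1) by (eapply Rlt_le_trans; [exact Hw | apply Rmin_r]).
  change (Cmod (f w - f z - (w - z) * l) <= eps * Cmod (w - z)).
  eapply Rle_trans; [apply H, H1|].
  assert (P := Cmod_ge_0 (w - z)).
  apply Rle_trans with (Rmax K 1 * Cmod (w - z) * Cmod (w - z)).
  - simpl. rewrite Rmult_1_r, <- Rmult_assoc. apply Rmult_le_compat_r; [exact P|].
    apply Rmult_le_compat_r; [exact P | apply Rmax_l].
  - apply Rmult_le_compat_r; [exact P|]. left.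
    replace (pos eps) with (Rmax K 1 * (eps / Rmax K 1)) by (field; lra).
    now apply Rmult_lt_compat_l.
Qed.

(** Second-order errors of the monomials are summable, so term-by-term
    differentiation needs no uniform convergence of the derivatives. *)
Lemma is_derive_CPSeries r c z : converges_in r c -> Cmod z < r ->
  is_derive_CC (CPSeries c) z (CPSeries (CPS_derive c) z).
Proof.
  intros H Hz. assert (Pz := Cmod_ge_0 z). set (s := (Cmod z + r) / 2).
  assert (Hs : 0 < s /\ Cmod z < s < r) by (unfold s; lra).
  assert (S2 : 0 < s ^ 2) by (apply pow_lt; lra).
  set (e := fun n => INR n * INR n * (Cmod (c n) * s ^ n)).
  assert (He : ex_series e).
  { assert (A := converges_in_INR r _ (converges_in_INR r c H) s ltac:(lra)).
    revert A. apply ex_series_ext. intros n. unfold e.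
    rewrite !Cmod_mult, Cmod_R, Rabs_pos_eq by apply pos_INR. simpl. ring. }
  apply is_C_derive_second_order with (d := s - Cmod z) (K := Series e / s ^ 2); [lra|].
  intros w Hw.
  assert (Hw' : Cmod w < s).
  { replace w with ((w - z) + z)%C by ring.
    eapply Rle_lt_trans; [apply Cmod_triangle | lra]. }
  assert (Sw : abs_summable (fun n => c n * w ^ n)%C) by (apply converges_in_abs with r; [exact H | lra]).
  assert (Sz : abs_summable (fun n => c n * z ^ n)%C) by (apply converges_in_abs with r; [exact H | lra]).
  assert (Sd : abs_summable (fun n => CPS_derive c n * z ^ n)%C)
    by (apply converges_in_abs with r; [now apply converges_in_derive | lra]).
  (* the derivative series re-indexed to match the monomials *)
  assert (Sd' : abs_summable (fun n => c n * (INR n * z ^ pred n))%C).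
  { apply (ex_series_incr_1 (fun n => Cmod (c n * (INR n * z ^ pred n)))).
    revert Sd. apply ex_series_ext. intros n. unfold CPS_derive. cbn [pred]. f_equal. ring. }
  assert (Ed : CPSeries (CPS_derive c) z = CSeries (fun n => c n * (INR n * z ^ pred n))%C).
  { rewrite (CSeries_incr (fun n => c n * (INR n * z ^ pred n))%C) by exact Sd'.
    change (INR 0) with 0. replace (c 0%nat * (0 * z ^ pred 0))%C with (RtoC 0) by (cbn [pred Cpow]; ring).
    rewrite Cplus_0_l. apply CSeries_ext. intros n. unfold CPS_derive. cbn [pred]. ring. }
  rewrite Ed. unfold CPSeries.
  rewrite <- CSeries_scal by exact Sd'.
  rewrite <- CSeries_minus by assumption.
  assert (Sm : abs_summable (fun n => c n * w ^ n - c n * z ^ n)%C).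
  { apply abs_summable_ext with (fun n => c n * w ^ n + (-(1)) * (c n * z ^ n))%C;
      [intros n; ring|].
    apply abs_summable_plus; [exact Sw | now apply abs_summable_scal]. }
  rewrite <- CSeries_minus by (try exact Sm; now apply abs_summable_scal).
  assert (B : forall n, Cmod (c n * w ^ n - c n * z ^ n - (w - z) * (c n * (INR n * z ^ pred n)))
      <= Cmod (w - z) ^ 2 / s ^ 2 * e n).
  { intros n.
    replace (c n * w ^ n - c n * z ^ n - (w - z) * (c n * (INR n * z ^ pred n)))%C
      with (c n * (w ^ n - z ^ n - (w - z) * (INR n * z ^ pred n)))%C by ring.
    rewrite Cmod_mult. apply Rmult_le_reg_r with (s ^ 2); [exact S2|].
    replace (Cmod (w - z) ^ 2 / s ^ 2 * e n * s ^ 2)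
      with (Cmod (c n) * (INR n * INR n * s ^ n * Cmod (w - z) ^ 2))
      by (unfold e; field; lra).
    rewrite Rmult_assoc. apply Rmult_le_compat_l; [apply Cmod_ge_0|].
    apply Cpow_second_order; lra. }
  eapply Rle_trans; [apply Cmod_CSeries_le|].
  - apply abs_summable_le with (1 := B). now apply ex_series_mult_l.
  - eapply Rle_trans.
    + apply Series_le with (b := fun n => Cmod (w - z) ^ 2 / s ^ 2 * e n);
        [intros n; split; [apply Cmod_ge_0 | apply B] | now apply ex_series_mult_l].
    + rewrite Series_scal_l. right. field; lra.
Qed.

(** * Calculus of complex-valued functions of a real variable *)

Lemma norm_C_R (z : C) : norm (z : C_R_NormedModule) = Cmod z.
Proof.
  change (sqrt (Rabs (fst z) ^ 2 + Rabs (snd z) ^ 2) = sqrt (fst z ^ 2 + snd z ^ 2)).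
  now rewrite !RPow_abs, !(Rabs_pos_eq (_ ^ 2)) by apply pow2_ge_0.
Qed.

Lemma continuous_C_intro (f : R -> C) x :
  continuous (fun t => Re (f t)) x -> continuous (fun t => Im (f t)) x ->
  continuous_RC f x.
Proof.
  intros H1 H2. apply filterlim_locally. intros eps.
  assert (A := proj1 (filterlim_locally _ _) H1 eps).
  assert (B := proj1 (filterlim_locally _ _) H2 eps).
  generalize (filter_and _ _ A B). apply filter_imp. intros t [H H']. split; assumption.
Qed.

Lemma continuous_C_Re (f : R -> C) x :
  continuous_RC f x -> continuous (fun t => Re (f t)) x.
Proof.
  intros H. apply filterlim_locally. intros eps.
  generalize (proj1 (filterlim_locally _ _) H eps). apply filter_imp. now intros t [A _].
Qed.

Lemma continuous_C_Im (f : R -> C) x :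
  continuous_RC f x -> continuous (fun t => Im (f t)) x.
Proof.
  intros H. apply filterlim_locally. intros eps.
  generalize (proj1 (filterlim_locally _ _) H eps). apply filter_imp. now intros t [_ A].
Qed.

Lemma continuous_Cmult (f g : R -> C) x :
  continuous_RC f x -> continuous_RC g x ->
  continuous_RC (fun t => f t * g t)%C x.
Proof.
  intros Hf Hg.
  assert (A := continuous_C_Re f x Hf). assert (B := continuous_C_Im f x Hf).
  assert (A' := continuous_C_Re g x Hg). assert (B' := continuous_C_Im g x Hg).
  apply continuous_C_intro.
  - apply (continuous_minus (fun t => Re (f t) * Re (g t)) (fun t => Im (f t) * Im (g t)));
      apply (continuous_mult (K := R_AbsRing)); assumption.
  - apply (continuous_plus (fun t => Re (f t) * Im (g t)) (fun t => Im (f t) * Re (g t)));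
      apply (continuous_mult (K := R_AbsRing)); assumption.
Qed.

Lemma continuous_Cplus (f g : R -> C) x :
  continuous_RC f x -> continuous_RC g x ->
  continuous_RC (fun t => f t + g t)%C x.
Proof.
  intros Hf Hg. apply (continuous_plus (V := C_R_NormedModule) f g x Hf Hg).
Qed.

Lemma continuous_C_comp (g : C -> C) (p : R -> C) t :
  ex_derive_CC g (p t) ->
  continuous_RC p t ->
  continuous_RC (fun s => g (p s)) t.
Proof.
  intros Hg Hp. apply filterlim_comp with (1 := Hp).
  intros Q HQ. apply (locally_C (p t)). exact (ex_derive_continuous g (p t) Hg Q HQ).
Qed.

Lemma continuous_of_ex_derive (f : R -> R) x : ex_derive f x -> continuous f x.
Proof. exact (ex_derive_continuous (V := R_NormedModule) f x). Qed.

Lemma continuous_RC_of_derive (f : R -> C) x l : is_derive_RC f x l -> continuous_RC f x.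
Proof. intros H. apply (ex_derive_continuous (V := C_R_NormedModule)). now exists l. Qed.

Lemma ball_R_elim (x e y : R) : ball x e y -> Rabs (y - x) < e.
Proof. exact (fun H => H). Qed.

Lemma ball_R_intro (x e y : R) : Rabs (y - x) < e -> ball x e y.
Proof. exact (fun H => H). Qed.

Lemma is_derive_C_intro (f : R -> C) x (l : C) :
  is_derive (fun t => Re (f t)) x (Re l) -> is_derive (fun t => Im (f t)) x (Im l) ->
  is_derive_RC f x l.
Proof.
  intros [_ H1] [_ H2]. split; [apply is_linear_scal_l|].
  intros y Hy eps.
  assert (He : 0 < eps / 2) by (assert (A := cond_pos eps); lra).
  generalize (filter_and _ _ (H1 y Hy (mkposreal _ He)) (H2 y Hy (mkposreal _ He))).
  apply filter_imp. intros t [A B]. rewrite norm_C_R.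
  eapply Rle_trans; [apply Cmod_le_Re_Im|].
  simpl pos in A, B. cbv [norm minus plus opp scal] in A, B |- *. simpl in A, B |- *.
  cbv [Re Im fst snd] in *. unfold mult, abs in *; simpl in *. 
  eapply Rle_trans; [apply Rplus_le_compat; [exact A | exact B]|]. lra.
Qed.

Lemma is_derive_C_Re (f : R -> C) x (l : C) :
  is_derive_RC f x l -> is_derive (fun t => Re (f t)) x (Re l).
Proof.
  intros [_ H]. split; [apply is_linear_scal_l|].
  intros y Hy eps. generalize (H y Hy eps). apply filter_imp. intros t A.
  eapply Rle_trans; [|exact A]. rewrite norm_C_R. eapply Rle_trans; [|apply re_le_Cmod].
  apply Rle_refl.
Qed.

Lemma is_derive_C_Im (f : R -> C) x (l : C) :
  is_derive_RC f x l -> is_derive (fun t => Im (f t)) x (Im l).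
Proof.
  intros [_ H]. split; [apply is_linear_scal_l|].
  intros y Hy eps. generalize (H y Hy eps). apply filter_imp. intros t A.
  eapply Rle_trans; [|exact A]. rewrite norm_C_R. eapply Rle_trans; [|apply im_le_Cmod].
  apply Rle_refl.
Qed.

Lemma is_derive_Cmult (f g : R -> C) x (f' g' : C) :
  is_derive_RC f x f' -> is_derive_RC g x g' ->
  is_derive_RC (fun t => f t * g t)%C x (f' * g x + f x * g')%C.
Proof.
  intros Hf Hg.
  assert (A := is_derive_C_Re f x _ Hf). assert (B := is_derive_C_Im f x _ Hf).
  assert (A' := is_derive_C_Re g x _ Hg). assert (B' := is_derive_C_Im g x _ Hg).
  apply is_derive_C_intro.
  - apply is_derive_ext with (fun t => Re (f t) * Re (g t) - Im (f t) * Im (g t));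
      [intros t; now rewrite re_mult|].
    replace (Re _) with ((Re f' * Re (g x) + Re (f x) * Re g') - (Im f' * Im (g x) + Im (f x) * Im g'))
      by (rewrite re_plus, !re_mult; ring).
    apply (is_derive_minus (fun t => Re (f t) * Re (g t)) (fun t => Im (f t) * Im (g t)));
      apply (is_derive_mult (K := R_AbsRing)); auto; intros; apply Rmult_comm.
  - apply is_derive_ext with (fun t => Re (f t) * Im (g t) + Im (f t) * Re (g t));
      [intros t; now rewrite im_mult|].
    replace (Im _) with ((Re f' * Im (g x) + Re (f x) * Im g') + (Im f' * Re (g x) + Im (f x) * Re g'))
      by (rewrite im_plus, !im_mult; ring).
    apply (is_derive_plus (fun t => Re (f t) * Im (g t)) (fun t => Im (f t) * Re (g t)));
      apply (is_derive_mult (K := R_AbsRing)); auto; intros; apply Rmult_comm.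
Qed.

Lemma is_derive_Cconst (c : C) x : is_derive_RC (fun _ : R => c) x (RtoC 0).
Proof. apply (is_derive_const (V := C_R_NormedModule)). Qed.

Lemma is_derive_Cplus (f g : R -> C) x (f' g' : C) :
  is_derive_RC f x f' -> is_derive_RC g x g' ->
  is_derive_RC (fun t => f t + g t)%C x (f' + g')%C.
Proof. exact (is_derive_plus (V := C_R_NormedModule) f g x f' g'). Qed.

(** * Goursat's theorem *)

(** The integral of [g dζ] along [p]; the velocity [dp] is tied to [p] only by the
    hypotheses of the lemmas. *)
Definition path_int (g : C -> C) (p dp : R -> C) (a b : R) : C :=
  RInt (V := C_R_CompleteNormedModule) (fun t => g (p t) * dp t)%C a b.

Lemma path_int_correct g p dp a b : a <= b ->
  (forall t, a <= t <= b -> continuous_RC (fun t => g (p t) * dp t)%C t) ->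
  is_RInt_RC (fun t => g (p t) * dp t)%C a b (path_int g p dp a b).
Proof.
  intros Hab H. apply (RInt_correct (V := C_R_CompleteNormedModule)).
  apply (ex_RInt_continuous (V := C_R_CompleteNormedModule)).
  intros t. rewrite Rmin_left, Rmax_right by exact Hab. apply H.
Qed.

Lemma Cmod_is_RInt_le (f : R -> C) a b (l : C) M : a <= b ->
  (forall t, a <= t <= b -> Cmod (f t) <= M) ->
  is_RInt_RC f a b l -> Cmod l <= (b - a) * M.
Proof.
  intros Hab H Hl. rewrite <- norm_C_R.
  apply (norm_RInt_le_const (V := C_R_NormedModule) f a b l M Hab); [|exact Hl].
  intros t Ht. rewrite norm_C_R. now apply H.
Qed.

Lemma path_int_Chasles g p dp a b c : a <= b -> b <= c ->
  (forall t, a <= t <= c -> continuous_RC (fun t => g (p t) * dp t)%C t) ->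
  path_int g p dp a c = (path_int g p dp a b + path_int g p dp b c)%C.
Proof.
  intros Hab Hbc H.
  apply (is_RInt_unique (V := C_R_CompleteNormedModule)).
  apply (is_RInt_Chasles (V := C_R_NormedModule)) with b.
  - apply path_int_correct; [exact Hab|]. intros; apply H; lra.
  - apply path_int_correct; [exact Hbc|]. intros; apply H; lra.
Qed.

(** Along a short path [g dζ] is nearly the exact form [(u + v (ζ - z0)) dζ]. *)
Lemma path_int_linearize g p dp a b (z0 u v : C) K eta : a <= b ->
  (forall t, a <= t <= b -> is_derive_RC p t (dp t)) ->
  (forall t, a <= t <= b -> continuous_RC dp t) ->
  (forall t, a <= t <= b -> continuous_RC (fun t => g (p t) * dp t)%C t) ->
  (forall t, a <= t <= b -> Cmod (dp t) <= K) ->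
  (forall t, a <= t <= b -> Cmod (g (p t) - (u + v * (p t - z0))) <= eta) ->
  let G := fun z => (u * z + v / 2 * ((z - z0) * (z - z0)))%C in
  Cmod (path_int g p dp a b - (G (p b) - G (p a))) <= (b - a) * (eta * K).
Proof.
  intros Hab Hp Hdp Hc HK Heta G.
  assert (Cp : forall t, a <= t <= b -> continuous_RC p t).
  { intros t Ht. eapply continuous_RC_of_derive. now apply Hp. }
  assert (HL : is_RInt_RC
    (fun t => (u + v * (p t - z0)) * dp t)%C a b (G (p b) - G (p a))%C).
  { apply (is_RInt_derive (V := C_R_CompleteNormedModule) (fun t => G (p t))).
    - intros t. rewrite Rmin_left, Rmax_right by exact Hab. intros Ht.
      assert (D1 := is_derive_Cplus _ _ t _ _ (Hp t Ht) (is_derive_Cconst (- z0)%C t)).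
      assert (D2 := is_derive_Cmult _ _ t _ _ D1 D1).
      assert (D3 := is_derive_Cmult _ _ t _ _ (is_derive_Cconst (v / 2)%C t) D2).
      assert (D4 := is_derive_Cmult _ _ t _ _ (is_derive_Cconst u t) (Hp t Ht)).
      assert (D5 := is_derive_Cplus _ _ t _ _ D4 D3).
      replace ((u + v * (p t - z0)) * dp t)%C with
        (0 * p t + u * dp t + (0 * ((p t + - z0) * (p t + - z0)) +
         v / 2 * ((dp t + 0) * (p t + - z0) + (p t + - z0) * (dp t + 0))))%C.
      + exact D5.
      + field.
    - intros t. rewrite Rmin_left, Rmax_right by exact Hab. intros Ht.
      apply continuous_Cmult; [|now apply Hdp].
      apply continuous_Cplus; [apply continuous_const|].
      apply continuous_Cmult; [apply continuous_const|].
      apply continuous_Cplus; [now apply Cp | apply continuous_const]. }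
  assert (HI := path_int_correct g p dp a b Hab Hc).
  assert (HD := is_RInt_minus (V := C_R_NormedModule) _ _ a b _ _ HI HL).
  apply Cmod_is_RInt_le with (1 := Hab) (3 := HD).
  intros t Ht.
  replace (minus _ _) with ((g (p t) - (u + v * (p t - z0))) * dp t)%C
    by (change (((g (p t) - (u + v * (p t - z0))) * dp t)%C
        = (g (p t) * dp t - (u + v * (p t - z0)) * dp t)%C); ring).
  rewrite Cmod_mult. apply Rmult_le_compat; try apply Cmod_ge_0; auto.
Qed.

(** Bisection: a square on which [Q] failed would contain nested failing squares
    shrinking to a point, against the local hypothesis at that point. *)
Lemma square_induction (Q : R -> R -> R -> Prop) :
  (forall a c w, 0 <= a -> 0 <= c -> 0 < w -> a + w <= 1 -> c + w <= 1 ->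
     Q a c (w / 2) -> Q (a + w / 2) c (w / 2) -> Q a (c + w / 2) (w / 2) ->
     Q (a + w / 2) (c + w / 2) (w / 2) -> Q a c w) ->
  (forall s t, 0 <= s <= 1 -> 0 <= t <= 1 -> exists d, 0 < d /\
     forall a c w, 0 <= a -> 0 <= c -> 0 < w < d -> a + w <= 1 -> c + w <= 1 ->
     a <= s <= a + w -> c <= t <= c + w -> Q a c w) ->
  Q 0 0 1.
Proof.
  intros Hstep Hloc. apply NNPP. intros HN.
  set (bad := fun x : R * R * R => let '(a, c, w) := x in
    0 <= a /\ 0 <= c /\ 0 < w /\ a + w <= 1 /\ c + w <= 1 /\ ~ Q a c w).
  assert (Hnext : forall x, exists y, bad x -> bad y /\
    snd y = snd x / 2 /\ fst (fst x) <= fst (fst y) /\ fst (fst y) + snd y <= fst (fst x) + snd x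
    /\ snd (fst x) <= snd (fst y) /\ snd (fst y) + snd y <= snd (fst x) + snd x).
  { intros [[a c] w]. simpl. 
    destruct (classic (Q a c (w / 2))) as [Q1|Q1];
      [|exists (a, c, w / 2); intros (Ha & Hc & Hw & Ha' & Hc' & HQ); simpl; repeat split; try lra; exact Q1].
    destruct (classic (Q (a + w / 2) c (w / 2))) as [Q2|Q2];
      [|exists (a + w / 2, c, w / 2); intros (Ha & Hc & Hw & Ha' & Hc' & HQ); simpl; repeat split; try lra; exact Q2].
    destruct (classic (Q a (c + w / 2) (w / 2))) as [Q3|Q3];
      [|exists (a, c + w / 2, w / 2); intros (Ha & Hc & Hw & Ha' & Hc' & HQ); simpl; repeat split; try lra; exact Q3].
    exists (a + w / 2, c + w / 2, w / 2); intros (Ha & Hc & Hw & Ha' & Hc' & HQ); simpl; repeat split; try lra.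
    intros Q4. apply HQ. now apply Hstep. }
  set (next := fun x => proj1_sig (constructive_indefinite_description _ (Hnext x))).
  assert (Hn : forall x, bad x -> bad (next x) /\
    snd (next x) = snd x / 2 /\ fst (fst x) <= fst (fst (next x)) /\ fst (fst (next x)) + snd (next x) <= fst (fst x) + snd x
    /\ snd (fst x) <= snd (fst (next x)) /\ snd (fst (next x)) + snd (next x) <= snd (fst x) + snd x).
  { intros x. unfold next. apply (proj2_sig (constructive_indefinite_description _ (Hnext x))). }
  set (x := fun n => Nat.iter n next (0, 0, 1)).
  set (a := fun n => fst (fst (x n))). set (c := fun n => snd (fst (x n))). set (w := fun n => snd (x n)).
  assert (Hbad : forall n, bad (x n)).
  { induction n as [|n IH]; [simpl; repeat split; try lra; exact HN | apply Hn, IH]. }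
  assert (Hb : forall n, 0 <= a n /\ 0 <= c n /\ 0 < w n /\ a n + w n <= 1 /\ c n + w n <= 1
      /\ ~ Q (a n) (c n) (w n)).
  { intros n. generalize (Hbad n). unfold a, c, w, bad. now destruct (x n) as [[? ?] ?]. }
  assert (Hst : forall n, w (S n) = w n / 2 /\ a n <= a (S n) /\ a (S n) + w (S n) <= a n + w n
     /\ c n <= c (S n) /\ c (S n) + w (S n) <= c n + w n).
  { intros n. exact (proj2 (Hn (x n) (Hbad n))). }
  assert (Hmono : forall n m, a n <= a (n + m)%nat /\ a (n + m)%nat + w (n + m)%nat <= a n + w n
     /\ c n <= c (n + m)%nat /\ c (n + m)%nat + w (n + m)%nat <= c n + w n).
  { intros n m. induction m as [|m IH].
    - rewrite Nat.add_0_r. lra.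
    - rewrite Nat.add_succ_r. assert (A := Hst (n + m)%nat). lra. }
  assert (Hwn : forall n, w n = / 2 ^ n).
  { induction n as [|n IH]; [unfold w, x; simpl; lra|].
    rewrite (proj1 (Hst n)), IH. simpl. field. apply pow_nonzero; lra. }
  assert (Lim : forall u : nat -> R, (forall n, u n <= u (S n)) ->
     (forall n, u n + w n <= 1) -> (forall n m, u (n + m)%nat + w (n + m)%nat <= u n + w n) ->
     (forall n m, u n <= u (n + m)%nat) ->
     exists l, forall n, u n <= l <= u n + w n).
  { intros u H1 H2 H3 H4.
    destruct (ex_finite_lim_seq_incr u 1 H1) as [l Hl].
    { intros n. assert (A := Hb n). assert (B := H2 n). lra. }
    exists l. intros n.
    assert (Hl' := proj1 (is_lim_seq_incr_n u n l) Hl).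
    split.
    - apply (is_lim_seq_le (fun _ => u n) (fun m => u (m + n)%nat) (u n) l);
        [|apply is_lim_seq_const | exact Hl'].
      intros m. rewrite Nat.add_comm. apply H4.
    - apply (is_lim_seq_le (fun m => u (m + n)%nat) (fun _ => u n + w n) l (u n + w n));
        [| exact Hl' | apply is_lim_seq_const].
      intros m. rewrite Nat.add_comm. assert (A := Hb (n + m)%nat). assert (B := H3 n m). lra. }
  destruct (Lim a) as [s Hs]; [apply Hst | apply Hb | apply Hmono | apply Hmono |].
  destruct (Lim c) as [t Ht]; [apply Hst | apply Hb | apply Hmono | apply Hmono |].
  assert (B0 := Hb 0%nat). assert (S0 := Hs 0%nat). assert (T0 := Ht 0%nat).
  destruct (Hloc s t) as [d [Hd HQ]]; [lra | lra |].
  destruct (pow_lt_1_zero (/ 2)) with (y := d) as [N HNn]; [rewrite Rabs_pos_eq; lra | exact Hd |].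
  specialize (HNn N (Nat.le_refl N)). rewrite Rabs_pos_eq in HNn by (apply pow_le; lra).
  rewrite pow_inv, <- Hwn in HNn.
  destruct (Hb N) as (A1 & A2 & A3 & A4 & A5 & A6).
  apply A6, HQ; try lra; auto.
Qed.

(** The contour is the image of the boundary of the unit square under a map [P].
    With a map that contracts a circle towards an interior point this yields
    Cauchy's formula for circles directly, without primitives or homotopies. *)

Section Goursat.

Variables (g : C -> C) (P P1 P2 : R -> R -> C) (K : R).
Hypothesis HP1 : forall s t, is_derive_RC (fun s => P s t) s (P1 s t).
Hypothesis HP2 : forall s t, is_derive_RC (fun t => P s t) t (P2 s t).
Hypothesis CP1 : forall s t, continuous_RC (fun s => P1 s t) s.
Hypothesis CP2 : forall s t, continuous_RC (fun t => P2 s t) t.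
Hypothesis BP1 : forall s t, 0 <= s <= 1 -> 0 <= t <= 1 -> Cmod (P1 s t) <= K.
Hypothesis BP2 : forall s t, 0 <= s <= 1 -> 0 <= t <= 1 -> Cmod (P2 s t) <= K.
Hypothesis Lip : forall s t s' t', 0 <= s <= 1 -> 0 <= t <= 1 -> 0 <= s' <= 1 -> 0 <= t' <= 1 ->
  Cmod (P s' t' - P s t) <= K * (Rabs (s' - s) + Rabs (t' - t)).
Hypothesis Hg : forall s t, 0 <= s <= 1 -> 0 <= t <= 1 ->
  ex_derive_CC g (P s t).

Let H1 (t a b : R) : C := path_int g (fun s => P s t) (fun s => P1 s t) a b.
Let H2 (s a b : R) : C := path_int g (fun t => P s t) (fun t => P2 s t) a b.

(* the integral around the image of the square with corner (a, c) and side w *)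
Let circ (a c w : R) : C :=
  (H1 c a (a + w) + H2 (a + w) c (c + w) - H1 (c + w) a (a + w) - H2 a c (c + w))%C.

Let cont1 s t : 0 <= s <= 1 -> 0 <= t <= 1 ->
  continuous_RC (fun s => g (P s t) * P1 s t)%C s.
Proof.
  intros Hs Ht. apply continuous_Cmult; [|apply CP1].
  apply (continuous_C_comp g (fun s => P s t)); [now apply Hg|].
  eapply continuous_RC_of_derive. apply HP1.
Qed.

Let cont2 s t : 0 <= s <= 1 -> 0 <= t <= 1 ->
  continuous_RC (fun t => g (P s t) * P2 s t)%C t.
Proof.
  intros Hs Ht. apply continuous_Cmult; [|apply CP2].
  apply (continuous_C_comp g (fun t => P s t)); [now apply Hg|].
  eapply continuous_RC_of_derive. apply HP2.
Qed.

Let circ_split a c w : 0 <= a -> 0 <= c -> 0 < w -> a + w <= 1 -> c + w <= 1 ->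
  circ a c w = (circ a c (w / 2) + circ (a + w / 2) c (w / 2)
    + circ a (c + w / 2) (w / 2) + circ (a + w / 2) (c + w / 2) (w / 2))%C.
Proof.
  intros Ha Hc Hw Ha' Hc'. unfold circ.
  replace (a + w / 2 + w / 2) with (a + w) by field.
  replace (c + w / 2 + w / 2) with (c + w) by field.
  assert (E1 : forall t, 0 <= t <= 1 -> H1 t a (a + w) = (H1 t a (a + w / 2) + H1 t (a + w / 2) (a + w))%C).
  { intros t Ht. apply (path_int_Chasles g (fun s => P s t) (fun s => P1 s t)); [lra | lra |]. intros s Hs. apply cont1; lra. }
  assert (E2 : forall s, 0 <= s <= 1 -> H2 s c (c + w) = (H2 s c (c + w / 2) + H2 s (c + w / 2) (c + w))%C).
  { intros s Hs. apply (path_int_Chasles g (P s) (P2 s)); [lra | lra |]. intros t Ht. apply cont2; lra. }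
  rewrite (E1 c), (E1 (c + w)), (E2 a), (E2 (a + w)) by lra. ring.
Qed.

Let circ_small s t eps : 0 <= s <= 1 -> 0 <= t <= 1 -> 0 < eps -> exists d, 0 < d /\
  forall a c w, 0 <= a -> 0 <= c -> 0 < w < d -> a + w <= 1 -> c + w <= 1 ->
    a <= s <= a + w -> c <= t <= c + w -> Cmod (circ a c w) <= eps * w ^ 2.
Proof.
  intros Hs Ht He.
  assert (HK : 0 <= K) by (eapply Rle_trans; [apply Cmod_ge_0 | now apply (BP1 s t)]).
  set (e := eps / (8 * (K + 1) ^ 2)).
  assert (K1 : 0 < (K + 1) ^ 2) by (apply pow_lt; lra).
  assert (Hep : 0 < e) by (apply Rdiv_lt_0_compat; lra).
  destruct (Hg s t Hs Ht) as [v [_ Hv]].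
  destruct (Hv (P s t) (fun Q h => h) (mkposreal e Hep)) as [d Hd].
  set (z0 := P s t) in *.
  exists (d / (2 * (K + 1))). assert (Pd := cond_pos d).
  split; [apply Rdiv_lt_0_compat; lra|].
  intros a c w Ha Hc Hw Ha' Hc' Has Hct.
  assert (Hwd : 2 * (K + 1) * w < d).
  { apply Rlt_le_trans with (2 * (K + 1) * (d / (2 * (K + 1)))).
    - apply Rmult_lt_compat_l; lra.
    - right. field. lra. }
  assert (near : forall s' t', a <= s' <= a + w -> c <= t' <= c + w ->
    Cmod (g (P s' t') - (g z0 + v * (P s' t' - z0))) <= e * (2 * (K + 1) * w)).
  { intros s' t' Hs' Ht'.
    assert (L : Cmod (P s' t' - z0) <= 2 * (K + 1) * w).
    { eapply Rle_trans; [apply Lip; lra|].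
      assert (Rabs (s' - s) <= w) by (apply Rabs_le; lra).
      assert (Rabs (t' - t) <= w) by (apply Rabs_le; lra).
      apply Rle_trans with (K * (w + w)); [apply Rmult_le_compat_l; lra|]. nra. }
    assert (B : Cmod (P s' t' - z0) < d) by lra.
    assert (A := Hd (P s' t') B).
    change (Cmod (g (P s' t') - g z0 - (P s' t' - z0) * v) <= e * Cmod (P s' t' - z0)) in A.
    replace (g (P s' t') - (g z0 + v * (P s' t' - z0)))%C
      with (g (P s' t') - g z0 - (P s' t' - z0) * v)%C by ring.
    eapply Rle_trans; [exact A|]. apply Rmult_le_compat_l; lra. }
  set (G := fun z => (g z0 * z + v / 2 * ((z - z0) * (z - z0)))%C).
  assert (F1 : forall t', c <= t' <= c + w ->
    Cmod (H1 t' a (a + w) - (G (P (a + w) t') - G (P a t'))) <= w * (e * (2 * (K + 1) * w) * K)).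
  { intros t' Ht'. replace w with (a + w - a) at 3 by ring.
    apply (path_int_linearize g (fun s => P s t') (fun s => P1 s t'));
      [lra | intros s' Hs' .. ]; auto.
    - apply cont1; lra.
    - apply BP1; lra. }
  assert (F2 : forall s', a <= s' <= a + w ->
    Cmod (H2 s' c (c + w) - (G (P s' (c + w)) - G (P s' c))) <= w * (e * (2 * (K + 1) * w) * K)).
  { intros s' Hs'. replace w with (c + w - c) at 3 by ring.
    apply (path_int_linearize g (P s') (P2 s'));
      [lra | intros t' Ht' .. ]; auto.
    - apply cont2; lra.
    - apply BP2; lra. }
  (* the exact form contributes nothing around the square *)
  replace (circ a c w) with
    ((H1 c a (a + w) - (G (P (a + w) c) - G (P a c)))
     + (H2 (a + w) c (c + w) - (G (P (a + w) (c + w)) - G (P (a + w) c)))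
     + - (H1 (c + w) a (a + w) - (G (P (a + w) (c + w)) - G (P a (c + w))))
     + - (H2 a c (c + w) - (G (P a (c + w)) - G (P a c))))%C by (unfold circ; ring).
  assert (T4 : forall z1 z2 z3 z4 : C, Cmod (z1 + z2 + - z3 + - z4) <= Cmod z1 + Cmod z2 + Cmod z3 + Cmod z4).
  { intros. rewrite <- (Cmod_opp z3), <- (Cmod_opp z4).
    eapply Rle_trans; [apply Cmod_triangle|]. apply Rplus_le_compat_r.
    eapply Rle_trans; [apply Cmod_triangle|]. apply Rplus_le_compat_r. apply Cmod_triangle. }
  eapply Rle_trans; [apply T4|].
  assert (A1 := F1 c ltac:(lra)). assert (A2 := F1 (c + w) ltac:(lra)).
  assert (A3 := F2 a ltac:(lra)). assert (A4 := F2 (a + w) ltac:(lra)).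
  apply Rle_trans with (8 * (K + 1) * K * e * w ^ 2); [simpl; lra|].
  apply Rmult_le_compat_r; [apply pow2_ge_0|].
  replace eps with (8 * (K + 1) * (K + 1) * e) by (unfold e; field; lra).
  apply Rmult_le_compat_r; [lra|]. apply Rmult_le_compat_l; lra.
Qed.

Theorem goursat :
  (path_int g (fun s => P s 0) (fun s => P1 s 0) 0 1 + path_int g (P 1) (P2 1) 0 1
   - path_int g (fun s => P s 1) (fun s => P1 s 1) 0 1 - path_int g (P 0) (P2 0) 0 1)%C = 0.
Proof.
  assert (H : forall eps, 0 < eps -> Cmod (circ 0 0 1) <= eps * 1 ^ 2).
  { intros eps He. apply (square_induction (fun a c w => Cmod (circ a c w) <= eps * w ^ 2)).
    - intros a c w Ha Hc Hw Ha' Hc' Q1 Q2 Q3 Q4. rewrite circ_split by assumption.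
      eapply Rle_trans; [apply Cmod_triangle|].
      eapply Rle_trans; [apply Rplus_le_compat_r, Cmod_triangle|].
      eapply Rle_trans; [apply Rplus_le_compat_r, Rplus_le_compat_r, Cmod_triangle|].
      replace (eps * w ^ 2) with (eps * (w / 2) ^ 2 + eps * (w / 2) ^ 2 + eps * (w / 2) ^ 2 + eps * (w / 2) ^ 2)
        by field. lra.
    - intros s t Hs Ht. now apply circ_small. }
  apply Cmod_eq_0. replace (_ - _)%C with (circ 0 0 1) by (unfold circ, H1, H2; now rewrite Rplus_0_l).
  apply Rle_antisym; [|apply Cmod_ge_0]. apply le_epsilon. intros eps He.
  specialize (H eps He). lra.
Qed.

End Goursat.

(** * The unit circle *)

Definition circle (t : R) : C := (cos (2 * PI * t), sin (2 * PI * t)).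

Lemma Cmod_circle t : Cmod (circle t) = 1.
Proof.
  unfold Cmod, circle. cbn [fst snd]. rewrite <- sqrt_1. f_equal.
  assert (A := sin2_cos2 (2 * PI * t)). unfold Rsqr in A. lra.
Qed.

Lemma circle_nz t : circle t <> 0.
Proof. apply Cmod_gt_0. rewrite Cmod_circle. lra. Qed.

Lemma circle_0 : circle 0 = 1.
Proof. unfold circle. rewrite Rmult_0_r, cos_0, sin_0. reflexivity. Qed.

Lemma circle_1 : circle 1 = 1.
Proof. unfold circle. rewrite Rmult_1_r, cos_2PI, sin_2PI. reflexivity. Qed.

Lemma circle_plus s t : circle (s + t) = (circle s * circle t)%C.
Proof.
  unfold circle. rewrite Rmult_plus_distr_l, cos_plus, sin_plus.
  apply C_eq; [rewrite re_mult | rewrite im_mult]; cbn [Re Im fst snd]; ring.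
Qed.

Lemma circle_opp t : circle (- t) = Cconj (circle t).
Proof.
  unfold circle, Cconj. cbn [fst snd].
  replace (2 * PI * - t) with (- (2 * PI * t)) by ring. now rewrite cos_neg, sin_neg.
Qed.

Lemma circle_inv t : (/ circle t)%C = circle (- t).
Proof.
  assert (E : (circle t * circle (- t))%C = 1).
  { rewrite <- circle_plus, Rplus_opp_r. apply circle_0. }
  assert (N := circle_nz t).
  replace (circle (- t)) with (/ circle t * (circle t * circle (- t)))%C by (field; exact N).
  rewrite E. ring.
Qed.

Lemma circle_pow t n : (circle t ^ n)%C = circle (INR n * t).
Proof.
  induction n as [|n IH]; [simpl; rewrite Rmult_0_l; symmetry; apply circle_0|].
  rewrite Cpow_S, IH, S_INR, <- circle_plus. f_equal. ring.
Qed.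

Lemma is_derive_circle t :
  is_derive_RC circle t (2 * PI * (Ci * circle t))%C.
Proof.
  apply is_derive_C_intro.
  - change (is_derive (fun t => cos (2 * PI * t)) t (Re (2 * PI * (Ci * circle t))%C)).
    auto_derive; [trivial|]. rewrite <- RtoC_mult, re_scal_l, re_mult. unfold circle, Ci. simpl. ring.
  - change (is_derive (fun t => sin (2 * PI * t)) t (Im (2 * PI * (Ci * circle t))%C)).
    auto_derive; [trivial|]. rewrite <- RtoC_mult, im_scal_l, im_mult. unfold circle, Ci. simpl. ring.
Qed.

Lemma continuous_circle t : continuous_RC circle t.
Proof.
  eapply continuous_RC_of_derive. apply is_derive_circle.
Qed.

Lemma is_RInt_const_0_1 (c : R) : is_RInt (fun _ => c) 0 1 c.
Proof.
  assert (A := is_RInt_const (V := R_NormedModule) 0 1 c).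
  change (is_RInt (fun _ => c) 0 1 ((1 - 0) * c)) in A.
  replace ((1 - 0) * c) with c in A by ring. exact A.
Qed.

Lemma is_RInt_cos_0_1 n : (0 < n)%nat ->
  is_RInt (fun t => cos (2 * PI * (INR n * t))) 0 1 0.
Proof.
  intros Hn. assert (N : 0 < INR n) by (now apply lt_0_INR). assert (P := PI_RGT_0).
  assert (A : is_RInt (fun t => cos (2 * PI * (INR n * t))) 0 1
    (minus (sin (2 * PI * (INR n * 1)) / (2 * PI * INR n)) (sin (2 * PI * (INR n * 0)) / (2 * PI * INR n)))).
  { apply (is_RInt_derive (fun t => sin (2 * PI * (INR n * t)) / (2 * PI * INR n))).
    - intros t _. auto_derive; [trivial|]. field. split; lra.
    - intros t _. apply continuous_of_ex_derive. auto_derive. trivial. }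
  replace (minus _ _) with 0 in A; [exact A|].
  unfold minus, plus, opp; simpl. rewrite !Rmult_0_r, Rmult_1_r, sin_0.
  replace (2 * PI * INR n) with (0 + 2 * INR n * PI) at 1 by ring. rewrite sin_period, sin_0. unfold Rdiv; ring.
Qed.

Lemma is_RInt_sin_0_1 n : is_RInt (fun t => sin (2 * PI * (INR n * t))) 0 1 0.
Proof.
  destruct n as [|n].
  - apply is_RInt_ext with (fun _ => 0).
    + intros t _. simpl. now rewrite Rmult_0_l, Rmult_0_r, sin_0.
    + apply is_RInt_const_0_1.
  - assert (N : 0 < INR (S n)) by (apply lt_0_INR; lia). assert (P := PI_RGT_0).
    set (m := S n) in *. clearbody m.
    assert (A : is_RInt (fun t => sin (2 * PI * (INR m * t))) 0 1
      (minus (- cos (2 * PI * (INR m * 1)) / (2 * PI * INR m)) (- cos (2 * PI * (INR m * 0)) / (2 * PI * INR m)))).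
    { apply (is_RInt_derive (fun t => - cos (2 * PI * (INR m * t)) / (2 * PI * INR m))).
      - intros t _. auto_derive; [trivial|]. field. split; lra.
      - intros t _. apply continuous_of_ex_derive. auto_derive. trivial. }
    replace (minus _ _) with 0 in A; [exact A|].
    unfold minus, plus, opp; simpl. rewrite !Rmult_0_r, Rmult_1_r, cos_0.
    replace (2 * PI * INR m) with (0 + 2 * INR m * PI) at 1 by ring. rewrite cos_period, cos_0. field. split; lra.
Qed.

Lemma is_RInt_circle n :
  is_RInt_RC (fun t => circle (INR n * t)) 0 1
    (RtoC (match n with O => 1 | _ => 0 end)).
Proof.
  apply (is_RInt_fct_extend_pair (U := R_NormedModule) (V := R_NormedModule)
    (fun t => circle (INR n * t))).
  - destruct n as [|n]; [|apply is_RInt_cos_0_1; lia].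
    apply is_RInt_ext with (fun _ => 1).
    + intros t _. unfold circle. simpl. now rewrite Rmult_0_l, Rmult_0_r, cos_0.
    + apply is_RInt_const_0_1.
  - apply is_RInt_sin_0_1.
Qed.

Lemma is_RInt_Cconj (f : R -> C) a b (l : C) :
  is_RInt_RC f a b l ->
  is_RInt_RC (fun t => Cconj (f t)) a b (Cconj l).
Proof.
  intros H.
  apply (is_RInt_fct_extend_pair (U := R_NormedModule) (V := R_NormedModule)
    (fun t => Cconj (f t))).
  - exact (is_RInt_fct_extend_fst (U := R_NormedModule) (V := R_NormedModule) f a b l H).
  - apply (is_RInt_opp (V := R_NormedModule) (fun t => snd (f t))).
    exact (is_RInt_fct_extend_snd (U := R_NormedModule) (V := R_NormedModule) f a b l H).
Qed.

Lemma is_RInt_Cmult (c : C) (f : R -> C) a b (l : C) :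
  is_RInt_RC f a b l ->
  is_RInt_RC (fun t => c * f t)%C a b (c * l)%C.
Proof.
  intros H.
  assert (A := is_RInt_fct_extend_fst (U := R_NormedModule) (V := R_NormedModule) f a b l H).
  assert (B := is_RInt_fct_extend_snd (U := R_NormedModule) (V := R_NormedModule) f a b l H).
  apply (is_RInt_fct_extend_pair (U := R_NormedModule) (V := R_NormedModule)
    (fun t => c * f t)%C).
  - apply (is_RInt_minus (V := R_NormedModule) (fun t => Re c * Re (f t)) (fun t => Im c * Im (f t)));
      now apply (is_RInt_scal (V := R_NormedModule)).
  - apply (is_RInt_plus (V := R_NormedModule) (fun t => Re c * Im (f t)) (fun t => Im c * Re (f t)));
      now apply (is_RInt_scal (V := R_NormedModule)).
Qed.

Lemma is_RInt_circle_opp n :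
  is_RInt_RC (fun t => circle (- (INR n * t))) 0 1
    (RtoC (match n with O => 1 | _ => 0 end)).
Proof.
  assert (A := is_RInt_Cconj _ _ _ _ (is_RInt_circle n)).
  replace (Cconj _) with (RtoC (match n with O => 1 | _ => 0 end)) in A
    by (apply C_eq; cbn; ring).
  revert A. apply (is_RInt_ext (V := C_R_NormedModule)). intros t _. symmetry. apply circle_opp.
Qed.

Lemma Rabs_cos_minus a b : Rabs (cos a - cos b) <= Rabs (a - b).
Proof.
  destruct (MVT_gen cos b a (fun x => - sin x)) as [c [_ E]].
  - intros x _. auto_derive; [trivial | ring].
  - intros x _. apply continuity_cos.
  - rewrite E, Rabs_mult, Rabs_Ropp.
    rewrite <- (Rmult_1_l (Rabs (a - b))) at 2. apply Rmult_le_compat_r; [apply Rabs_pos|].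
    apply Rabs_le, SIN_bound.
Qed.

Lemma Rabs_sin_minus a b : Rabs (sin a - sin b) <= Rabs (a - b).
Proof.
  destruct (MVT_gen sin b a cos) as [c [_ E]].
  - intros x _. auto_derive; [trivial | ring].
  - intros x _. apply continuity_sin.
  - rewrite E, Rabs_mult.
    rewrite <- (Rmult_1_l (Rabs (a - b))) at 2. apply Rmult_le_compat_r; [apply Rabs_pos|].
    apply Rabs_le, COS_bound.
Qed.

Lemma circle_Lipschitz s t : Cmod (circle s - circle t) <= 4 * PI * Rabs (s - t).
Proof.
  eapply Rle_trans; [apply Cmod_le_Re_Im|].
  assert (P := PI_RGT_0).
  assert (A := Rabs_cos_minus (2 * PI * s) (2 * PI * t)).
  assert (B := Rabs_sin_minus (2 * PI * s) (2 * PI * t)).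
  replace (2 * PI * s - 2 * PI * t) with (2 * PI * (s - t)) in A, B by ring.
  rewrite Rabs_mult, (Rabs_pos_eq (2 * PI)) in A, B by lra.
  change (Rabs (cos (2 * PI * s) - cos (2 * PI * t)) + Rabs (sin (2 * PI * s) - sin (2 * PI * t))
    <= 4 * PI * Rabs (s - t)). lra.
Qed.

(** * Cauchy's formula and the Taylor expansion *)

Lemma is_C_derive_inv (z : C) : z <> 0 ->
  is_derive_CC (fun w => / w)%C z (- / (z * z))%C.
Proof.
  intros Hz. assert (P := proj1 (Cmod_gt_0 z) Hz).
  apply is_C_derive_second_order with (d := Cmod z / 2) (K := 2 / Cmod z ^ 3); [lra|].
  intros w Hw.
  assert (Lw : Cmod z / 2 <= Cmod w).
  { assert (T := Cmod_triangle (z - w) w). replace (z - w + w)%C with z in T by ring.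
    rewrite <- (Cmod_opp (z - w)) in T. replace (- (z - w))%C with (w - z)%C in T by ring. lra. }
  assert (Hw0 : w <> 0) by (apply Cmod_gt_0; lra).
  replace (/ w - / z - (w - z) * - / (z * z))%C with ((w - z) * (w - z) / (w * (z * z)))%C
    by (field; auto).
  rewrite Cmod_div by (repeat apply Cmult_neq_0; assumption). rewrite !Cmod_mult.
  set (d := Cmod (w - z)) in *. set (x := Cmod z) in *. set (y := Cmod w) in *.
  replace (d * d / (y * (x * x))) with (/ y * (d * d / (x * x))) by (field; split; lra).
  replace (2 / x ^ 3 * d ^ 2) with (/ (x / 2) * (d * d / (x * x))) by (field; lra).
  apply Rmult_le_compat_r.
  - apply Rmult_le_pos; [apply Rmult_le_pos; apply Cmod_ge_0 | left; apply Rinv_0_lt_compat; nra].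
  - apply Rinv_le_contravar; lra.
Qed.

(** Over itself the complex field carries two normed-module structures, with the
    same norm; rules for products are stated for one of them, limits for the other. *)
Lemma is_C_derive_iff (f : C -> C) (z l : C) :
  is_derive_CC f z l <->
  is_derive (K := C_AbsRing) (V := AbsRing_NormedModule C_AbsRing) f z l.
Proof. split; (intros [_ H]; split; [apply is_linear_scal_l | exact H]). Qed.

Lemma is_C_derive_id (z : C) :
  is_derive_CC (fun w => w) z (RtoC 1).
Proof. apply is_C_derive_iff. exact (is_derive_id (K := C_AbsRing) z). Qed.

Lemma is_C_derive_const (c z : C) :
  is_derive_CC (fun _ => c) z (RtoC 0).
Proof. exact (is_derive_const (K := C_AbsRing) (V := C_NormedModule) c z). Qed.

Lemma is_C_derive_minus (f g : C -> C) (z l m : C) :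
  is_derive_CC f z l ->
  is_derive_CC g z m ->
  is_derive_CC (fun w => f w - g w)%C z (l - m)%C.
Proof. exact (is_derive_minus (K := C_AbsRing) (V := C_NormedModule) f g z l m). Qed.

Lemma is_C_derive_mult (f g : C -> C) (z l m : C) :
  is_derive_CC f z l ->
  is_derive_CC g z m ->
  is_derive_CC (fun w => f w * g w)%C z (l * g z + f z * m)%C.
Proof.
  intros Hf Hg. apply is_C_derive_iff in Hf. apply is_C_derive_iff in Hg. apply is_C_derive_iff.
  exact (is_derive_mult (K := C_AbsRing) f g z l m Hf Hg Cmult_comm).
Qed.

Lemma ex_C_derive_quotient (f : C -> C) (z0 z : C) :
  ex_derive_CC f z -> z <> z0 ->
  ex_derive_CC (fun w => (f w - f z0) / (w - z0))%C z.
Proof.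
  intros [l Hl] Hz.
  assert (Hz' : (z - z0)%C <> 0) by (now apply Cminus_eq_contra).
  assert (D1 := is_C_derive_minus _ _ z _ _ (is_C_derive_id z) (is_C_derive_const z0 z)).
  assert (D2 := is_derive_comp (K := C_AbsRing) (V := C_NormedModule)
    (fun w => / w)%C (fun w => w - z0)%C z _ _ (is_C_derive_inv _ Hz')
    (proj1 (is_C_derive_iff _ _ _) D1)).
  assert (D3 := is_C_derive_minus _ _ z _ _ Hl (is_C_derive_const (f z0) z)).
  eexists. exact (is_C_derive_mult _ _ z _ _ D3 D2).
Qed.

(* Sums and integrals with values in [C] come with the abstract [plus] and with
   equalities at a structure type; the next two tactics expose the form on which
   [ring] works, and their counterparts below do the same for [R]. *)
Ltac Cplus_fold := repeat match goal with |- context [plus ?x ?y] =>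
  change (plus x y) with (x + y)%C end.

Ltac C_ring := match goal with |- ?a = ?b => change (@eq C a b) end; ring.

Lemma path_int_bound g p dp a b M : a <= b ->
  (forall t, a <= t <= b -> continuous_RC (fun t => g (p t) * dp t)%C t) ->
  (forall t, a <= t <= b -> Cmod (g (p t) * dp t)%C <= M) ->
  Cmod (path_int g p dp a b) <= (b - a) * M.
Proof.
  intros Hab Hc H.
  apply (Cmod_is_RInt_le (fun t => g (p t) * dp t)%C); [exact Hab | exact H | now apply path_int_correct].
Qed.

Lemma Cmod_scaled_circle r t : 0 <= r -> Cmod (r * circle t) = r.
Proof. intros H. rewrite Cmod_mult, Cmod_circle, Cmod_R, Rabs_pos_eq; lra. Qed.

Lemma scaled_circle_neq r z t : 0 <= r -> Cmod z < r -> (r * circle t - z)%C <> 0.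
Proof.
  intros Hr Hz E. apply Ceq_minus in E. assert (H := Cmod_scaled_circle r t Hr).
  rewrite E in H. lra.
Qed.

Lemma is_derive_Cminus_const (p : R -> C) (c : C) t (l : C) :
  is_derive_RC p t l ->
  is_derive_RC (fun s => p s - c)%C t l.
Proof.
  intros H. assert (A := is_derive_Cplus _ _ t _ _ H (is_derive_Cconst (- c)%C t)).
  replace (l + 0)%C with l in A by ring. exact A.
Qed.

Lemma is_derive_Cscal (c : C) (p : R -> C) t (l : C) :
  is_derive_RC p t l ->
  is_derive_RC (fun s => c * p s)%C t (c * l)%C.
Proof.
  intros H. assert (A := is_derive_Cmult _ _ t _ _ (is_derive_Cconst c t) H).
  cbv beta in A. replace (0 * p t + c * l)%C with (c * l)%C in A by ring. exact A.
Qed.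

Lemma is_derive_RtoC (u : R -> R) t l :
  is_derive u t l -> is_derive_RC (fun s => RtoC (u s)) t (RtoC l).
Proof.
  intros H. apply is_derive_C_intro; [exact H|].
  exact (is_derive_const (K := R_AbsRing) (V := R_NormedModule) 0 t).
Qed.

(** The difference quotient extends continuously to [z0].  Shrinking the circle
    towards [z0] sweeps out the annular region on which it is differentiable,
    and the integral over the small circle tends to [0] with its length. *)
Lemma cauchy (f : C -> C) (r : R) (z0 : C) :
  analytic_in_disk f -> 0 < r < 1 -> Cmod z0 < r ->
  path_int (fun w => (f w - f z0) / (w - z0))%C (fun t => r * circle t)%C
    (fun t => r * (2 * PI * (Ci * circle t)))%C 0 1 = 0.
Proof.
  intros Hf Hr Hz0.
  set (g := fun w => ((f w - f z0) / (w - z0))%C).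
  assert (Pz := Cmod_ge_0 z0). assert (PI4 := PI_4). assert (PP := PI_RGT_0).
  set (gam := fun t => (r * circle t)%C).
  set (dgam := fun t => (r * (2 * PI * (Ci * circle t)))%C).
  assert (Dgam : forall t, is_derive_RC gam t (dgam t)).
  { intros t. apply (is_derive_Cscal r circle), is_derive_circle. }
  assert (Cdgam : forall t, continuous_RC dgam t).
  { intros t. do 3 (apply continuous_Cmult; [apply continuous_const|]). apply continuous_circle. }
  assert (Mgam : forall t, Cmod (gam t) = r) by (intros t; apply Cmod_scaled_circle; lra).
  assert (Mdgam : forall t, Cmod (dgam t) <= 8).
  { intros t. unfold dgam. rewrite !Cmod_mult, Cmod_circle, Cmod_Ci, !Cmod_R, !Rabs_pos_eq by lra. nra. }
  assert (Lgam : forall s t, Cmod (gam s - gam t) <= 16 * Rabs (s - t)).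
  { intros s t. unfold gam. replace (r * circle s - r * circle t)%C with (r * (circle s - circle t))%C by ring.
    rewrite Cmod_mult, Cmod_R, Rabs_pos_eq by lra.
    assert (A := circle_Lipschitz s t). assert (B := Rabs_pos (s - t)).
    assert (C0 := Cmod_ge_0 (circle s - circle t)).
    apply Rle_trans with (1 * Cmod (circle s - circle t)); [apply Rmult_le_compat_r; lra|].
    nra. }
  (* differentiability at z0 bounds the quotient near z0 *)
  destruct (Hf z0) as [v [_ Hv]]; [unfold in_disk; lra|].
  destruct (Hv z0 (fun Q h => h) (mkposreal 1 Rlt_0_1)) as [d Hd].
  assert (Pd := cond_pos d).
  assert (Bg : forall w, w <> z0 -> Cmod (w - z0) < d -> Cmod (g w) <= Cmod v + 1).
  { intros w Hw Hwd. assert (N : (w - z0)%C <> 0) by (now apply Cminus_eq_contra).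
    assert (A := Hd w Hwd).
    change (Cmod (f w - f z0 - (w - z0) * v) <= 1 * Cmod (w - z0)) in A.
    unfold g. replace ((f w - f z0) / (w - z0))%C with ((f w - f z0 - (w - z0) * v) / (w - z0) + v)%C
      by (field; exact N).
    eapply Rle_trans; [apply Cmod_triangle|]. rewrite Rplus_comm. apply Rplus_le_compat_l.
    rewrite Cmod_div by exact N. apply Rmult_le_reg_r with (Cmod (w - z0)); [now apply Cmod_gt_0|].
    unfold Rdiv. rewrite Rmult_assoc, Rinv_l; [lra|]. apply Rgt_not_eq. now apply Cmod_gt_0. }
  assert (Cont : forall p dp t, is_derive_RC p t (dp t) ->
     continuous_RC dp t -> p t <> z0 -> Cmod (p t) < 1 ->
     continuous_RC (fun t => g (p t) * dp t)%C t).
  { intros p dp t Hp Hdp Hn H1. apply continuous_Cmult; [|exact Hdp].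
    apply (continuous_C_comp g p).
    - apply ex_C_derive_quotient; [now apply Hf | exact Hn].
    - eapply continuous_RC_of_derive. exact Hp. }
  (* compare with the circle contracted by the factor e, whose length is
     proportional to e *)
  assert (Key : forall e, 0 < e < 1 -> 2 * e < d ->
    Cmod (path_int g gam dgam 0 1) <= e * (8 * (Cmod v + 1))).
  { intros e He Hed.
    set (h := fun s => e + (1 - e) * s).
    set (P := fun s t => (z0 + h s * (gam t - z0))%C).
    set (P1 := fun (s t : R) => ((1 - e) * (gam t - z0))%C).
    set (P2 := fun s t => (h s * dgam t)%C).
    assert (Hh : forall s, 0 <= s <= 1 -> e <= h s <= 1) by (intros s Hs; unfold h; nra).
    assert (BP : forall t, Cmod (gam t - z0) <= 2).
    { intros t. replace (gam t - z0)%C with (gam t + - z0)%C by ring.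
      eapply Rle_trans; [apply Cmod_triangle|]. rewrite Cmod_opp, Mgam. lra. }
    assert (NP : forall s t, 0 <= s <= 1 -> P s t <> z0).
    { intros s t Hs E. apply Ceq_minus in E. revert E.
      replace (P s t - z0)%C with (h s * (gam t - z0))%C by (unfold P; ring).
      apply Cmult_neq_0; [|apply scaled_circle_neq; lra].
      intros E. apply RtoC_inj in E. assert (A := Hh s Hs). lra. }
    assert (DP : forall s t, 0 <= s <= 1 -> Cmod (P s t) < 1).
    { intros s t Hs. assert (A := Hh s Hs).
      replace (P s t) with ((1 - h s)%R * z0 + h s * gam t)%C
        by (unfold P; rewrite RtoC_minus; ring).
      eapply Rle_lt_trans; [apply Cmod_triangle|].
      rewrite !Cmod_mult, Mgam, !Cmod_R, !Rabs_pos_eq by lra. nra. }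
    assert (D1 : forall s t, is_derive_RC (fun s => P s t) s (P1 s t)).
    { intros s t. unfold P, P1.
      assert (A : is_derive h s (1 - e)) by (unfold h; auto_derive; [trivial | ring]).
      assert (B := is_derive_Cmult _ _ s _ _ (is_derive_RtoC _ _ _ A) (is_derive_Cconst (gam t - z0)%C s)).
      assert (D := is_derive_Cplus _ _ s _ _ (is_derive_Cconst z0 s) B).
      replace ((1 - e) * (gam t - z0))%C with (0 + ((1 - e)%R * (gam t - z0) + h s * 0))%C
        by (rewrite RtoC_minus; ring). exact D. }
    assert (D2 : forall s t, is_derive_RC (fun t => P s t) t (P2 s t)).
    { intros s t. unfold P, P2.
      assert (B := is_derive_Cscal (h s) _ t _ (is_derive_Cminus_const gam z0 t _ (Dgam t))).
      assert (D := is_derive_Cplus _ _ t _ _ (is_derive_Cconst z0 t) B).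
      replace (h s * dgam t)%C with (0 + h s * dgam t)%C by ring. exact D. }
    assert (C1 : forall s t, continuous_RC (fun s => P1 s t) s).
    { intros s t. apply continuous_const. }
    assert (C2 : forall s t, continuous_RC (fun t => P2 s t) t).
    { intros s t. apply continuous_Cmult; [apply continuous_const | apply Cdgam]. }
    assert (G := goursat g P P1 P2 16 D1 D2 C1 C2).
    lapply G; clear G; [intros G | intros s t Hs Ht]. 2:{
      unfold P1. rewrite <- RtoC_minus, Cmod_mult, Cmod_R, Rabs_pos_eq by lra.
      assert (A := BP t). assert (B := Cmod_ge_0 (gam t - z0)). nra. }
    lapply G; clear G; [intros G | intros s t Hs Ht]. 2:{
      assert (A := Hh s Hs).
      unfold P2. rewrite Cmod_mult, Cmod_R, Rabs_pos_eq by lra.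
      assert (B := Mdgam t). assert (B' := Cmod_ge_0 (dgam t)). nra. }
    lapply G; clear G; [intros G | intros s t s' t' Hs Ht Hs' Ht']. 2:{
      assert (A := Hh s Hs). assert (A' := Hh s' Hs').
      replace (P s' t' - P s t)%C with ((h s' - h s)%R * (gam t' - z0) + h s * (gam t' - gam t))%C
        by (unfold P; rewrite RtoC_minus; ring).
      eapply Rle_trans; [apply Cmod_triangle|].
      rewrite !Cmod_mult, !Cmod_R, (Rabs_pos_eq (h s)) by lra.
      replace (h s' - h s) with ((1 - e) * (s' - s)) by (unfold h; ring).
      rewrite Rabs_mult, (Rabs_pos_eq (1 - e)) by lra.
      assert (B := BP t'). assert (B' := Cmod_ge_0 (gam t' - z0)).
      assert (L := Lgam t' t). assert (L' := Cmod_ge_0 (gam t' - gam t)).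
      assert (R1 := Rabs_pos (s' - s)). assert (R2 := Rabs_pos (t' - t)).
      assert ((1 - e) * Rabs (s' - s) * Cmod (gam t' - z0) <= Rabs (s' - s) * 2).
      { apply Rmult_le_compat; try lra; [apply Rmult_le_pos; lra | nra]. }
      nra. }
    lapply G; clear G; [intros G | intros s t Hs Ht]. 2:{
      apply ex_C_derive_quotient; [apply Hf; now apply DP | now apply NP]. }
    replace (path_int g (fun s => P s 1) (fun s => P1 s 1) 0 1)
      with (path_int g (fun s => P s 0) (fun s => P1 s 0) 0 1) in G.
    2:{ unfold P, P1, gam. now rewrite circle_0, circle_1. }
    assert (E1 : path_int g (P 1) (P2 1) 0 1 = path_int g gam dgam 0 1).
    { apply (RInt_ext (V := C_R_CompleteNormedModule)). intros t _.
      assert (Eh : h 1 = 1) by (unfold h; ring).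
      unfold P, P2. rewrite Eh. f_equal; [f_equal|]; ring. }
    assert (E2 : path_int g gam dgam 0 1 = path_int g (P 0) (P2 0) 0 1).
    { rewrite <- E1. apply Ceq_minus. rewrite <- G. ring. }
    rewrite E2. replace (e * (8 * (Cmod v + 1))) with ((1 - 0) * (e * (8 * (Cmod v + 1)))) by ring.
    assert (Eh : h 0 = e) by (unfold h; ring).
    apply path_int_bound; [lra | intros t Ht | intros t Ht].
    - apply Cont; [apply D2 | apply C2 | apply NP; lra | apply DP; lra].
    - rewrite Cmod_mult. unfold P2. rewrite Cmod_mult, Eh, Cmod_R, Rabs_pos_eq by lra.
      assert (A : Cmod (g (P 0 t)) <= Cmod v + 1).
      { apply Bg; [apply NP; lra|].
        replace (P 0 t - z0)%C with (h 0 * (gam t - z0))%C by (unfold P; ring).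
        rewrite Cmod_mult, Eh, Cmod_R, Rabs_pos_eq by lra. assert (A := BP t). nra. }
      assert (B := Mdgam t). assert (B' := Cmod_ge_0 (dgam t)). assert (A' := Cmod_ge_0 (g (P 0 t))).
      assert (Cmod (g (P 0 t)) * Cmod (dgam t) <= (Cmod v + 1) * 8) by (apply Rmult_le_compat; lra).
      nra. }
  apply Cmod_eq_0. apply Rle_antisym; [|apply Cmod_ge_0].
  apply le_epsilon. intros eps Heps. rewrite Rplus_0_l.
  set (M := 8 * (Cmod v + 1)). assert (PM : 0 < M) by (assert (A := Cmod_ge_0 v); unfold M; lra).
  set (e := Rmin (/ 2) (Rmin (d / 4) (eps / M))).
  assert (A1 : e <= / 2) by apply Rmin_l.
  assert (A2 : e <= d / 4) by (eapply Rle_trans; [apply Rmin_r | apply Rmin_l]).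
  assert (A3 : e <= eps / M) by (eapply Rle_trans; [apply Rmin_r | apply Rmin_r]).
  assert (A4 : 0 < e).
  { repeat apply Rmin_glb_lt; try lra. now apply Rdiv_lt_0_compat. }
  eapply Rle_trans; [apply (Key e); lra|]. fold M.
  apply Rle_trans with (eps / M * M); [apply Rmult_le_compat_r; lra | right; field; lra].
Qed.

Lemma is_RInt_Csum (F : nat -> R -> C) (l : nat -> C) a b N :
  (forall n, is_RInt_RC (F n) a b (l n)) ->
  is_RInt_RC (fun t => Csum_n (fun n => F n t) N) a b
    (Csum_n l N).
Proof.
  intros H. induction N as [|N IH].
  - rewrite sum_O. apply (is_RInt_ext (V := C_R_NormedModule)) with (F 0%nat); [|apply H].
    intros t _. now rewrite sum_O.
  - rewrite sum_Sn.
    apply (is_RInt_ext (V := C_R_NormedModule))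
      with (fun t => plus (Csum_n (fun n => F n t) N) (F (S N) t)).
    + intros t _. now rewrite sum_Sn.
    + apply (is_RInt_plus (V := C_R_NormedModule)
        (fun t => Csum_n (fun n => F n t) N)); [exact IH | apply H].
Qed.

Lemma Re_sum_n (a : nat -> C) N :
  Re (Csum_n a N) = sum_n (fun n => Re (a n)) N.
Proof.
  induction N as [|N IH]; [now rewrite !sum_O|]. rewrite !sum_Sn, <- IH. reflexivity.
Qed.

Lemma Im_sum_n (a : nat -> C) N :
  Im (Csum_n a N) = sum_n (fun n => Im (a n)) N.
Proof.
  induction N as [|N IH]; [now rewrite !sum_O|]. rewrite !sum_Sn, <- IH. reflexivity.
Qed.

Lemma Cgeom_sum (u : C) N :
  (Csum_n (fun n => u ^ n)%C N * (1 - u))%C = (1 - u ^ S N)%C.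
Proof.
  induction N as [|N IH]; [rewrite sum_O; cbn [Cpow]; ring|].
  rewrite sum_Sn. Cplus_fold.
  rewrite Cmult_plus_distr_r, IH, (Cpow_S u (S N)). ring.
Qed.

Lemma sum_n_Cmult_l (c : C) (a : nat -> C) N :
  Csum_n (fun n => c * a n)%C N = (c * Csum_n a N)%C.
Proof.
  induction N as [|N IH]; [now rewrite !sum_O|]. rewrite !sum_Sn, IH.
  change ((c * Csum_n a N + c * a (S N))%C
    = (c * (Csum_n a N + a (S N)))%C). ring.
Qed.

Lemma is_lim_seq_of_error (u : nat -> R) (l : R) (e : nat -> R) :
  (forall n, Rabs (u n - l) <= e n) -> is_lim_seq e 0 -> is_lim_seq u l.
Proof.
  intros H He. apply (is_lim_seq_ext (fun n => (u n - l) + l)); [intros n; ring|].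
  replace (Finite l) with (Finite (0 + l)) by (f_equal; ring).
  apply is_lim_seq_plus'; [|apply is_lim_seq_const].
  apply is_lim_seq_abs_0. apply is_lim_seq_le_le with (fun _ => 0) e;
    [intros n; split; [apply Rabs_pos | apply H] | apply is_lim_seq_const | exact He].
Qed.

Lemma CSeries_of_geometric_error (a : nat -> C) (l : C) M q :
  0 <= q < 1 -> (forall N, Cmod (Csum_n a N - l) <= M * q ^ S N) ->
  CSeries a = l.
Proof.
  intros Hq H.
  assert (L : is_lim_seq (fun N => M * q ^ S N) 0).
  { replace (Finite 0) with (Rbar_mult (Finite M) (Finite 0)) by (simpl; f_equal; ring).
    apply is_lim_seq_scal_l. apply (is_lim_seq_incr_1 (fun n => q ^ n)).
    apply is_lim_seq_geom. rewrite Rabs_pos_eq; lra. }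
  apply C_eq; apply is_series_unique.
  - apply (is_lim_seq_of_error _ _ (fun N => M * q ^ S N)); [|exact L].
    intros N. rewrite <- Re_sum_n. exact (Rle_trans _ _ _ (re_le_Cmod (Csum_n a N - l)) (H N)).
  - apply (is_lim_seq_of_error _ _ (fun N => M * q ^ S N)); [|exact L].
    intros N. rewrite <- Im_sum_n. exact (Rle_trans _ _ _ (im_le_Cmod (Csum_n a N - l)) (H N)).
Qed.

Lemma Cmod_is_RInt_0_1_le (f : R -> C) (l : C) M :
  (forall t, 0 <= t <= 1 -> Cmod (f t) <= M) ->
  is_RInt_RC f 0 1 l -> Cmod l <= M.
Proof.
  intros H Hl. replace M with ((1 - 0) * M) by ring.
  exact (Cmod_is_RInt_le f 0 1 l M Rle_0_1 H Hl).
Qed.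

Theorem taylor (f : C -> C) (r : R) :
  analytic_in_disk f -> 0 < r < 1 ->
  exists c, converges_in r c /\ forall z, Cmod z < r -> f z = CPSeries c z.
Proof.
  intros Hf Hr.
  set (gam := fun t => (r * circle t)%C).
  assert (Mgam : forall t, Cmod (gam t) = r) by (intros t; apply Cmod_scaled_circle; lra).
  assert (Ngam : forall t, gam t <> 0) by (intros t; apply Cmod_gt_0; rewrite Mgam; lra).
  assert (Nr : RtoC r <> 0) by (intros E; apply RtoC_inj in E; lra).
  assert (Einv : forall t n, ((/ gam t) ^ n)%C = ((/ r) ^ n * circle (- (INR n * t)))%C).
  { intros t n. unfold gam. replace (/ (r * circle t))%C with (/ r * circle (- t))%C
      by (rewrite <- circle_inv; field; split; [apply circle_nz | exact Nr]).
    rewrite Cpow_mult_l, circle_pow. do 2 f_equal. ring. }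
  assert (Cf : forall t, continuous_RC (fun t => f (gam t)) t).
  { intros t. apply (continuous_C_comp f gam); [apply Hf; unfold in_disk; rewrite Mgam; lra|].
    apply continuous_Cmult; [apply continuous_const | apply continuous_circle]. }
  assert (Cinv : forall n t, continuous_RC (fun t => (/ gam t) ^ n)%C t).
  { intros n t. apply continuous_ext with (fun t => (/ r) ^ n * circle (- (INR n * t)))%C;
      [intros s; symmetry; apply Einv|].
    apply continuous_Cmult; [apply continuous_const|].
    apply (continuous_comp (fun t => - (INR n * t)) circle); [|apply continuous_circle].
    apply continuous_of_ex_derive. auto_derive. trivial. }
  destruct (bounded_continuity (V := C_R_NormedModule) (fun t => f (gam t)) 0 1) as [M HM];
    [intros t _; apply Cf|].
  assert (BM : forall t, 0 <= t <= 1 -> Cmod (f (gam t)) <= M).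
  { intros t Ht. rewrite <- norm_C_R. left. now apply HM. }
  set (c := fun n => RInt (V := C_R_CompleteNormedModule) (fun t => f (gam t) * (/ gam t) ^ n)%C 0 1).
  assert (Hc : forall n, is_RInt_RC (fun t => f (gam t) * (/ gam t) ^ n)%C 0 1 (c n)).
  { intros n. apply (RInt_correct (V := C_R_CompleteNormedModule)).
    apply (ex_RInt_continuous (V := C_R_CompleteNormedModule)).
    intros t _. apply continuous_Cmult; [apply Cf | apply Cinv]. }
  exists c. split.
  - apply converges_in_bounded with M; [lra|]. intros n.
    assert (Pr : 0 < r ^ n) by (apply pow_lt; lra).
    apply Rmult_le_reg_r with (/ r ^ n); [now apply Rinv_0_lt_compat|].
    rewrite Rmult_assoc, Rinv_r, Rmult_1_r by lra.
    apply Cmod_is_RInt_0_1_le with (2 := Hc n). intros t Ht. rewrite Cmod_mult, Cmod_pow, Cmod_inv, Mgam, pow_inv by apply Ngam.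
    apply Rmult_le_compat_r; [left; now apply Rinv_0_lt_compat | now apply BM].
  - intros z Hz. symmetry.
    assert (Pz := Cmod_ge_0 z).
    assert (Hq := Rdiv_lt_1 (Cmod z) r (conj Pz Hz)).
    set (M' := (M + Cmod (f z)) * (r / (r - Cmod z))).
    apply CSeries_of_geometric_error with M' (Cmod z / r); [exact Hq|]. intros N.
    assert (N1 : forall t, (gam t - z)%C <> 0) by (intros t; apply scaled_circle_neq; lra).
    assert (N2 : RtoC PI <> 0).
    { intros E. apply RtoC_inj in E. now apply PI_neq0. }
    set (D := fun t => ((f (gam t) - f z) * (gam t / (gam t - z)))%C).
    assert (HD : is_RInt_RC D 0 1 (RtoC 0)).
    { assert (A := is_RInt_Cmult (/ (2 * PI * Ci))%C _ 0 1 _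
        (path_int_correct (fun w => (f w - f z) / (w - z))%C gam
           (fun t => r * (2 * PI * (Ci * circle t)))%C 0 1 Rle_0_1
         ltac:(intros t Ht; apply continuous_Cmult;
           [ apply (continuous_C_comp (fun w => (f w - f z) / (w - z))%C gam);
             [ apply ex_C_derive_quotient;
               [apply Hf; unfold in_disk; rewrite Mgam; lra
               | intros E; apply (N1 t); rewrite E; ring]
             | apply continuous_Cmult; [apply continuous_const | apply continuous_circle]]
           | do 3 (apply continuous_Cmult; [apply continuous_const|]); apply continuous_circle]))).
      unfold gam in A at 2. rewrite cauchy in A by assumption. rewrite Cmult_0_r in A.
      revert A. apply (is_RInt_ext (V := C_R_NormedModule)). intros t _. unfold D.
      assert (N1t := N1 t). change (gam t) with (r * circle t)%C in *.
      match goal with |- ?a = ?b => change (@eq C a b) end.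
      field. repeat split; auto using Ci_nz. }
    set (u := fun t => (z * / gam t)%C).
    assert (Hu : forall t, Cmod (u t) = Cmod z / r).
    { intros t. unfold u. rewrite Cmod_mult, Cmod_inv, Mgam by apply Ngam. reflexivity. }
    (* [u ^ n] contributes the n-th Taylor term, and the constant [f z] only
       survives for n = 0 *)
    assert (HS : is_RInt_RC
      (fun t => (f (gam t) - f z) * Csum_n (fun n => u t ^ n)%C N)%C 0 1
      (Csum_n (fun n => c n * z ^ n)%C N - f z)%C).
    { assert (A := is_RInt_Csum (fun n t => z ^ n * ((f (gam t) * (/ gam t) ^ n)
        + - f z * ((/ r) ^ n * circle (- (INR n * t)))))%C
        (fun n => z ^ n * (c n + - f z * ((/ r) ^ n * RtoC (match n with O => 1 | _ => 0 end))))%C 0 1 N).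
      replace (Csum_n (fun n => c n * z ^ n)%C N - f z)%C
        with (Csum_n (fun n => z ^ n * (c n + - f z * ((/ r) ^ n * RtoC (match n with O => 1 | _ => 0 end))))%C N).
      - assert (B : forall n, is_RInt_RC (fun t => z ^ n * ((f (gam t) * (/ gam t) ^ n)
          + - f z * ((/ r) ^ n * circle (- (INR n * t)))))%C 0 1
          (z ^ n * (c n + - f z * ((/ r) ^ n * RtoC (match n with O => 1 | _ => 0 end))))%C).
        { intros n. apply is_RInt_Cmult.
          apply (is_RInt_plus (V := C_R_NormedModule) (fun t => f (gam t) * (/ gam t) ^ n)%C); [apply Hc|].
          do 2 apply is_RInt_Cmult. apply is_RInt_circle_opp. }
        specialize (A B). revert A. apply (is_RInt_ext (V := C_R_NormedModule)). intros t _.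
        rewrite <- sum_n_Cmult_l. apply (sum_n_ext (G := C_AbelianMonoid)). intros n. unfold u.
        match goal with |- ?a = ?b => change (@eq C a b) end.
        rewrite Cpow_mult_l, !Einv. ring.
      - clear. induction N as [|N IH]; [rewrite !sum_O; cbn [Cpow]; C_ring|].
        rewrite !sum_Sn, IH. Cplus_fold. C_ring. }
    assert (HE := is_RInt_minus (V := C_R_NormedModule) _ _ 0 1 _ _ HS HD).
    replace (minus _ _) with (Csum_n (fun n => c n * z ^ n)%C N - f z)%C in HE
      by (match goal with |- _ = minus ?x ?y => change (minus x y) with (x - y)%C end; ring).
    apply Cmod_is_RInt_0_1_le with (2 := HE). intros t Ht. change (minus ?x ?y) with (x - y)%C. unfold D.
    assert (N3 : (1 - u t)%C <> 0).
    { intros E. apply (N1 t). replace (gam t - z)%C with (gam t * (1 - u t))%C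
        by (unfold u; field; apply Ngam). rewrite E. ring. }
    replace (gam t / (gam t - z))%C with (/ (1 - u t))%C
      by (unfold u; field; split; [apply N1 | apply Ngam]).
    replace ((f (gam t) - f z) * Csum_n (fun n => u t ^ n)%C N
        - (f (gam t) - f z) * / (1 - u t))%C
      with ((f (gam t) - f z) * ((Csum_n (fun n => u t ^ n)%C N * (1 - u t) - 1) / (1 - u t)))%C
      by (field; exact N3).
    rewrite Cgeom_sum.
    replace (1 - u t ^ S N - 1)%C with (- u t ^ S N)%C by ring.
    rewrite Cmod_mult, Cmod_div, Cmod_opp, Cmod_pow, Hu by exact N3.
    unfold M'. rewrite Rmult_assoc. apply Rmult_le_compat; try apply Cmod_ge_0.
    + apply Rmult_le_pos; [apply pow_le; lra | left; apply Rinv_0_lt_compat; now apply Cmod_gt_0].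
    + eapply Rle_trans; [apply Cmod_triangle|]. rewrite Cmod_opp. apply Rplus_le_compat_r. now apply BM.
    + unfold Rdiv at 1. rewrite Rmult_comm. apply Rmult_le_compat_r; [apply pow_le; lra|].
      replace (r / (r - Cmod z)) with (/ (1 - Cmod z / r)) by (field; lra).
      apply Rinv_le_contravar; [lra|].
      assert (T := Cmod_triangle (1 - u t) (u t)). replace (1 - u t + u t)%C with (RtoC 1) in T by ring.
      rewrite Cmod_1, Hu in T. lra.
Qed.

(** * Positivity of Hadamard products *)

Ltac Rplus_fold := repeat match goal with |- context [@plus ?G ?x ?y] =>
  change (@plus G x y) with (x + y)%R end.

Ltac R_ring := match goal with |- ?a = ?b => change (@eq R a b) end; ring.

Lemma CSeries_minus_sum (a : nat -> C) N : abs_summable a ->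
  (CSeries a - Csum_n a N)%C = CSeries (fun n => a (S N + n)%nat).
Proof.
  intros Ha. induction N as [|N IH].
  - rewrite sum_O, (CSeries_incr a) by exact Ha. cbn [Nat.add]; C_ring.
  - rewrite sum_Sn. Cplus_fold.
    assert (Hs : abs_summable (fun n => a (S N + n)%nat)).
    { exact (proj1 (ex_series_incr_n (fun n => Cmod (a n)) (S N)) Ha). }
    replace (CSeries a - (Csum_n a N + a (S N)))%C
      with ((CSeries a - Csum_n a N) - a (S N))%C by ring.
    rewrite IH, CSeries_incr by exact Hs. rewrite Nat.add_0_r.
    replace (CSeries (fun n => a (S (S N) + n)%nat)) with (CSeries (fun n => a (S N + S n)%nat))
      by (apply CSeries_ext; intros n; f_equal; lia). ring.
Qed.

Lemma Series_minus_sum (a : nat -> R) N : ex_series a ->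
  Series a - sum_n a N = Series (fun n => a (S N + n)%nat).
Proof.
  intros Ha. rewrite (Series_incr_n a (S N)) by (auto; lia). cbn [pred]. rewrite sum_n_Reals. ring.
Qed.

Lemma CSeries_tail_le (a : nat -> C) N : abs_summable a ->
  Cmod (CSeries a - Csum_n a N)
    <= Series (fun n => Cmod (a n)) - sum_n (fun n => Cmod (a n)) N.
Proof.
  intros Ha. rewrite CSeries_minus_sum, Series_minus_sum by exact Ha.
  apply (Cmod_CSeries_le (fun n => a (S N + n)%nat)).
  exact (proj1 (ex_series_incr_n (fun n => Cmod (a n)) (S N)) Ha).
Qed.

Lemma sum_n_single (v : nat -> R) k N :
  (forall n, n <> k -> v n = 0) -> sum_n v N = if Nat.leb k N then v k else 0.
Proof.
  intros H. induction N as [|N IH].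
  - rewrite sum_O. destruct k as [|k]; [reflexivity | now apply H].
  - rewrite sum_Sn, IH. change (plus ?x ?y) with (x + y).
    destruct (Nat.leb_spec k N), (Nat.leb_spec k (S N)); try lia.
    + rewrite (H (S N)) by lia. unfold plus; simpl. ring.
    + replace (S N) with k by lia. unfold plus; simpl. ring.
    + rewrite (H (S N)) by lia. unfold plus; simpl. ring.
Qed.

Lemma is_RInt_sum (F : nat -> R -> R) (l : nat -> R) a b N :
  (forall n, is_RInt (F n) a b (l n)) ->
  is_RInt (fun t => sum_n (fun n => F n t) N) a b (sum_n l N).
Proof.
  intros H. induction N as [|N IH].
  - rewrite sum_O. apply is_RInt_ext with (F 0%nat); [|apply H].
    intros t _. now rewrite sum_O.
  - rewrite sum_Sn.
    apply is_RInt_ext with (fun t => plus (sum_n (fun n => F n t) N) (F (S N) t)).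
    + intros t _. now rewrite sum_Sn.
    + apply (is_RInt_plus (V := R_NormedModule) (fun t => sum_n (fun n => F n t) N)); [exact IH | apply H].
Qed.

Lemma is_RInt_Re (f : R -> C) a b (l : C) :
  is_RInt_RC f a b l -> is_RInt (fun t => Re (f t)) a b (Re l).
Proof. exact (is_RInt_fct_extend_fst (U := R_NormedModule) (V := R_NormedModule) f a b l). Qed.

(** Orthogonality of the characters of the circle. *)
Lemma is_RInt_characters (p q : C) n k :
  is_RInt (fun t => Re (p * circle (INR n * t))%C * Re (q * circle (- (INR k * t)))%C) 0 1
    (if Nat.eqb n k then (if Nat.eqb n 0 then Re p * Re q else / 2 * Re (p * q)%C) else 0).
Proof.
  set (e := fun j => RtoC (match j with O => 1 | _ => 0 end)).
  assert (A : is_RInt_RC (fun t => circle (INR n * t) * circle (- (INR k * t)))%C 0 1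
      (e ((n - k) + (k - n))%nat)).
  { destruct (Nat.leb_spec k n) as [L|L].
    - replace (n - k + (k - n))%nat with (n - k)%nat by lia.
      generalize (is_RInt_circle (n - k)). apply (is_RInt_ext (V := C_R_NormedModule)). intros t _.
      rewrite <- circle_plus, minus_INR by exact L. f_equal. ring.
    - replace (n - k + (k - n))%nat with (k - n)%nat by lia.
      generalize (is_RInt_circle_opp (k - n)). apply (is_RInt_ext (V := C_R_NormedModule)). intros t _.
      rewrite <- circle_plus, minus_INR by lia. f_equal. ring. }
  assert (B : is_RInt_RC (fun t => circle (INR n * t) * circle (INR k * t))%C 0 1
      (e (n + k)%nat)).
  { generalize (is_RInt_circle (n + k)). apply (is_RInt_ext (V := C_R_NormedModule)). intros t _.
    rewrite <- circle_plus, plus_INR. f_equal. ring. }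
  assert (A' := is_RInt_Re _ _ _ _ (is_RInt_Cmult (p * q)%C _ _ _ _ A)).
  assert (B' := is_RInt_Re _ _ _ _ (is_RInt_Cmult (p * Cconj q)%C _ _ _ _ B)).
  assert (D := is_RInt_scal (V := R_NormedModule) _ 0 1 (/ 2) _
    (is_RInt_plus (V := R_NormedModule) _ _ 0 1 _ _ A' B')).
  replace (if Nat.eqb n k then _ else 0) with
    (/ 2 * (Re (p * q * e ((n - k) + (k - n))%nat)%C + Re (p * Cconj q * e (n + k)%nat)%C)).
  - revert D. apply (is_RInt_ext (V := R_NormedModule)). intros t _.
    change (/ 2 * (Re (p * q * (circle (INR n * t) * circle (- (INR k * t))))%C
      + Re (p * Cconj q * (circle (INR n * t) * circle (INR k * t)))%C)
      = Re (p * circle (INR n * t))%C * Re (q * circle (- (INR k * t)))%C).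
    rewrite circle_opp, !re_mult, ?im_mult, ?re_conj, ?im_conj. field.
  - destruct (Nat.eqb_spec n k) as [->|N].
    + replace (k - k + (k - k))%nat with 0%nat by lia.
      destruct k as [|k]; cbn [Nat.eqb Nat.add e]; unfold e; rewrite !re_scal_r, ?re_mult, ?im_conj, ?re_conj; field.
    + replace (n - k + (k - n))%nat with (S (pred (n - k + (k - n)))) by lia.
      replace (n + k)%nat with (S (pred (n + k))) by lia.
      unfold e. rewrite !re_scal_r. ring.
Qed.

(** The mean over the circle of [Re P] times [Re Q - m] is non-negative, and by
    orthogonality it is [Re (sum p q) / 2 + (1/2 - m) Re (p 0)].  Truncating both
    series keeps all integrals elementary. *)
Theorem hadamard_positivity (p q : nat -> C) (m : R) :
  abs_summable p -> abs_summable q -> q 0%nat = 1 ->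
  (forall t, 0 <= Re (CSeries (fun n => p n * circle (INR n * t)))%C) ->
  (forall t, m <= Re (CSeries (fun n => q n * circle (- (INR n * t))))%C) ->
  (2 * m - 1) * Re (p 0%nat) <= Re (CSeries (fun n => p n * q n)%C).
Proof.
  intros Hp Hq Hq0 HP HQ.
  set (tp := fun N => Series (fun n => Cmod (p n)) - sum_n (fun n => Cmod (p n)) N).
  set (tq := fun N => Series (fun n => Cmod (q n)) - sum_n (fun n => Cmod (q n)) N).
  set (P := fun N t => sum_n (fun n => Re (p n * circle (INR n * t))%C) N).
  set (Q := fun N t => sum_n (fun n => Re (q n * circle (- (INR n * t)))%C) N).
  assert (Tail : forall (a : nat -> C) (phi : nat -> R), abs_summable a -> forall N,
    Re (CSeries (fun n => a n * circle (phi n))%C) <= sum_n (fun n => Re (a n * circle (phi n))%C) N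
      + (Series (fun n => Cmod (a n)) - sum_n (fun n => Cmod (a n)) N)).
  { intros a phi Ha N.
    assert (E : forall n, Cmod (a n * circle (phi n)) = Cmod (a n))
      by (intros n; rewrite Cmod_mult, Cmod_circle; ring).
    assert (Ha' : abs_summable (fun n => a n * circle (phi n))%C)
      by (apply abs_summable_le with (fun n => Cmod (a n)); [intros n; rewrite E; lra | exact Ha]).
    assert (T := CSeries_tail_le _ N Ha').
    cbv beta in T.
    rewrite (Series_ext _ _ E), (sum_n_ext _ _ N E) in T.
    rewrite <- Re_sum_n.
    assert (B := re_le_Cmod (CSeries (fun n => a n * circle (phi n))%C - Csum_n (fun n => a n * circle (phi n))%C N)).
    apply Rabs_le_between in B. unfold Cminus in B. rewrite re_plus, re_opp in B. unfold Cminus in T. lra. }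
  assert (Tp : forall N, 0 <= tp N).
  { intros N. eapply Rle_trans; [apply Cmod_ge_0 | exact (CSeries_tail_le p N Hp)]. }
  assert (Tq : forall N, 0 <= tq N).
  { intros N. eapply Rle_trans; [apply Cmod_ge_0 | exact (CSeries_tail_le q N Hq)]. }
  assert (Lim : forall a : nat -> C, abs_summable a ->
    is_lim_seq (fun N => Series (fun n => Cmod (a n)) - sum_n (fun n => Cmod (a n)) N) 0).
  { intros a Ha. replace (Finite 0) with (Finite (Series (fun n => Cmod (a n)) - Series (fun n => Cmod (a n)))) by (f_equal; ring).
    apply is_lim_seq_minus'; [apply is_lim_seq_const | exact (Series_correct _ Ha)]. }
  assert (IP : forall N, is_RInt (P N) 0 1 (Re (p 0%nat))).
  { intros N.
    assert (A := is_RInt_sum (fun n t => Re (p n * circle (INR n * t))%C)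
      (fun n => Re (p n * RtoC (match n with O => 1 | _ => 0 end))%C) 0 1 N).
    rewrite (sum_n_single _ 0) in A.
    - cbn [Nat.leb] in A. rewrite re_scal_r, Rmult_1_r in A. apply A.
      intros n. apply is_RInt_Re, is_RInt_Cmult, is_RInt_circle.
    - intros [|n] Hn; [easy|]. rewrite re_scal_r. ring. }
  assert (IQ : forall N, is_RInt (Q N) 0 1 1).
  { intros N.
    assert (A := is_RInt_sum (fun n t => Re (q n * circle (- (INR n * t)))%C)
      (fun n => Re (q n * RtoC (match n with O => 1 | _ => 0 end))%C) 0 1 N).
    rewrite (sum_n_single _ 0) in A.
    - cbn [Nat.leb] in A. rewrite re_scal_r, Rmult_1_r, Hq0 in A. apply A.
      intros n. apply is_RInt_Re, is_RInt_Cmult, is_RInt_circle_opp.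
    - intros [|n] Hn; [easy|]. rewrite re_scal_r. ring. }
  assert (IPQ : forall N, is_RInt (fun t => P N t * Q N t) 0 1
     (/ 2 * sum_n (fun n => Re (p n * q n)%C) N + / 2 * Re (p 0%nat))).
  { intros N.
    set (w := fun k => if Nat.eqb k 0 then Re (p k) * Re (q k) else / 2 * Re (p k * q k)%C).
    assert (A : is_RInt (fun t => sum_n (fun k => P N t * Re (q k * circle (- (INR k * t)))%C) N) 0 1
        (sum_n (fun k => if Nat.leb k N then w k else 0) N)).
    { apply (is_RInt_sum (fun k t => P N t * Re (q k * circle (- (INR k * t)))%C)). intros k.
      assert (B := is_RInt_sum (fun n t => Re (p n * circle (INR n * t))%C * Re (q k * circle (- (INR k * t)))%C)
        _ 0 1 N (fun n => is_RInt_characters (p n) (q k) n k)).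
      rewrite (sum_n_single _ k) in B.
      - rewrite Nat.eqb_refl in B. revert B. apply (is_RInt_ext (V := R_NormedModule)). intros t _.
        unfold P. apply (sum_n_mult_r (K := R_AbsRing)).
      - intros n Hn. now rewrite (proj2 (Nat.eqb_neq n k) Hn). }
    replace (_ + _) with (sum_n (fun k => if Nat.leb k N then w k else 0) N).
    - revert A. apply (is_RInt_ext (V := R_NormedModule)). intros t _.
      unfold Q. apply (sum_n_mult_l (K := R_AbsRing)).
    - rewrite (sum_n_ext_loc _ w) by (intros k Hk; now rewrite (proj2 (Nat.leb_le k N) Hk)).
      clear - Hq0. induction N as [|N IH].
      + rewrite !sum_O. unfold w. cbn [Nat.eqb]. rewrite Hq0, re_scal_r. simpl. field.
      + rewrite !sum_Sn, IH. Rplus_fold. unfold w. cbn [Nat.eqb]. R_ring. }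
  assert (Main : forall N, 0 <= / 2 * sum_n (fun n => Re (p n * q n)%C) N + / 2 * Re (p 0%nat)
      + tp N * 1 + (tq N - m) * Re (p 0%nat) + tp N * (tq N - m)).
  { intros N.
    assert (A : is_RInt (fun t => (P N t + tp N) * (Q N t + (tq N - m))) 0 1
      (/ 2 * sum_n (fun n => Re (p n * q n)%C) N + / 2 * Re (p 0%nat)
      + tp N * 1 + (tq N - m) * Re (p 0%nat) + tp N * (tq N - m))).
    { assert (B := is_RInt_plus (V := R_NormedModule) _ _ 0 1 _ _ (is_RInt_plus (V := R_NormedModule) _ _ 0 1 _ _
        (is_RInt_plus (V := R_NormedModule) _ _ 0 1 _ _ (IPQ N)
        (is_RInt_scal (V := R_NormedModule) _ 0 1 (tp N) _ (IQ N)))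
        (is_RInt_scal (V := R_NormedModule) _ 0 1 (tq N - m) _ (IP N)))
        (is_RInt_const_0_1 (tp N * (tq N - m)))).
      revert B. apply (is_RInt_ext (V := R_NormedModule)). intros t _.
      unfold plus, scal; simpl. unfold mult; simpl. ring. }
    apply (is_RInt_ge_0 _ 0 1 _ Rle_0_1 A). intros t _.
    apply Rmult_le_pos.
    - eapply Rle_trans; [apply (HP t)|]. apply (Tail p (fun n => INR n * t) Hp N).
    - assert (B := HQ t). assert (B' := Tail q (fun n => - (INR n * t)) Hq N).
      unfold Q, tq. cbv beta in B'. lra. }
  assert (Hpq : ex_series (fun n => Re (p n * q n)%C)).
  { apply (abs_summable_Re (fun n => p n * q n)%C).
    apply abs_summable_le with (fun n => Cmod (p n) * (Series (fun n => Cmod (q n)) - 0)).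
    - intros n. rewrite Cmod_mult. apply Rmult_le_compat_l; [apply Cmod_ge_0|].
      assert (A := Tq n). unfold tq in A. destruct n as [|n].
      + rewrite sum_O in A. lra.
      + rewrite sum_Sn in A. unfold plus in A; simpl in A.
        assert (0 <= sum_n (fun n => Cmod (q n)) n); [|lra].
        { clear. induction n as [|n IH]; [rewrite sum_O; apply Cmod_ge_0|].
          rewrite sum_Sn. unfold plus; simpl. assert (A := Cmod_ge_0 (q (S n))). lra. }
    - exact (ex_series_scal_r (Series (fun n => Cmod (q n)) - 0) _ Hp). }
  assert (L : is_lim_seq (fun N => / 2 * sum_n (fun n => Re (p n * q n)%C) N + / 2 * Re (p 0%nat)
      + tp N * 1 + (tq N - m) * Re (p 0%nat) + tp N * (tq N - m))
    (/ 2 * Series (fun n => Re (p n * q n)%C) + / 2 * Re (p 0%nat) + 0 * 1 + (0 - m) * Re (p 0%nat) + 0 * (0 - m))).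
  { assert (Lp := Lim p Hp). assert (Lq := Lim q Hq).
    assert (Lm : is_lim_seq (fun N => tq N - m) (0 - m)) by (apply is_lim_seq_minus'; [exact Lq | apply is_lim_seq_const]).
    apply is_lim_seq_plus'; [apply is_lim_seq_plus'; [apply is_lim_seq_plus';
      [apply is_lim_seq_plus'; [|apply is_lim_seq_const] |] |] |].
    - apply is_lim_seq_mult'; [apply is_lim_seq_const | exact (Series_correct _ Hpq)].
    - apply is_lim_seq_mult'; [exact Lp | apply is_lim_seq_const].
    - apply is_lim_seq_mult'; [exact Lm | apply is_lim_seq_const].
    - apply is_lim_seq_mult'; [exact Lp | exact Lm]. }
  assert (Fin := is_lim_seq_le _ _ _ _ Main (is_lim_seq_const 0) L).
  change (0 <= / 2 * Series (fun n => Re (p n * q n)%C) + / 2 * Re (p 0%nat) + 0 * 1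
    + (0 - m) * Re (p 0%nat) + 0 * (0 - m)) in Fin.
  change (Re (CSeries (fun n => p n * q n)%C)) with (Series (fun n => Re (p n * q n)%C)).
  lra.
Qed.

(** * Improper integrals over the unit interval *)

Lemma filter_prod_01 (Q : R * R -> Prop) :
  filter_prod (at_right 0) (at_left 1) Q <->
  exists eta, 0 < eta /\ forall a b, 0 < a < eta -> 1 - eta < b < 1 -> Q (a, b).
Proof.
  split.
  - intros [P1 P2 [e1 H1] [e2 H2] H].
    exists (Rmin e1 e2). split; [apply Rmin_glb_lt; apply cond_pos|].
    intros a b Ha Hb.
    assert (A1 := Rmin_l e1 e2). assert (A2 := Rmin_r e1 e2).
    apply H.
    + apply H1; [|lra]. apply ball_R_intro; simpl.
      apply Rabs_def1; lra.
    + apply H2; [|lra]. apply ball_R_intro; simpl.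
      apply Rabs_def1; lra.
  - intros [eta [He H]].
    apply Filter_prod with (fun a => 0 < a < eta) (fun b => 1 - eta < b < 1); [| | exact H].
    + exists (mkposreal eta He). intros y Hy Hy0.
      apply ball_R_elim in Hy; simpl in Hy.
      apply Rabs_def2 in Hy. lra.
    + exists (mkposreal eta He). intros y Hy Hy0.
      apply ball_R_elim in Hy; simpl in Hy.
      apply Rabs_def2 in Hy. lra.
Qed.

Lemma is_RInt_gen_01 (g : R -> R) (l : R) :
  is_int01 g l <->
  forall eps, 0 < eps -> exists eta, 0 < eta /\ forall a b, 0 < a < eta -> 1 - eta < b < 1 ->
    exists I, is_RInt g a b I /\ Rabs (I - l) < eps.
Proof.
  split.
  - intros H eps He.
    assert (A := H (fun I => Rabs (I - l) < eps)). unfold filtermapi in A.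
    apply (proj1 (filter_prod_01 _)) in A; [exact A|].
    exists (mkposreal eps He). intros y Hy. exact Hy.
  - intros H P [eps HP]. destruct (H eps (cond_pos eps)) as [eta [He Ha]].
    apply filter_prod_01. exists eta. split; [exact He|].
    intros a b Ha' Hb'. destruct (Ha a b Ha' Hb') as [I [H1 H2]].
    exists I. split; [exact H1 | apply HP; exact H2].
Qed.

Lemma is_RInt_gen_pair (g : R -> C) (l : C) :
  is_int01 (fun t => Re (g t)) (Re l) ->
  is_int01 (fun t => Im (g t)) (Im l) ->
  is_RInt_gen (V := C_R_NormedModule) g (at_right 0) (at_left 1) l.
Proof.
  intros H1 H2 P [eps HP].
  destruct (proj1 (is_RInt_gen_01 _ _) H1 eps (cond_pos eps)) as [e1 [He1 A1]].
  destruct (proj1 (is_RInt_gen_01 _ _) H2 eps (cond_pos eps)) as [e2 [He2 A2]].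
  apply filter_prod_01. exists (Rmin e1 e2).
  assert (B1 := Rmin_l e1 e2). assert (B2 := Rmin_r e1 e2).
  split; [apply Rmin_glb_lt; assumption|].
  intros a b Ha Hb.
  destruct (A1 a b) as [I1 [J1 K1]]; [lra | lra |].
  destruct (A2 a b) as [I2 [J2 K2]]; [lra | lra |].
  exists (I1, I2). split.
  - exact (is_RInt_fct_extend_pair (U := R_NormedModule) (V := R_NormedModule) g a b I1 I2 J1 J2).
  - apply HP. split; assumption.
Qed.

Lemma is_RInt_gen_ge_0 (g : R -> R) (l : R) :
  is_int01 g l ->
  (forall eps, 0 < eps -> exists eta, 0 < eta /\ forall a b I, 0 < a < eta -> a < b < 1 ->
     is_RInt g a b I -> - eps <= I) ->
  0 <= l.
Proof.
  intros H H0. apply le_epsilon. intros eps He.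
  destruct (proj1 (is_RInt_gen_01 _ _) H (eps / 2)) as [e1 [He1 A1]]; [lra|].
  destruct (H0 (eps / 2)) as [e2 [He2 A2]]; [lra|].
  set (a := Rmin (Rmin e1 e2) 1 / 2).
  assert (B1 := Rmin_l (Rmin e1 e2) 1). assert (B2 := Rmin_r (Rmin e1 e2) 1).
  assert (B3 := Rmin_l e1 e2). assert (B4 := Rmin_r e1 e2).
  assert (B5 : 0 < Rmin (Rmin e1 e2) 1) by (repeat apply Rmin_glb_lt; lra).
  destruct (A1 a (1 - a / 2)) as [I [J K]]; [unfold a; lra | unfold a; lra |].
  apply Rabs_def2 in K. assert (A := A2 a (1 - a / 2) I). unfold a in *. 
  assert (- (eps / 2) <= I) by (apply A; [lra | lra | exact J]). lra.
Qed.

Lemma is_RInt_gen_ge_0_pointwise (g : R -> R) (l : R) :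
  is_int01 g l -> (forall t, 0 < t < 1 -> 0 <= g t) -> 0 <= l.
Proof.
  intros H Hg. apply (is_RInt_gen_ge_0 g l H). intros eps He. exists 1. split; [lra|].
  intros a b I Ha Hb HI. assert (0 <= I); [|lra].
  apply (is_RInt_ge_0 g a b I); [lra | exact HI | intros t Ht; apply Hg; lra].
Qed.

Lemma is_RInt_gen_ext_01 (f g : R -> R) (l : R) : (forall t, 0 < t < 1 -> f t = g t) ->
  is_int01 f l -> is_int01 g l.
Proof.
  intros H. apply is_RInt_gen_ext; try apply _.
  apply filter_prod_01. exists 1. split; [lra|]. cbn [fst snd].
  intros a b Ha Hb t Ht.
  assert (0 < Rmin a b) by (apply Rmin_glb_lt; lra).
  assert (Rmax a b < 1) by (apply Rmax_lub_lt; lra).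
  apply H; lra.
Qed.

Lemma int01_unique (g : R -> R) l : is_int01 g l -> int01 g = l.
Proof. exact (is_RInt_gen_unique (V := R_CompleteNormedModule) g l). Qed.

Lemma is_RInt_gen_lincomb (f g : R -> R) (x y lf lg : R) :
  is_int01 f lf -> is_int01 g lg ->
  is_int01 (fun t => x * f t + y * g t) (x * lf + y * lg).
Proof.
  intros Hf Hg. 
  exact (is_RInt_gen_plus (V := R_NormedModule) _ _ _ _
    (is_RInt_gen_scal (V := R_NormedModule) _ x _ Hf) (is_RInt_gen_scal (V := R_NormedModule) _ y _ Hg)).
Qed.

Lemma is_RInt_gen_sum (F : nat -> R -> R) (l : nat -> R) N :
  (forall n, is_int01 (F n) (l n)) ->
  is_int01 (fun t => sum_n (fun n => F n t) N) (sum_n l N).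
Proof.
  intros H. induction N as [|N IH].
  - rewrite sum_O. apply is_RInt_gen_ext_01 with (F 0%nat); [|apply H].
    intros t _. now rewrite sum_O.
  - rewrite sum_Sn.
    apply is_RInt_gen_ext_01 with (fun t => plus (sum_n (fun n => F n t) N) (F (S N) t)).
    + intros t _. now rewrite sum_Sn.
    + exact (is_RInt_gen_plus (V := R_NormedModule) _ _ _ _ IH (H (S N))).
Qed.

Lemma CV_radius_ge (a : nat -> R) r :
  (forall s, 0 <= s < r -> ex_series (fun n => Rabs (a n) * s ^ n)) ->
  forall x, Rabs x < r -> Rbar_lt (Rabs x) (CV_radius a).
Proof.
  intros H x Hx. assert (P := Rabs_pos x).
  set (s := (Rabs x + r) / 2).
  apply Rbar_lt_le_trans with s; [simpl; unfold s; lra|].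
  apply CV_radius_bounded. assert (A := H s ltac:(unfold s; lra)).
  destruct (filterlim_bounded (K := R_AbsRing) (V := R_NormedModule) (fun n => Rabs (a n) * s ^ n)) as [M HM].
  - exists 0. apply (ex_series_lim_0 _ A).
  - exists M. intros n. eapply Rle_trans; [|apply HM].
    unfold norm; simpl. unfold abs; simpl. rewrite !Rabs_mult, Rabs_Rabsolu. apply Rle_refl.
Qed.

(** * Moments of a weight *)

Section Weight.

Variable lam : R -> R.
Hypothesis lam_pos : forall t, 0 < t < 1 -> 0 < lam t.
Hypothesis lam_cont : forall t, 0 < t < 1 -> continuous lam t.
Hypothesis lam_int : is_int01 lam 1.

Let ex_int (g : R -> R) a b : (forall t, 0 < t < 1 -> continuous g t) ->
  0 < a < 1 -> 0 < b < 1 -> ex_RInt g a b.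
Proof.
  intros Hg Ha Hb. apply (ex_RInt_continuous (V := R_CompleteNormedModule)). intros t Ht. apply Hg.
  assert (0 < Rmin a b) by (apply Rmin_glb_lt; lra).
  assert (Rmax a b < 1) by (apply Rmax_lub_lt; lra). lra.
Qed.

Lemma weight_mass_ge_0 a b : 0 < a -> a <= b -> b < 1 -> 0 <= RInt lam a b.
Proof.
  intros Ha Hab Hb. apply RInt_ge_0; [exact Hab | apply ex_int; auto; lra|].
  intros t Ht. left. apply lam_pos. lra.
Qed.

Lemma weight_mass_le_1 a b : 0 < a -> a <= b -> b < 1 -> RInt lam a b <= 1.
Proof.
  intros Ha Hab Hb. apply le_epsilon. intros eps He.
  destruct (proj1 (is_RInt_gen_01 _ _) lam_int eps He) as [eta [He' A]].
  set (a' := Rmin a eta / 2). set (b' := 1 - Rmin (1 - b) eta / 2).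
  assert (B1 := Rmin_l a eta). assert (B2 := Rmin_r a eta).
  assert (B3 := Rmin_l (1 - b) eta). assert (B4 := Rmin_r (1 - b) eta).
  assert (B5 : 0 < Rmin a eta) by (apply Rmin_glb_lt; lra).
  assert (B6 : 0 < Rmin (1 - b) eta) by (apply Rmin_glb_lt; lra).
  destruct (A a' b') as [I [J K]]; [unfold a'; lra | unfold b'; lra|].
  apply Rabs_def2 in K.
  assert (E1 := RInt_Chasles lam a' a b' (ex_int lam a' a lam_cont ltac:(unfold a'; lra) ltac:(lra))
    (ex_int lam a b' lam_cont ltac:(lra) ltac:(unfold b'; lra))).
  assert (E2 := RInt_Chasles lam a b b' (ex_int lam a b lam_cont ltac:(lra) ltac:(lra))
    (ex_int lam b b' lam_cont ltac:(lra) ltac:(unfold b'; lra))).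
  unfold plus in E1, E2; simpl in E1, E2.
  rewrite (is_RInt_unique lam a' b' I J) in E1.
  assert (P1 := weight_mass_ge_0 a' a ltac:(unfold a'; lra) ltac:(unfold a'; lra) ltac:(lra)).
  assert (P2 := weight_mass_ge_0 b b' ltac:(lra) ltac:(unfold b'; lra) ltac:(unfold b'; lra)).
  lra.
Qed.

Lemma dominated_RInt_le (g : R -> R) M a b : 0 < a -> a <= b -> b < 1 ->
  (forall t, 0 < t < 1 -> continuous g t) -> (forall t, 0 < t < 1 -> Rabs (g t) <= M * lam t) ->
  Rabs (RInt g a b) <= M * RInt lam a b.
Proof.
  intros Ha Hab Hb Hg HM.
  apply (norm_RInt_le (V := R_NormedModule) g (fun t => M * lam t) a b).
  - exact Hab.
  - intros t Ht. apply HM. lra.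
  - apply (RInt_correct (V := R_CompleteNormedModule)). apply ex_int; auto; lra.
  - apply (is_RInt_scal (V := R_NormedModule)). apply (RInt_correct (V := R_CompleteNormedModule)).
    apply ex_int; auto; lra.
Qed.

(** Cauchy's criterion for the partial integrals, which vary by at most [M]
    times the corresponding mass of the weight. *)
Lemma ex_RInt_gen_dominated (g : R -> R) M :
  (forall t, 0 < t < 1 -> continuous g t) -> (forall t, 0 < t < 1 -> Rabs (g t) <= M * lam t) ->
  ex_RInt_gen g (at_right 0) (at_left 1).
Proof.
  intros Hg HM.
  assert (M0 : 0 <= M).
  { assert (A := HM (/ 2) ltac:(lra)). assert (B := lam_pos (/ 2) ltac:(lra)).
    assert (D := Rabs_pos (g (/ 2))). nra. }
  assert (Cauchy : exists l, filterlim (fun ab => RInt g (fst ab) (snd ab))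
    (filter_prod (at_right 0) (at_left 1)) (locally (l : R_CompleteSpace))).
  { apply (filterlim_locally_cauchy (U := R_CompleteSpace)). intros eps.
    set (d := eps / (8 * (M + 1))).
    assert (Hd : 0 < d) by (apply Rdiv_lt_0_compat; [apply cond_pos | lra]).
    destruct (proj1 (is_RInt_gen_01 _ _) lam_int d Hd) as [eta [He A]].
    set (eta' := Rmin eta (/ 2)).
    assert (B1 := Rmin_l eta (/ 2)). assert (B2 := Rmin_r eta (/ 2)).
    assert (B3 : 0 < eta') by (apply Rmin_glb_lt; lra).
    exists (fun ab => 0 < fst ab < eta' /\ 1 - eta' < snd ab < 1). split.
    { apply filter_prod_01. exists eta'. split; [exact B3|]. now intros. }
    assert (Left : forall a a' b, 0 < a <= a' -> a' < eta' -> 1 - eta' < b < 1 ->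
      Rabs (RInt g a b - RInt g a' b) <= M * (2 * d)).
    { intros a a' b Ha Ha' Hb. fold eta' in B1, B2.
      destruct (A a b) as [I [J K]]; [lra | lra |]. destruct (A a' b) as [I' [J' K']]; [lra | lra |].
      assert (E := RInt_Chasles g a a' b (ex_int g a a' Hg ltac:(lra) ltac:(lra)) (ex_int g a' b Hg ltac:(lra) ltac:(lra))).
      assert (E' := RInt_Chasles lam a a' b (ex_int lam a a' lam_cont ltac:(lra) ltac:(lra)) (ex_int lam a' b lam_cont ltac:(lra) ltac:(lra))).
      unfold plus in E, E'; simpl in E, E'. rewrite <- E.
      rewrite (is_RInt_unique lam a b I J), (is_RInt_unique lam a' b I' J') in E'.
      rewrite Rplus_minus_r.
      eapply Rle_trans; [apply (dominated_RInt_le g M a a'); auto; lra|].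
      apply Rmult_le_compat_l; [exact M0|].
      apply Rabs_def2 in K. apply Rabs_def2 in K'. lra. }
    assert (Right : forall a b b', 0 < a < eta' -> 1 - eta' < b <= b' -> b' < 1 ->
      Rabs (RInt g a b' - RInt g a b) <= M * (2 * d)).
    { intros a b b' Ha Hb Hb'. fold eta' in B1, B2.
      destruct (A a b) as [I [J K]]; [lra | lra |]. destruct (A a b') as [I' [J' K']]; [lra | lra |].
      assert (E := RInt_Chasles g a b b' (ex_int g a b Hg ltac:(lra) ltac:(lra)) (ex_int g b b' Hg ltac:(lra) ltac:(lra))).
      assert (E' := RInt_Chasles lam a b b' (ex_int lam a b lam_cont ltac:(lra) ltac:(lra)) (ex_int lam b b' lam_cont ltac:(lra) ltac:(lra))).
      unfold plus in E, E'; simpl in E, E'. rewrite <- E.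
      rewrite (is_RInt_unique lam a b I J), (is_RInt_unique lam a b' I' J') in E'.
      rewrite Rplus_minus_l.
      eapply Rle_trans; [apply (dominated_RInt_le g M b b'); auto; lra|].
      apply Rmult_le_compat_l; [exact M0|].
      apply Rabs_def2 in K. apply Rabs_def2 in K'. lra. }
    assert (Small : M * (2 * d) + M * (2 * d) < eps).
    { apply Rlt_le_trans with ((M + 1) * (8 * d)); [|unfold d; right; field; lra]. nra. }
    assert (Two : forall a a' b b', 0 < a < eta' -> 0 < a' < eta' -> 1 - eta' < b < 1 -> 1 - eta' < b' < 1 ->
      Rabs (RInt g a' b' - RInt g a b) < eps).
    { intros a a' b b' Ha Ha' Hb Hb'.
      assert (X : Rabs (RInt g a' b' - RInt g a b') <= M * (2 * d)).
      { destruct (Rle_or_lt a a'); [rewrite Rabs_minus_sym|]; apply Left; lra. }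
      assert (Y : Rabs (RInt g a b' - RInt g a b) <= M * (2 * d)).
      { destruct (Rle_or_lt b b'); [|rewrite Rabs_minus_sym]; apply Right; lra. }
      assert (T := Rdist_tri (RInt g a' b') (RInt g a b) (RInt g a b')). unfold Rdist in T.
      eapply Rle_lt_trans; [exact T|]. lra. }
    intros [a b] [a' b'] [H1 H2] [H3 H4]. cbn [fst snd] in *. now apply Two. }
  destruct Cauchy as [l Hl]. exists l. apply is_RInt_gen_01. intros eps He.
  assert (B := proj1 (filterlim_locally _ _) Hl (mkposreal eps He)).
  destruct (proj1 (filter_prod_01 _) B) as [eta [He' A]].
  exists (Rmin eta (/ 2)). assert (B1 := Rmin_l eta (/ 2)). assert (B2 := Rmin_r eta (/ 2)).
  split; [apply Rmin_glb_lt; lra|]. intros a b Ha Hb. exists (RInt g a b). split.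
  - apply (RInt_correct (V := R_CompleteNormedModule)). apply ex_int; auto; lra.
  - apply A; lra.
Qed.

Lemma is_RInt_gen_dominated (g : R -> R) M :
  (forall t, 0 < t < 1 -> continuous g t) -> (forall t, 0 < t < 1 -> Rabs (g t) <= M * lam t) ->
  is_int01 g (int01 g).
Proof.
  intros Hg HM. apply (RInt_gen_correct (V := R_CompleteNormedModule)). now apply ex_RInt_gen_dominated with M.
Qed.

Definition moment (n : nat) : R := int01 (fun t => lam t * t ^ n).

Lemma is_RInt_gen_moment n :
  is_int01 (fun t => lam t * t ^ n) (moment n).
Proof.
  apply is_RInt_gen_dominated with 1.
  - intros t Ht. apply (continuous_mult (K := R_AbsRing) lam); [now apply lam_cont|].
    apply continuous_of_ex_derive. auto_derive. trivial.
  - intros t Ht. assert (P := lam_pos t Ht). rewrite Rabs_mult, !Rabs_pos_eq; try lra; [|apply pow_le; lra].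
    rewrite Rmult_comm. apply Rmult_le_compat_r; [lra|]. rewrite <- (pow1 n). apply pow_incr; lra.
Qed.

Lemma moment_0 : moment 0 = 1.
Proof.
  apply int01_unique. apply is_RInt_gen_ext_01 with (2 := lam_int). intros t _. simpl. ring.
Qed.

Lemma moment_bounds n : 0 <= moment n <= 1.
Proof.
  split.
  - apply (is_RInt_gen_ge_0_pointwise _ _ (is_RInt_gen_moment n)). intros t Ht.
    apply Rmult_le_pos; [left; now apply lam_pos | apply pow_le; lra].
  - assert (A := is_RInt_gen_lincomb _ _ 1 (-1) _ _ lam_int (is_RInt_gen_moment n)).
    apply is_RInt_gen_ge_0_pointwise in A; [lra|]. intros t Ht.
    assert (P := lam_pos t Ht). assert (Q : t ^ n <= 1) by (rewrite <- (pow1 n); apply pow_incr; lra). nra.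
Qed.

Lemma is_RInt_gen_abs_le (g : R -> R) l M :
  is_int01 g l -> (forall t, 0 < t < 1 -> Rabs (g t) <= M * lam t) ->
  Rabs l <= M.
Proof.
  intros H HM. apply Rabs_le. split.
  - assert (A := is_RInt_gen_lincomb _ _ M 1 _ _ lam_int H).
    apply is_RInt_gen_ge_0_pointwise in A; [lra|]. intros t Ht.
    assert (B := HM t Ht). apply Rabs_le_between in B. lra.
  - assert (A := is_RInt_gen_lincomb _ _ M (-1) _ _ lam_int H).
    apply is_RInt_gen_ge_0_pointwise in A; [lra|]. intros t Ht.
    assert (B := HM t Ht). apply Rabs_le_between in B. lra.
Qed.

Lemma ex_series_mult_pow (a : nat -> R) t : ex_series (fun n => Rabs (a n)) -> Rabs t <= 1 ->
  ex_series (fun n => Rabs (a n * t ^ n)).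
Proof.
  intros Ha Ht. apply ex_series_le_R with (2 := Ha). intros n. rewrite Rabs_Rabsolu, Rabs_mult.
  rewrite <- (Rmult_1_r (Rabs (a n))) at 2. apply Rmult_le_compat_l; [apply Rabs_pos|].
  rewrite <- RPow_abs, <- (pow1 n). apply pow_incr. split; [apply Rabs_pos | exact Ht].
Qed.

(** Partial sums are integrated exactly; since the weight has mass [1], the
    remainder is at most the tail of the series of the [|a_n|]. *)
Theorem is_RInt_gen_power_series (a : nat -> R) : ex_series (fun n => Rabs (a n)) ->
  is_int01 (fun t => lam t * PSeries a t) (Series (fun n => a n * moment n)).
Proof.
  intros Ha. set (A := Series (fun n => Rabs (a n))).
  assert (Sa : forall t, 0 < t < 1 -> ex_series (fun n => Rabs (a n * t ^ n))).
  { intros t Ht. apply ex_series_mult_pow; [exact Ha | rewrite Rabs_pos_eq; lra]. }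
  assert (B : forall t, 0 < t < 1 -> forall n, Rabs (a n * t ^ n) <= Rabs (a n)).
  { intros t Ht n. rewrite Rabs_mult. rewrite <- (Rmult_1_r (Rabs (a n))) at 2.
    apply Rmult_le_compat_l; [apply Rabs_pos|]. rewrite Rabs_pos_eq by (apply pow_le; lra).
    rewrite <- (pow1 n). apply pow_incr; lra. }
  assert (H : is_int01 (fun t => lam t * PSeries a t)
     (int01 (fun t => lam t * PSeries a t))).
  { apply is_RInt_gen_dominated with A.
    - intros t Ht. apply (continuous_mult (K := R_AbsRing) lam); [now apply lam_cont|].
      apply continuous_of_ex_derive. apply ex_derive_PSeries.
      apply (CV_radius_ge a 1); [|rewrite Rabs_pos_eq; lra].
      intros s Hs. apply ex_series_le_R with (2 := ex_series_mult_pow a s Ha ltac:(rewrite Rabs_pos_eq; lra)).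
      intros n. rewrite !Rabs_mult, Rabs_Rabsolu. lra.
    - intros t Ht. assert (P := lam_pos t Ht). rewrite Rabs_mult, (Rabs_pos_eq (lam t)), Rmult_comm by lra.
      apply Rmult_le_compat_r; [lra|]. apply Rabs_Series_le; [now apply B | exact Ha]. }
  replace (Series (fun n => a n * moment n)) with (int01 (fun t => lam t * PSeries a t)); [exact H|].
  symmetry. apply is_series_unique.
  assert (Tail : forall N, Rabs (int01 (fun t => lam t * PSeries a t) - sum_n (fun n => a n * moment n) N)
     <= A - sum_n (fun n => Rabs (a n)) N).
  { intros N.
    assert (S1 := is_RInt_gen_sum (fun n t => a n * (lam t * t ^ n)) (fun n => a n * moment n) N).
    lapply S1; clear S1; [intros S1 | intros n; exact (is_RInt_gen_scal (V := R_NormedModule) _ (a n) _ (is_RInt_gen_moment n))].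
    assert (D := is_RInt_gen_lincomb _ _ 1 (-1) _ _ H S1).
    apply is_RInt_gen_abs_le with (M := A - sum_n (fun n => Rabs (a n)) N) in D.
    - now replace (_ - _) with (1 * int01 (fun t => lam t * PSeries a t) + -1 * sum_n (fun n => a n * moment n) N) by ring.
    - intros t Ht. assert (P := lam_pos t Ht).
      replace (1 * (lam t * PSeries a t) + -1 * sum_n (fun n => a n * (lam t * t ^ n)) N)
        with (lam t * (PSeries a t - sum_n (fun n => a n * t ^ n) N)).
      + rewrite Rabs_mult, (Rabs_pos_eq (lam t)), Rmult_comm by lra. apply Rmult_le_compat_r; [lra|].
        unfold PSeries, A. rewrite !Series_minus_sum; [|exact Ha | now apply ex_series_Rabs, Sa].
        apply Rabs_Series_le; [intros n; now apply B|].
        exact (proj1 (ex_series_incr_n (fun n => Rabs (a n)) (S N)) Ha).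
      + replace (sum_n (fun n => a n * (lam t * t ^ n)) N) with (lam t * sum_n (fun n => a n * t ^ n) N); [ring|].
        rewrite <- (sum_n_mult_l (K := R_AbsRing)). apply sum_n_ext. intros n. unfold mult; simpl. ring. }
  change (is_lim_seq (sum_n (fun n => a n * moment n)) (int01 (fun t => lam t * PSeries a t))).
  apply is_lim_seq_of_error with (fun N => A - sum_n (fun n => Rabs (a n)) N).
  - intros N. rewrite Rabs_minus_sym. apply Tail.
  - replace (Finite 0) with (Finite (A - A)) by (f_equal; ring).
    apply is_lim_seq_minus'; [apply is_lim_seq_const | exact (Series_correct _ Ha)].
Qed.

End Weight.

(** * The extremal kernel *)

Lemma converges_in_1 (c : nat -> C) (M : R) :
  (forall n, Cmod (c n) <= M * (INR n + 1)) -> converges_in 1 c.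
Proof.
  intros H.
  apply converges_in_le_mult with (c := fun n => (INR n * 1 + 1)%C) (M := M).
  - intros n. replace (INR n * 1 + 1)%C with (RtoC (INR n + 1)) by (rewrite RtoC_plus; ring).
    rewrite Cmod_R, Rabs_pos_eq; [apply H | assert (A := pos_INR n); lra].
  - assert (B : converges_in 1 (fun _ => RtoC 1)).
    { apply converges_in_bounded with 1; [lra|]. intros n. rewrite Cmod_1, pow1. lra. }
    apply converges_in_plus; [now apply converges_in_INR | exact B].
Qed.

Lemma CPSeries_plus r c d z : converges_in r c -> converges_in r d -> Cmod z < r ->
  CPSeries (fun n => c n + d n)%C z = (CPSeries c z + CPSeries d z)%C.
Proof.
  intros Hc Hd Hz. unfold CPSeries.
  rewrite <- CSeries_plus by (now apply converges_in_abs with r).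
  apply CSeries_ext. intros n. ring.
Qed.

Lemma CPSeries_scal r k c z : converges_in r c -> Cmod z < r ->
  CPSeries (fun n => k * c n)%C z = (k * CPSeries c z)%C.
Proof.
  intros Hc Hz. unfold CPSeries.
  rewrite <- CSeries_scal by (now apply converges_in_abs with r).
  apply CSeries_ext. intros n. ring.
Qed.

Lemma CPSeries_ext c d z : (forall n, c n = d n) -> CPSeries c z = CPSeries d z.
Proof. intros H. apply CSeries_ext. intros n. now rewrite H. Qed.

Lemma Cmod_lt_1_neq (w : C) : Cmod w < 1 -> (1 - w)%C <> 0.
Proof.
  intros H E. apply Ceq_minus in E. rewrite <- E, Cmod_1 in H. lra.
Qed.

Lemma CPSeries_geom w : Cmod w < 1 -> CPSeries (fun _ => RtoC 1) w = (/ (1 - w))%C.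
Proof.
  intros Hw. assert (N := Cmod_lt_1_neq w Hw).
  assert (B : converges_in 1 (fun _ => RtoC 1)).
  { apply converges_in_1 with 1. intros n. rewrite Cmod_1. assert (A := pos_INR n). lra. }
  assert (E := CPSeries_incr 1 _ w B Hw). set (G := CPSeries (fun _ => RtoC 1) w) in *.
  replace G with ((G - w * G) / (1 - w))%C by (field; exact N).
  replace (G - w * G)%C with (RtoC 1) by (rewrite E at 1; ring).
  field; exact N.
Qed.

Lemma converges_in_S : converges_in 1 (fun n => (INR n + 1)%C).
Proof.
  apply converges_in_1 with 1. intros n. rewrite <- RtoC_plus, Cmod_R, Rabs_pos_eq; [lra|].
  assert (A := pos_INR n). lra.
Qed.

Lemma CPSeries_geom_derive w : Cmod w < 1 ->
  CPSeries (fun n => INR n + 1)%C w = (/ ((1 - w) * (1 - w)))%C.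
Proof.
  intros Hw. assert (N := Cmod_lt_1_neq w Hw).
  assert (B : converges_in 1 (fun _ => RtoC 1)).
  { apply converges_in_1 with 1. intros n. rewrite Cmod_1. assert (A := pos_INR n). lra. }
  assert (E := CPSeries_incr 1 _ w converges_in_S Hw).
  rewrite (CPSeries_ext (fun n => INR (S n) + 1)%C (fun n => (INR n + 1) + 1)%C) in E
    by (intros n; rewrite S_INR, RtoC_plus; ring).
  rewrite (CPSeries_plus 1 (fun n => INR n + 1)%C (fun _ => RtoC 1)) in E by (auto; apply converges_in_S).
  rewrite CPSeries_geom in E by exact Hw.
  set (A := CPSeries (fun n => (INR n + 1)%C) w) in *.
  replace A with ((A - w * A) / (1 - w))%C by (field; exact N).
  replace (A - w * A)%C with (/ (1 - w))%C; [field; exact N|].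
  rewrite E at 1. cbn [INR]. field. exact N.
Qed.

(** The coefficients of [(1 + (x - 1) / 2 w) / (1 - w)^2].  For [|x| = 1] these
    functions, times [w], test starlikeness by Hadamard products. *)
Definition test_coef (x : C) (n : nat) : C := (1 + INR n * ((1 + x) / 2))%C.

Lemma test_coef_bound x n : Cmod x <= 1 -> Cmod (test_coef x n) <= INR n + 1.
Proof.
  intros Hx. unfold test_coef. eapply Rle_trans; [apply Cmod_triangle|].
  rewrite Cmod_1, Cmod_mult, Cmod_R, Rabs_pos_eq by apply pos_INR.
  assert (Cmod ((1 + x) / 2) <= 1).
  { rewrite Cmod_div by (intros E; apply RtoC_inj in E; lra).
    rewrite (Cmod_R 2), (Rabs_pos_eq 2) by lra.
    assert (T := Cmod_triangle 1 x). rewrite Cmod_1 in T. lra. }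
  assert (P := pos_INR n). nra.
Qed.

Lemma CPSeries_test x w : Cmod x <= 1 -> Cmod w < 1 ->
  CPSeries (test_coef x) w = ((1 - w / 2) / ((1 - w) * (1 - w)) + x * ((w / 2) / ((1 - w) * (1 - w))))%C.
Proof.
  intros Hx Hw. assert (N := Cmod_lt_1_neq w Hw).
  assert (B : converges_in 1 (fun _ => RtoC 1)).
  { apply converges_in_1 with 1. intros n. rewrite Cmod_1. assert (A := pos_INR n). lra. }
  rewrite (CPSeries_ext _ (fun n => (1 - x) / 2 * 1 + (1 + x) / 2 * (INR n + 1))%C)
    by (intros n; unfold test_coef; field).
  rewrite (CPSeries_plus 1), !(CPSeries_scal 1), CPSeries_geom, CPSeries_geom_derive;
    auto using converges_in_S.
  - field. exact N.
  - now apply converges_in_scal.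
  - apply converges_in_scal, converges_in_S.
Qed.

(** Here [w = t (c + i s)] and [Q = |1 - w|^2].  The term containing [x] has modulus
    at most [t / (2 Q)]; as the argument of [x] is arbitrary, the bound is sharp. *)
Lemma Re_test_ge (x : C) (t c s : R) : Cmod x <= 1 -> 0 <= t < 1 -> c ^ 2 + s ^ 2 = 1 ->
  let Q := 1 - 2 * t * c + t ^ 2 in
  / 2 * ((1 - t * c) / Q + ((1 - t * c) ^ 2 - t ^ 2 * (1 - c ^ 2)) / Q ^ 2) - t / (2 * Q)
    <= Re (CPSeries (test_coef x) (t * (c, s))%C).
Proof.
  intros Hx Ht Hcs Q. set (w := (t * (c, s))%C).
  assert (Hc : -1 <= c <= 1) by nra.
  assert (HQ : 0 < Q) by (unfold Q; nra).
  assert (Hz : Cmod (c, s) = 1).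
  { unfold Cmod. cbn [fst snd]. rewrite Hcs. apply sqrt_1. }
  assert (Hw : Cmod w = t) by (unfold w; rewrite Cmod_mult, Hz, Cmod_R, Rabs_pos_eq; lra).
  assert (N := Cmod_lt_1_neq w ltac:(lra)).
  rewrite CPSeries_test by (auto; lra). rewrite re_plus.
  assert (Mw : Cmod (1 - w) ^ 2 = Q).
  { rewrite Cmod2_alt. unfold w, Q, Cminus. rewrite re_plus, im_plus, re_opp, im_opp, re_scal_l, im_scal_l.
    cbn [Re Im fst snd RtoC]. nra. }
  assert (A : Re ((1 - w / 2) / ((1 - w) * (1 - w)))%C
    = / 2 * ((1 - t * c) / Q + ((1 - t * c) ^ 2 - t ^ 2 * (1 - c ^ 2)) / Q ^ 2)).
  { assert (Ei : (/ (1 - w))%C = ((1 - t * c) / Q, t * s / Q)).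
    { replace (/ (1 - w))%C with (/ (1 - w) * (RtoC Q * / RtoC Q))%C.
      - rewrite <- Mw at 1. rewrite Cmod2_conj.
        replace (/ (1 - w) * ((1 - w) * Cconj (1 - w) * / Q))%C with (Cconj (1 - w) * / Q)%C
          by (field; split; [intros E; apply RtoC_inj in E; lra | exact N]).
        rewrite <- RtoC_inv by lra.
        apply C_eq; [rewrite re_scal_r, re_conj | rewrite im_scal_r, im_conj];
          unfold w, Cminus; rewrite ?re_plus, ?im_plus, ?re_opp, ?im_opp, ?re_scal_l, ?im_scal_l;
          cbn [Re Im fst snd RtoC]; field; lra.
      - rewrite Cinv_r; [ring | intros E; apply RtoC_inj in E; lra]. }
    replace ((1 - w / 2) / ((1 - w) * (1 - w)))%C with ((/ 2)%R * (/ (1 - w) + / (1 - w) * / (1 - w)))%C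
      by (rewrite RtoC_inv by lra; field; exact N).
    rewrite Ei, re_scal_l, re_plus, re_mult. cbn [Re Im fst snd].
    replace (1 - c ^ 2) with (s ^ 2) by lra. field. lra. }
  assert (B : Cmod (x * (w / 2 / ((1 - w) * (1 - w))))%C <= t / (2 * Q)).
  { rewrite Cmod_mult, Cmod_div by (now apply Cmult_neq_0).
    rewrite Cmod_div by (intros E; apply RtoC_inj in E; lra).
    rewrite Cmod_mult, Hw, Cmod_R, (Rabs_pos_eq 2) by lra.
    replace (Cmod (1 - w) * Cmod (1 - w)) with Q by (rewrite <- Mw; ring).
    replace (t / (2 * Q)) with (1 * (t / 2 / Q)) by (field; lra).
    apply Rmult_le_compat_r; [|exact Hx].
    apply Rmult_le_pos; [lra | left; now apply Rinv_0_lt_compat]. }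
  assert (D := re_le_Cmod (x * (w / 2 / ((1 - w) * (1 - w))))%C).
  apply Rabs_le_between in D. lra.
Qed.

(** A non-negative function that vanishes at [t = 0] and grows more slowly than the
    integral from [0] to [t] of [1 - s] times the excess of the bound of
    [Re_test_ge] over [1 / (1 + s)^2].  It agrees with that integral to leading
    order at [t = 0], and the factor [(1 - t)^2 / Q] keeps it bounded near [t = 1]
    for all [c], including [c = 1], where [Q = (1 - t)^2]. *)
Definition minorant (c t : R) : R :=
  3 * (1 + c) * t ^ 2 * (1 - t) ^ 2 / ((4 + 5 * t) * (1 - 2 * t * c + t ^ 2)).

Definition minorant' (c t : R) : R :=
  let Q := 1 - 2 * t * c + t ^ 2 in
  (1 + c) * (1 - t) / Q ^ 2 *
  (3 * (8 * t + 5 * t ^ 2) / (4 + 5 * t) ^ 2 * (1 - t) * Q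
   - 2 * (3 * t ^ 2 / (4 + 5 * t)) * Q - 3 * t ^ 2 / (4 + 5 * t) * (1 - t) * (2 * t - 2 * c)).

Lemma Q_ge c t : -1 <= c <= 1 -> 0 <= t < 1 -> 0 < (1 - t) ^ 2 <= 1 - 2 * t * c + t ^ 2.
Proof. intros Hc Ht. split; nra. Qed.

Lemma is_derive_minorant c t : -1 <= c <= 1 -> 0 <= t < 1 ->
  is_derive (minorant c) t (minorant' c t).
Proof.
  intros Hc Ht. assert (H := Q_ge c t Hc Ht).
  unfold minorant. auto_derive.
  - apply Rmult_integral_contrapositive_currified; lra.
  - unfold minorant'. field. split; lra.
Qed.

Lemma minorant_bounds c t : -1 <= c <= 1 -> 0 <= t < 1 -> 0 <= minorant c t <= 2 * t ^ 2.
Proof.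
  intros Hc Ht. assert (H := Q_ge c t Hc Ht). unfold minorant.
  set (Q := 1 - 2 * t * c + t ^ 2) in *. set (u := (1 - t) ^ 2) in *.
  assert (T2 := pow2_ge_0 t).
  assert (N : 0 <= 3 * (1 + c) * t ^ 2 * u) by (repeat apply Rmult_le_pos; lra).
  assert (D : 0 < (4 + 5 * t) * Q) by (apply Rmult_lt_0_compat; lra).
  split.
  - apply Rmult_le_pos; [exact N | left; now apply Rinv_0_lt_compat].
  - apply Rmult_le_reg_r with ((4 + 5 * t) * Q); [exact D|].
    unfold Rdiv. rewrite Rmult_assoc, Rinv_l, Rmult_1_r by lra.
    apply Rle_trans with (6 * t ^ 2 * Q).
    + apply Rmult_le_compat; try lra; [apply Rmult_le_pos; lra|]. apply Rmult_le_compat_r; lra.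
    + replace (2 * t ^ 2 * ((4 + 5 * t) * Q)) with ((8 + 10 * t) * t ^ 2 * Q) by ring.
      apply Rmult_le_compat_r; [lra|]. apply Rmult_le_compat_r; lra.
Qed.

(** After clearing the positive factors the difference is affine in [c]; its
    values at [c = -1] and [c = 1] are the two polynomials below. *)
Lemma minorant'_le c t : -1 <= c <= 1 -> 0 <= t < 1 ->
  let Q := 1 - 2 * t * c + t ^ 2 in
  minorant' c t <= (1 - t) *
   ((/ 2 * ((1 - t * c) / Q + ((1 - t * c) ^ 2 - t ^ 2 * (1 - c ^ 2)) / Q ^ 2) - t / (2 * Q)) - / (1 + t) ^ 2).
Proof.
  intros Hc Ht Q. assert (H := Q_ge c t Hc Ht). fold Q in H.
  match goal with |- _ <= ?r =>
    assert (E : r - minorant' c t = (1 + c) * (1 - t) * t / (2 * (4 + 5 * t) ^ 2 * Q ^ 2) *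
    ((1 - c) / 2 * (42 * t + 53 * t ^ 2 + 8 * t ^ 3 + 5 * t ^ 4)
     + (1 + c) / 2 * ((1 - t) ^ 3 * (10 * t + 7 * t ^ 2 - 5 * t ^ 3) / (1 + t) ^ 2))) end.
  { unfold minorant'. fold Q. unfold Q in *. field. repeat split; lra. }
  assert (P2 := pow_le t 2 (proj1 Ht)). assert (P3 := pow_le t 3 (proj1 Ht)). assert (P4 := pow_le t 4 (proj1 Ht)).
  assert (P5 := pow_le (1 - t) 3 ltac:(lra)).
  match type of E with _ = ?r => assert (0 <= r); [|lra] end.
  apply Rmult_le_pos.
  - apply Rmult_le_pos; [repeat apply Rmult_le_pos; lra|].
    left. apply Rinv_0_lt_compat. repeat apply Rmult_lt_0_compat; try apply pow_lt; lra.
  - apply Rplus_le_le_0_compat.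
    + apply Rmult_le_pos; lra.
    + apply Rmult_le_pos; [lra|]. apply Rmult_le_pos.
      * apply Rmult_le_pos; [exact P5|]. replace (t ^ 3) with (t * t ^ 2) by ring. nra.
      * left. apply Rinv_0_lt_compat, pow_lt; lra.
Qed.

Lemma nondecreasing_of_derive (F dF : R -> R) a b : a <= b ->
  (forall t, a <= t <= b -> is_derive F t (dF t)) -> (forall t, a <= t <= b -> 0 <= dF t) ->
  F a <= F b.
Proof.
  intros Hab HF Hd.
  destruct (MVT_gen F a b dF) as [c [Hc E]].
  - intros t Ht. rewrite Rmin_left, Rmax_right in Ht by exact Hab. apply HF; lra.
  - intros t Ht. rewrite Rmin_left, Rmax_right in Ht by exact Hab.
    apply derivable_continuous_pt. exists (dF t). apply is_derive_Reals. apply HF; lra.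
  - rewrite Rmin_left, Rmax_right in Hc by exact Hab.
    assert (0 <= dF c * (b - a)) by (apply Rmult_le_pos; [now apply Hd | lra]). lra.
Qed.

(** * Weights with decreasing [λ(t) / (1 - t)] *)

Section DecreasingWeight.

Variables lam dlam : R -> R.
Hypothesis lam_pos : forall t, 0 < t < 1 -> 0 < lam t.
Hypothesis lam_der : forall t, 0 < t < 1 -> is_derive lam t (dlam t).
Hypothesis dlam_le : forall t, 0 < t < 1 -> dlam t <= - (lam t / (1 - t)).
Hypothesis lam_int : is_int01 lam 1.

Lemma weight_cont t : 0 < t < 1 -> continuous lam t.
Proof.
  intros Ht. apply continuous_of_ex_derive. eexists. now apply lam_der.
Qed.

Lemma dlam_neg t : 0 < t < 1 -> dlam t <= 0.
Proof.
  intros Ht. assert (A := dlam_le t Ht).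
  assert (0 < lam t / (1 - t)) by (apply Rdiv_lt_0_compat; [now apply lam_pos | lra]). lra.
Qed.

Lemma t_weight_le_2 a : 0 < a < 1 -> a * lam a <= 2.
Proof.
  intros Ha.
  assert (Mass := weight_mass_le_1 lam lam_pos weight_cont lam_int (a / 2) a ltac:(lra) ltac:(lra) ltac:(lra)).
  assert (E : ex_RInt lam (a / 2) a).
  { apply (ex_RInt_continuous (V := R_CompleteNormedModule)). intros t.
    rewrite Rmin_left, Rmax_right by lra. intros Ht. apply weight_cont. lra. }
  assert (L : RInt (fun _ => lam a) (a / 2) a <= RInt lam (a / 2) a).
  { apply RInt_le; [lra | apply (ex_RInt_const (V := R_NormedModule)) | exact E |].
    intros t Ht. assert (A : - lam t <= - lam a); [|lra].
    apply (nondecreasing_of_derive (fun t => - lam t) (fun t => - dlam t)); [lra | |].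
    - intros s Hs. apply (is_derive_opp (V := R_NormedModule) lam). apply lam_der. lra.
    - intros s Hs. assert (A := dlam_neg s ltac:(lra)). lra. }
  rewrite (RInt_const (V := R_CompleteNormedModule)) in L.
  unfold scal in L; simpl in L; unfold mult in L; simpl in L. lra.
Qed.

(** A second mean value theorem.  As [dPhi u <= (1 - u) D u] and [λ(t) / (1 - ρ t)]
    decreases along with [λ(t) / (1 - t)], the difference between the integral
    from [a] to [t] and [λ(t) / (1 - ρ t) * Phi (ρ t) / ρ] is nondecreasing in [t].
    At [t = a] it tends to [0] with [a], because [a λ(a)] stays bounded while
    [Phi (ρ a)] is of order [a^2]. *)
Lemma weighted_integral_ge_0 (D Phi dPhi : R -> R) rho I : 0 < rho < 1 ->
  (forall u, 0 < u < 1 -> is_derive Phi u (dPhi u)) ->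
  (forall u, 0 < u < 1 -> 0 <= Phi u <= 2 * u ^ 2) ->
  (forall u, 0 < u < 1 -> dPhi u <= (1 - u) * D u) ->
  (forall u, 0 < u < 1 -> continuous D u) ->
  is_int01 (fun t => lam t * D (rho * t)) I -> 0 <= I.
Proof.
  intros Hr HPhi BPhi HD CD HI.
  apply (is_RInt_gen_ge_0 _ _ HI). intros eps He.
  exists (Rmin (eps / 8) (/ 2)). split; [apply Rmin_glb_lt; lra|].
  intros a b J Ha Hb HJ.
  assert (B1 := Rmin_l (eps / 8) (/ 2)). assert (B2 := Rmin_r (eps / 8) (/ 2)).
  assert (R01 : forall t, 0 < t < 1 -> 0 < rho * t < 1).
  { intros t Ht. split; [apply Rmult_lt_0_compat; lra|]. assert (rho * t < 1 * t) by (apply Rmult_lt_compat_r; lra). lra. }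
  assert (Cg : forall t, 0 < t < 1 -> continuous (fun t => lam t * D (rho * t)) t).
  { intros t Ht. apply (continuous_mult (K := R_AbsRing) lam); [now apply weight_cont|].
    apply (continuous_comp (fun t => rho * t) D); [|now apply CD, R01].
    apply continuous_of_ex_derive. auto_derive. trivial. }
  set (g := fun t => lam t * D (rho * t)) in *.
  set (m := fun t => lam t / (1 - rho * t)).
  set (dm := fun t => (dlam t * (1 - rho * t) + rho * lam t) / (1 - rho * t) ^ 2).
  assert (Hm : forall t, 0 < t < 1 -> is_derive m t (dm t)).
  { intros t Ht. assert (A := R01 t Ht). unfold m, dm.
    replace ((dlam t * (1 - rho * t) + rho * lam t) / (1 - rho * t) ^ 2)
      with ((dlam t * (1 - rho * t) - lam t * (- rho)) / (1 - rho * t) ^ 2) by (field; lra).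
    apply (is_derive_div lam (fun t => 1 - rho * t) t (dlam t) (- rho)); [now apply lam_der | auto_derive; [trivial | ring] | lra]. }
  assert (dm_neg : forall t, 0 < t < 1 -> dm t <= 0).
  { intros t Ht. assert (A := R01 t Ht). unfold dm.
    assert (L := lam_pos t Ht). assert (dL := dlam_le t Ht).
    assert (Q2 : 0 < (1 - rho * t) ^ 2) by (apply pow_lt; lra).
    apply Rmult_le_reg_r with ((1 - rho * t) ^ 2); [exact Q2|].
    unfold Rdiv at 1. rewrite Rmult_assoc, Rinv_l, Rmult_1_r, Rmult_0_l by lra.
    assert (X : dlam t * (1 - rho * t) <= - (lam t / (1 - t)) * (1 - rho * t)) by (apply Rmult_le_compat_r; lra).
    assert (Y : rho * lam t <= lam t / (1 - t) * (1 - rho * t)).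
    { replace (rho * lam t) with (lam t / (1 - t) * (rho * (1 - t))) by (field; lra).
      apply Rmult_le_compat_l; [left; apply Rdiv_lt_0_compat; lra | lra]. }
    lra. }
  set (N := fun t => RInt g a t - m t * Phi (rho * t) / rho).
  set (dN := fun t => g t - (dm t * Phi (rho * t) + m t * (rho * dPhi (rho * t))) / rho).
  assert (Mono : N a <= N b).
  { apply nondecreasing_of_derive with dN; [lra | |].
    - intros t Ht. assert (T := R01 t ltac:(lra)).
      assert (D1 : is_derive (fun t => RInt g a t) t (g t)).
      { apply (is_derive_RInt (V := R_NormedModule) g _ a t).
        - set (d := Rmin t (1 - t)).
          assert (Hd : 0 < d) by (apply Rmin_glb_lt; lra).
          assert (E1 := Rmin_l t (1 - t)). assert (E2 := Rmin_r t (1 - t)). fold d in E1, E2.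
          exists (mkposreal d Hd). intros y Hy.
          apply ball_R_elim in Hy; simpl in Hy.
          apply Rabs_def2 in Hy.
          apply (RInt_correct (V := R_CompleteNormedModule)).
          apply (ex_RInt_continuous (V := R_CompleteNormedModule)). intros s Hs. apply Cg.
          assert (0 < Rmin a y) by (apply Rmin_glb_lt; lra).
          assert (Rmax a y < 1) by (apply Rmax_lub_lt; lra). lra.
        - apply Cg. lra. }
      assert (D2 : is_derive (fun t => Phi (rho * t)) t (rho * dPhi (rho * t))).
      { apply (is_derive_comp (V := R_NormedModule) Phi (fun t => rho * t) t (dPhi (rho * t)) rho);
          [now apply HPhi | auto_derive; [trivial | ring]]. }
      assert (D3 := is_derive_mult (K := R_AbsRing) m (fun t => Phi (rho * t)) t _ _ (Hm t ltac:(lra)) D2 Rmult_comm).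
      assert (D4 := is_derive_minus (V := R_NormedModule) _ _ t _ _ D1
        (is_derive_scal _ t (/ rho) _ D3)).
      apply is_derive_ext with (f := fun t => minus (RInt g a t) (/ rho * mult (m t) (Phi (rho * t)))).
      + intros s. unfold N, minus, plus, opp, mult; simpl. unfold Rdiv. 
        match goal with |- ?x = ?y => change (@eq R x y) end. rewrite (Rmult_comm (m s * Phi (rho * s))). reflexivity.
      + replace (dN t) with (minus (g t) (mult (/ rho) (plus (mult (dm t) (Phi (rho * t))) (mult (m t) (rho * dPhi (rho * t))))));
          [exact D4|].
        unfold dN, minus, plus, opp, mult; simpl. unfold Rdiv. ring.
    - intros t Ht. assert (T := R01 t ltac:(lra)). unfold dN.
      assert (P := BPhi _ T). assert (Hd := HD _ T). assert (dmn := dm_neg t ltac:(lra)).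
      assert (L := lam_pos t ltac:(lra)).
      assert (X : m t * dPhi (rho * t) <= g t).
      { unfold m, g. replace (lam t * D (rho * t)) with (lam t / (1 - rho * t) * ((1 - rho * t) * D (rho * t))) by (field; lra).
        apply Rmult_le_compat_l; [left; apply Rdiv_lt_0_compat; lra | exact Hd]. }
      assert (Y : dm t * Phi (rho * t) / rho <= 0).
      { apply Rmult_le_reg_r with rho; [lra|]. unfold Rdiv. rewrite Rmult_assoc, Rinv_l by lra. nra. }
      replace ((dm t * Phi (rho * t) + m t * (rho * dPhi (rho * t))) / rho)
        with (dm t * Phi (rho * t) / rho + m t * dPhi (rho * t)) by (field; lra).
      lra. }
  assert (Ta := R01 a ltac:(lra)). assert (Tb := R01 b ltac:(lra)).
  assert (Na : - (8 * a) <= N a).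
  { unfold N. rewrite (RInt_point (V := R_CompleteNormedModule)). unfold zero; simpl.
    assert (P := BPhi _ Ta). assert (W := t_weight_le_2 a ltac:(lra)). assert (L := lam_pos a ltac:(lra)).
    assert (X : m a * Phi (rho * a) / rho <= 8 * a); [|lra].
    apply Rle_trans with (2 * lam a * (2 * a ^ 2)); [|replace (2 * lam a * (2 * a ^ 2)) with (4 * a * (a * lam a)) by ring; nra].
    replace (m a * Phi (rho * a) / rho) with (m a * (Phi (rho * a) / rho)) by (field; lra).
    apply Rmult_le_compat.
    - unfold m. left. apply Rdiv_lt_0_compat; lra.
    - apply Rmult_le_pos; [apply P | left; apply Rinv_0_lt_compat; lra].
    - unfold m. replace (2 * lam a) with (lam a * / (/ 2)) by (field).
      apply Rmult_le_compat_l; [lra|]. apply Rinv_le_contravar; [lra|].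
      assert (rho * a <= 1 * a) by (apply Rmult_le_compat_r; lra). lra.
    - apply Rmult_le_reg_r with rho; [lra|]. unfold Rdiv. rewrite Rmult_assoc, Rinv_l by lra.
      rewrite Rmult_1_r. eapply Rle_trans; [apply P|].
      replace (2 * (rho * a) ^ 2) with (2 * a ^ 2 * rho * rho) by ring.
      rewrite <- (Rmult_1_r (2 * a ^ 2 * rho)) at 2. apply Rmult_le_compat_l; [|lra].
      assert (0 < a ^ 2) by (apply pow_lt; lra). nra. }
  assert (Nb : N b <= J).
  { unfold N. rewrite (is_RInt_unique (V := R_CompleteNormedModule) g a b J HJ).
    assert (P := BPhi _ Tb). assert (L := lam_pos b ltac:(lra)).
    assert (0 <= m b * Phi (rho * b) / rho); [|lra].
    apply Rmult_le_pos; [|left; apply Rinv_0_lt_compat; lra].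
    apply Rmult_le_pos; [|apply P]. unfold m. left. apply Rdiv_lt_0_compat; lra. }
  lra.
Qed.

End DecreasingWeight.

(** * Averaging over dilations *)

Definition converges_on_unit (a : nat -> R) : Prop :=
  forall s, 0 <= s < 1 -> ex_series (fun n => Rabs (a n) * s ^ n).

Lemma converges_on_unit_radius a x : converges_on_unit a -> Rabs x < 1 -> Rbar_lt (Rabs x) (CV_radius a).
Proof. intros H Hx. now apply (CV_radius_ge a 1). Qed.

Lemma converges_on_unit_bound (a : nat -> R) M :
  (forall n, Rabs (a n) <= M * (INR n + 1)) -> converges_on_unit a.
Proof.
  intros H s Hs.
  assert (B : converges_in 1 (fun n => RtoC (a n))).
  { apply converges_in_1 with M. intros n. rewrite Cmod_R. apply H. }
  specialize (B s Hs).
  revert B. apply ex_series_ext. intros n. now rewrite Cmod_R.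
Qed.

Lemma converges_on_unit_le (a b : nat -> R) M :
  (forall n, Rabs (b n) <= M * Rabs (a n)) -> converges_on_unit a -> converges_on_unit b.
Proof.
  intros H Ha s Hs. apply ex_series_le_R with (fun n => M * (Rabs (a n) * s ^ n)).
  - intros n. assert (P := pow_le s n (proj1 Hs)).
    rewrite Rabs_pos_eq by (apply Rmult_le_pos; [apply Rabs_pos | exact P]).
    rewrite <- Rmult_assoc. now apply Rmult_le_compat_r.
  - apply ex_series_mult_l, Ha, Hs.
Qed.

Lemma converges_on_unit_ex a t : converges_on_unit a -> Rabs t < 1 -> ex_series (fun n => a n * t ^ n).
Proof.
  intros H Ht. apply ex_series_le_R with (fun n => Rabs (a n) * Rabs t ^ n).
  - intros n. rewrite Rabs_mult, <- RPow_abs. lra.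
  - apply H. split; [apply Rabs_pos | exact Ht].
Qed.

Lemma PSeries_Euler (b : nat -> R) kappa t : converges_on_unit b -> Rabs t < 1 ->
  PSeries (fun n => (kappa + INR n) * b n) t = kappa * PSeries b t + t * PSeries (PS_derive b) t.
Proof.
  intros Hb Ht.
  assert (Rt := converges_on_unit_radius b t Hb Ht).
  assert (Eb := converges_on_unit_ex b t Hb Ht).
  assert (Ed : ex_series (fun n => INR n * b n * t ^ n)).
  { apply (ex_series_incr_1 (fun n => INR n * b n * t ^ n)).
    assert (X : ex_pseries (PS_derive b) t) by (apply CV_radius_inside; now rewrite CV_radius_derive).
    destruct X as [l Hl]. exists (scal t l).
    assert (Y := is_series_scal_l t _ _ Hl). revert Y. apply is_series_ext.
    intros n. unfold PS_derive, scal, mult; simpl. unfold mult; simpl.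
    rewrite pow_n_pow. R_ring. }
  replace (t * PSeries (PS_derive b) t) with (Series (fun n => INR n * b n * t ^ n)).
  - unfold PSeries. rewrite <- !Series_scal_l, <- Series_plus; [| now apply ex_series_mult_l | exact Ed].
    apply Series_ext. intros n. ring.
  - rewrite Series_incr_1 by exact Ed. change (INR 0) with 0. rewrite !Rmult_0_l, Rplus_0_l.
    unfold PSeries. rewrite <- Series_scal_l. apply Series_ext. intros n. unfold PS_derive.
    rewrite <- tech_pow_Rmult. ring.
Qed.

Lemma is_derive_Rpower_PSeries (b : nat -> R) kappa t : converges_on_unit b -> 0 < t < 1 ->
  is_derive (fun t => Rpower t kappa * PSeries b t) t
    (Rpower t kappa / t * PSeries (fun n => (kappa + INR n) * b n) t).
Proof.
  intros Hb Ht. assert (Ht' : Rabs t < 1) by (rewrite Rabs_pos_eq; lra).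
  assert (D1 := is_derive_PSeries b t (converges_on_unit_radius b t Hb Ht')).
  assert (D2 : is_derive (fun t => Rpower t kappa) t (Rpower t kappa / t * kappa)).
  { unfold Rpower. auto_derive; [lra|]. field. lra. }
  assert (D3 := is_derive_mult (K := R_AbsRing) _ _ t _ _ D2 D1 Rmult_comm).
  rewrite PSeries_Euler by assumption.
  replace (Rpower t kappa / t * (kappa * PSeries b t + t * PSeries (PS_derive b) t))
    with (plus (mult (Rpower t kappa / t * kappa) (PSeries b t)) (mult (Rpower t kappa) (PSeries (PS_derive b) t)));
    [exact D3|].
  unfold plus, mult; simpl. field. lra.
Qed.

(** [∑ a_n s^n / (1 + ν n)] is the mean of the dilates [∑ a_n (r^ν s)^n] over
    [0 < r < 1].  If it were negative at [s0], then, [s^(1/ν)] times it being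
    nondecreasing, it would be at most as large at all smaller [s], whereas both
    series have the same value at [0]. *)
Lemma averaging (a : nat -> R) nu : 0 < nu -> converges_on_unit a ->
  (forall s, 0 < s < 1 -> 0 <= PSeries a s) ->
  forall s, 0 < s < 1 -> 0 <= PSeries (fun n => a n / (1 + nu * INR n)) s.
Proof.
  intros Hnu Ha Hpos s0 Hs0.
  set (b := fun n => a n / (1 + nu * INR n)).
  assert (Pn : forall n, 1 <= 1 + nu * INR n).
  { intros n. assert (P := pos_INR n). assert (0 <= nu * INR n) by (apply Rmult_le_pos; lra). lra. }
  assert (Hb : converges_on_unit b).
  { apply converges_on_unit_le with a 1; [|exact Ha]. intros n. assert (P := Pn n).
    unfold b, Rdiv. rewrite Rabs_mult, Rmult_comm. apply Rmult_le_compat_r; [apply Rabs_pos|].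
    rewrite Rabs_pos_eq by (left; apply Rinv_0_lt_compat; lra).
    rewrite <- Rinv_1. apply Rinv_le_contravar; lra. }
  set (y := PSeries b).
  destruct (Rle_or_lt 0 (y s0)) as [|Hneg]; [assumption|exfalso].
  assert (E0 : y 0 = PSeries a 0).
  { unfold y. rewrite !PSeries_0. unfold b. simpl. field. }
  assert (Cont : forall c, converges_on_unit c -> continuous (PSeries c) 0).
  { intros c Hc. apply continuous_of_ex_derive. apply ex_derive_PSeries.
    apply converges_on_unit_radius; [exact Hc | rewrite Rabs_R0; lra]. }
  assert (He : 0 < - y s0 / 2) by lra.
  assert (L1 := proj1 (filterlim_locally _ _) (Cont a Ha) (mkposreal _ He)).
  assert (L2 := proj1 (filterlim_locally _ _) (Cont b Hb) (mkposreal _ He)).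
  destruct (filter_and _ _ L1 L2) as [d Hd].
  set (s := Rmin (d / 2) (s0 / 2)).
  assert (B1 := Rmin_l (d / 2) (s0 / 2)). assert (B2 := Rmin_r (d / 2) (s0 / 2)).
  assert (Pd := cond_pos d).
  assert (Hs : 0 < s) by (apply Rmin_glb_lt; lra). fold s in B1, B2.
  destruct (Hd s) as [H1 H2].
  { apply ball_R_intro; simpl. rewrite Rminus_0_r, Rabs_pos_eq; lra. }
  unfold ball in H1, H2; simpl in H1, H2. unfold AbsRing_ball, abs, minus, plus, opp in H1, H2; simpl in H1, H2.
  apply Rabs_def2 in H1. apply Rabs_def2 in H2.
  fold y in H2. rewrite E0 in H2.
  assert (P := Hpos s ltac:(lra)).
  assert (Mono : Rpower s (/ nu) * y s <= Rpower s0 (/ nu) * y s0).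
  { apply (nondecreasing_of_derive (fun t => Rpower t (/ nu) * y t)
      (fun t => Rpower t (/ nu) / t * (/ nu * PSeries a t))); [lra | |].
    - intros t Ht.
      replace (/ nu * PSeries a t) with (PSeries (fun n => (/ nu + INR n) * b n) t);
        [apply is_derive_Rpower_PSeries; [exact Hb | lra]|].
      unfold PSeries. rewrite <- Series_scal_l. apply Series_ext. intros n. unfold b.
      assert (Q := Pn n). field. split; lra.
    - intros t Ht. apply Rmult_le_pos.
      + left. apply Rdiv_lt_0_compat; [apply exp_pos | lra].
      + apply Rmult_le_pos; [left; now apply Rinv_0_lt_compat | apply Hpos; lra]. }
  assert (Q : 0 < Rpower s (/ nu)) by apply exp_pos.
  assert (Q' : Rpower s (/ nu) <= Rpower s0 (/ nu)).
  { apply Rle_Rpower_l; [left; now apply Rinv_0_lt_compat | lra]. }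
  assert (Rpower s0 (/ nu) * y s0 <= Rpower s (/ nu) * y s0) by nra.
  assert (y s <= y s0) by (apply Rmult_le_reg_l with (Rpower s (/ nu)); lra).
  lra.
Qed.

(** * The averaged kernel *)

(** The factor [n + 1] comes from convexity, the denominator from inverting [L]. *)
Definition averaged (mu nu : R) (a : nat -> R) (n : nat) : R :=
  a n * ((INR n + 1) / ((1 + mu * INR n) * (1 + nu * INR n))).

Lemma averaged_factor_bounds mu nu n : 1 <= mu -> 0 < nu ->
  0 <= (INR n + 1) / ((1 + mu * INR n) * (1 + nu * INR n)) <= 1.
Proof.
  intros Hmu Hnu. assert (P := pos_INR n).
  assert (0 <= nu * INR n) by (apply Rmult_le_pos; lra).
  assert (INR n <= mu * INR n) by nra.
  assert (D : 0 < (1 + mu * INR n) * (1 + nu * INR n)) by (apply Rmult_lt_0_compat; lra).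
  split.
  - apply Rmult_le_pos; [lra | left; now apply Rinv_0_lt_compat].
  - apply Rmult_le_reg_r with (1 := D). unfold Rdiv. rewrite Rmult_assoc, Rinv_l by lra. nra.
Qed.

Lemma Rabs_averaged_le mu nu a n : 1 <= mu -> 0 < nu -> Rabs (averaged mu nu a n) <= Rabs (a n).
Proof.
  intros Hmu Hnu. assert (B := averaged_factor_bounds mu nu n Hmu Hnu).
  unfold averaged. rewrite Rabs_mult, (Rabs_pos_eq (_ / _)) by apply B.
  rewrite <- (Rmult_1_r (Rabs (a n))) at 2. apply Rmult_le_compat_l; [apply Rabs_pos | apply B].
Qed.

Lemma converges_averaged mu nu a : 1 <= mu -> 0 < nu ->
  converges_on_unit a -> converges_on_unit (averaged mu nu a).
Proof.
  intros Hmu Hnu. apply converges_on_unit_le with 1. intros n. rewrite Rmult_1_l.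
  now apply Rabs_averaged_le.
Qed.

(** For [μ >= 1] the factor [(n + 1) / (1 + μ n)] is the convex combination
    [1 / μ + (1 - 1 / μ) / (1 + μ n)]. *)
Lemma averaged_ge_0 mu nu a : 1 <= mu -> 0 < nu -> converges_on_unit a ->
  (forall s, 0 < s < 1 -> 0 <= PSeries a s) ->
  forall s, 0 < s < 1 -> 0 <= PSeries (averaged mu nu a) s.
Proof.
  intros Hmu Hnu Ha Hpos s Hs.
  set (b := fun n => a n / (1 + nu * INR n)).
  assert (Pn : forall k n, 0 < k -> 1 <= 1 + k * INR n).
  { intros k n Hk. assert (P := pos_INR n). assert (0 <= k * INR n) by (apply Rmult_le_pos; lra). lra. }
  assert (Div : forall k c, 0 < k -> converges_on_unit c -> converges_on_unit (fun n => c n / (1 + k * INR n))).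
  { intros k c Hk. apply converges_on_unit_le with 1. intros n. assert (P := Pn k n Hk).
    unfold Rdiv. rewrite Rabs_mult, Rmult_comm. apply Rmult_le_compat_r; [apply Rabs_pos|].
    rewrite Rabs_pos_eq by (left; apply Rinv_0_lt_compat; lra).
    rewrite <- Rinv_1. apply Rinv_le_contravar; lra. }
  assert (Hb : converges_on_unit b) by (now apply Div).
  assert (Pb := averaging a nu Hnu Ha Hpos). fold b in Pb.
  assert (Pc := averaging b mu ltac:(lra) Hb Pb s Hs).
  specialize (Pb s Hs).
  assert (As : Rabs s < 1) by (rewrite Rabs_pos_eq; lra).
  assert (E : PSeries (averaged mu nu a) s = / mu * PSeries b s
      + (1 - / mu) * PSeries (fun n => b n / (1 + mu * INR n)) s).
  { unfold PSeries. rewrite <- !Series_scal_l, <- Series_plus.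
    - apply Series_ext. intros n. unfold averaged, b. assert (X := Pn mu n ltac:(lra)). assert (Y := Pn nu n Hnu).
      field. repeat split; lra.
    - apply ex_series_mult_l. now apply converges_on_unit_ex.
    - apply ex_series_mult_l. apply (converges_on_unit_ex (fun n => b n / (1 + mu * INR n))); [|exact As].
      apply Div; [lra | exact Hb]. }
  rewrite E. apply Rplus_le_le_0_compat; apply Rmult_le_pos; try assumption.
  - left. apply Rinv_0_lt_compat. lra.
  - assert (/ mu <= 1); [|lra]. rewrite <- Rinv_1. apply Rinv_le_contravar; lra.
Qed.

(** The coefficients of [1 / (1 + t)^2]. *)
Definition alt (n : nat) : R := (-1) ^ n * (INR n + 1).

Lemma Rabs_alt n : Rabs (alt n) = INR n + 1.
Proof.
  unfold alt. rewrite Rabs_mult, pow_1_abs, Rabs_pos_eq; [ring|]. assert (P := pos_INR n). lra.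
Qed.

Lemma converges_alt : converges_on_unit alt.
Proof. apply converges_on_unit_bound with 1. intros n. rewrite Rabs_alt. lra. Qed.

Lemma PSeries_alt t : 0 <= t < 1 -> PSeries alt t = / (1 + t) ^ 2.
Proof.
  intros Ht.
  assert (A := CPSeries_geom_derive (RtoC (- t))).
  rewrite Cmod_R, Rabs_Ropp, Rabs_pos_eq in A by lra. specialize (A ltac:(lra)).
  replace (1 - (- t)%R)%C with (RtoC (1 + t)) in A by (rewrite RtoC_plus, RtoC_opp; ring).
  rewrite <- RtoC_mult, <- RtoC_inv in A by nra.
  replace ((1 + t) ^ 2) with ((1 + t) * (1 + t)) by ring.
  transitivity (Re (RtoC (/ ((1 + t) * (1 + t))))); [|reflexivity].
  rewrite <- A. unfold CPSeries, CSeries. cbn [Re fst]. apply Series_ext. intros n.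
  rewrite <- RtoC_plus, <- RtoC_pow, <- RtoC_mult. change (alt n * t ^ n = (INR n + 1) * (- t) ^ n). unfold alt.
  replace (- t) with ((-1) * t) by ring. rewrite Rpow_mult_distr. ring.
Qed.

Lemma PSeries_dilate a rho t : PSeries (fun n => a n * rho ^ n) t = PSeries a (rho * t).
Proof.
  unfold PSeries. apply Series_ext. intros n. rewrite Rpow_mult_distr. ring.
Qed.

Lemma converges_dilate a rho : 0 <= rho <= 1 -> converges_on_unit a ->
  converges_on_unit (fun n => a n * rho ^ n).
Proof.
  intros Hr. apply converges_on_unit_le with 1. intros n.
  rewrite Rabs_mult, (Rabs_pos_eq (rho ^ n)) by (apply pow_le; lra).
  rewrite Rmult_comm. apply Rmult_le_compat_r; [apply Rabs_pos|].
  rewrite <- (pow1 n). apply pow_incr. lra.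
Qed.

(** The series [∑ (-1)^n (n + 1)^2 t^n / ((1 + μ n) (1 + ν n))]. *)
Definition q0 (mu nu t : R) : R := PSeries (averaged mu nu alt) t.

Lemma PSeries_minus_unit a b t : converges_on_unit a -> converges_on_unit b -> Rabs t < 1 ->
  PSeries (fun n => a n - b n) t = PSeries a t - PSeries b t.
Proof.
  intros Ha Hb Ht. unfold PSeries.
  rewrite <- Series_minus by (now apply converges_on_unit_ex).
  apply Series_ext. intros n. ring.
Qed.

Lemma converges_minus a b : converges_on_unit a -> converges_on_unit b ->
  converges_on_unit (fun n => a n - b n).
Proof.
  intros Ha Hb s Hs. apply ex_series_le_R with (fun n => Rabs (a n) * s ^ n + Rabs (b n) * s ^ n).
  - intros n. assert (P := pow_le s n (proj1 Hs)).
    rewrite Rabs_pos_eq by (apply Rmult_le_pos; [apply Rabs_pos | exact P]).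
    rewrite <- Rmult_plus_distr_r. apply Rmult_le_compat_r; [exact P|].
    unfold Rminus. rewrite <- (Rabs_Ropp (b n)). apply Rabs_triang.
  - exact (ex_series_plus _ _ (Ha s Hs) (Hb s Hs)).
Qed.

(** [q0] is an average of the decreasing functions [1 / (1 + r t)^2]. *)
Lemma q0_antitone mu nu rho t : 1 <= mu -> 0 < nu -> 0 < rho < 1 -> 0 < t < 1 ->
  q0 mu nu t <= q0 mu nu (rho * t).
Proof.
  intros Hmu Hnu Hr Ht.
  assert (As : Rabs t < 1) by (rewrite Rabs_pos_eq; lra).
  assert (Cd := converges_dilate alt rho ltac:(lra) converges_alt).
  assert (A := averaged_ge_0 mu nu (fun n => alt n * rho ^ n - alt n) Hmu Hnu
    (converges_minus _ _ Cd converges_alt)).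
  assert (B : 0 <= PSeries (averaged mu nu (fun n => alt n * rho ^ n - alt n)) t).
  { apply A; [|exact Ht]. intros s Hs.
    rewrite PSeries_minus_unit; [|exact Cd | apply converges_alt | rewrite Rabs_pos_eq; lra].
    assert (Hrs : 0 < rho * s <= s) by (split; [apply Rmult_lt_0_compat; lra | nra]).
    rewrite PSeries_dilate, !PSeries_alt by lra.
    assert (/ (1 + s) ^ 2 <= / (1 + rho * s) ^ 2); [|lra].
    apply Rinv_le_contravar; [apply pow_lt; lra | apply pow_incr; lra]. }
  unfold q0. rewrite <- PSeries_dilate.
  assert (Ca := converges_averaged mu nu alt Hmu Hnu converges_alt).
  assert (E := PSeries_minus_unit _ _ t (converges_dilate _ rho ltac:(lra) Ca) Ca As).
  cbv beta in E.
  replace (PSeries (fun n => averaged mu nu alt n * rho ^ n - averaged mu nu alt n) t)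
    with (PSeries (averaged mu nu (fun n => alt n * rho ^ n - alt n)) t) in E; [lra|].
  apply PSeries_ext. intros n. unfold averaged. ring.
Qed.

Lemma q0_bounds mu nu t : 1 <= mu -> 0 < nu -> 0 < t < 1 -> 0 <= q0 mu nu t <= 1.
Proof.
  intros Hmu Hnu Ht. assert (As : Rabs t < 1) by (rewrite Rabs_pos_eq; lra).
  split.
  - apply averaged_ge_0; auto using converges_alt. intros s Hs. rewrite PSeries_alt by lra.
    left. apply Rinv_0_lt_compat, pow_lt. lra.
  - set (one := fun n : nat => match n with O => 1 | _ => 0 end).
    assert (C1 : converges_on_unit one).
    { apply converges_on_unit_bound with 1. intros n. assert (P := pos_INR n).
      unfold one. destruct n; [rewrite Rabs_R1 | rewrite Rabs_R0]; lra. }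
    assert (E1 : forall s, PSeries one s = 1).
    { intros s. assert (X := CSeries_single 1). apply (f_equal Re) in X. simpl in X. rewrite <- X.
      unfold PSeries. apply Series_ext. intros [|n]; cbn [one Re RtoC fst]; unfold one; simpl; ring. }
    assert (A := averaged_ge_0 mu nu _ Hmu Hnu (converges_minus _ _ C1 converges_alt)).
    assert (B : 0 <= PSeries (averaged mu nu (fun n => one n - alt n)) t).
    { apply A; [|exact Ht]. intros s Hs.
      rewrite PSeries_minus_unit, E1, PSeries_alt; try lra; auto using converges_alt; [|rewrite Rabs_pos_eq; lra].
      assert (/ (1 + s) ^ 2 <= / 1); [|lra]. apply Rinv_le_contravar; nra. }
    assert (E := PSeries_minus_unit _ _ t C1 (converges_averaged mu nu alt Hmu Hnu converges_alt) As).
    cbv beta in E.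
    rewrite E1 in E. unfold q0.
    replace (PSeries (fun n => one n - averaged mu nu alt n) t)
      with (PSeries (averaged mu nu (fun n => one n - alt n)) t) in E; [lra|].
    apply PSeries_ext. intros [|n]; unfold averaged, one; [simpl; field | ring].
Qed.

Lemma q0_continuous mu nu t : 1 <= mu -> 0 < nu -> Rabs t < 1 -> continuous (q0 mu nu) t.
Proof.
  intros Hmu Hnu Ht. apply continuous_of_ex_derive. apply ex_derive_PSeries.
  apply converges_on_unit_radius; [|exact Ht]. apply converges_averaged; auto using converges_alt.
Qed.

Section KernelBound.

Variables lam dlam : R -> R.
Hypothesis lam_pos : forall t, 0 < t < 1 -> 0 < lam t.
Hypothesis lam_der : forall t, 0 < t < 1 -> is_derive lam t (dlam t).
Hypothesis dlam_le : forall t, 0 < t < 1 -> dlam t <= - (lam t / (1 - t)).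
Hypothesis lam_int : is_int01 lam 1.
Variables mu nu : R.
Hypothesis Hmu : 1 <= mu.
Hypothesis Hnu : 0 < nu.

Let lam_cont := weight_cont lam dlam lam_der.

Variables (x zeta : C).
Hypothesis Hx : Cmod x <= 1.
Hypothesis Hzeta : Cmod zeta = 1.

Let delta (n : nat) : R := Re (test_coef x n * zeta ^ n)%C - alt n.

Lemma delta_bound n : Rabs (delta n) <= 2 * (INR n + 1).
Proof.
  unfold delta. unfold Rminus. eapply Rle_trans; [apply Rabs_triang|].
  rewrite Rabs_Ropp, Rabs_alt.
  assert (A := re_le_Cmod (test_coef x n * zeta ^ n)).
  rewrite Cmod_mult, Cmod_pow, Hzeta, pow1, Rmult_1_r in A.
  assert (B := test_coef_bound x n Hx). lra.
Qed.

Lemma converges_delta : converges_on_unit delta.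
Proof. apply converges_on_unit_bound with 2. exact delta_bound. Qed.

Lemma ex_series_test t : 0 <= t < 1 -> ex_series (fun n => Re (test_coef x n * zeta ^ n)%C * t ^ n).
Proof.
  intros Ht. apply (converges_on_unit_ex (fun n => Re (test_coef x n * zeta ^ n)%C)); [|rewrite Rabs_pos_eq; lra].
  apply converges_on_unit_bound with 1. intros n.
  eapply Rle_trans; [apply re_le_Cmod|].
  rewrite Cmod_mult, Cmod_pow, Hzeta, pow1, Rmult_1_r, Rmult_1_l. now apply test_coef_bound.
Qed.

Lemma PSeries_delta t : 0 <= t < 1 ->
  PSeries delta t = Re (CPSeries (test_coef x) (t * zeta)%C) - / (1 + t) ^ 2.
Proof.
  intros Ht. rewrite <- PSeries_alt by exact Ht. unfold PSeries, CPSeries, CSeries. cbn [Re fst].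
  rewrite <- Series_minus.
  - apply Series_ext. intros n. unfold delta. rewrite Cpow_mult_l, <- RtoC_pow.
    replace (test_coef x n * (RtoC (t ^ n) * zeta ^ n))%C with (RtoC (t ^ n) * (test_coef x n * zeta ^ n))%C by ring.
    rewrite re_scal_l. ring.
  - assert (A := ex_series_test t Ht). revert A. apply ex_series_ext. intros n.
    rewrite Cpow_mult_l, <- RtoC_pow.
    replace (test_coef x n * (RtoC (t ^ n) * zeta ^ n))%C with (RtoC (t ^ n) * (test_coef x n * zeta ^ n))%C by ring.
    rewrite re_scal_l. R_ring.
  - apply converges_on_unit_ex; [apply converges_alt | rewrite Rabs_pos_eq; lra].
Qed.

Lemma weighted_delta_ge_0 rho : 0 < rho < 1 -> 0 <= PSeries (fun n => delta n * moment lam n) rho.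
Proof.
  intros Hr. set (c := Re zeta).
  assert (Hcs : c ^ 2 + Im zeta ^ 2 = 1) by (unfold c; rewrite <- Cmod2_alt, Hzeta; ring).
  assert (Hc : -1 <= c <= 1) by nra.
  apply (weighted_integral_ge_0 lam dlam lam_pos lam_der dlam_le lam_int
    (PSeries delta) (minorant c) (minorant' c) rho); auto.
  - intros u Hu. apply is_derive_minorant; lra.
  - intros u Hu. apply minorant_bounds; lra.
  - intros u Hu. eapply Rle_trans; [apply minorant'_le; lra|].
    apply Rmult_le_compat_l; [lra|]. rewrite PSeries_delta by lra.
    apply Rplus_le_compat_r.
    replace zeta with (c, Im zeta) by (now destruct zeta).
    apply Re_test_ge; auto; lra.
  - intros u Hu. apply continuous_of_ex_derive. apply ex_derive_PSeries.
    apply converges_on_unit_radius; [apply converges_delta | rewrite Rabs_pos_eq; lra].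
  - assert (A := is_RInt_gen_power_series lam lam_pos lam_cont lam_int (fun n => delta n * rho ^ n)).
    replace (PSeries (fun n => delta n * moment lam n) rho)
      with (Series (fun n => delta n * rho ^ n * moment lam n))
      by (unfold PSeries; apply Series_ext; intros n; ring).
    apply is_RInt_gen_ext_01 with (fun t => lam t * PSeries (fun n => delta n * rho ^ n) t).
    + intros t Ht. now rewrite PSeries_dilate.
    + apply A. assert (B := converges_delta rho ltac:(lra)). revert B. apply ex_series_ext. intros n.
      now rewrite Rabs_mult, (Rabs_pos_eq (rho ^ n)) by (apply pow_le; lra).
Qed.

Definition kernel_coef (y : C) (n : nat) : C :=
  (RtoC (averaged mu nu (moment lam) n) * test_coef y n)%C.

Lemma is_RInt_gen_q0 : is_int01 (fun t => lam t * q0 mu nu t)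
  (int01 (fun t => lam t * q0 mu nu t)).
Proof.
  apply (is_RInt_gen_dominated lam lam_pos lam_cont lam_int) with 1.
  - intros t Ht. apply (continuous_mult (K := R_AbsRing) lam); [now apply lam_cont|].
    apply q0_continuous; auto. rewrite Rabs_pos_eq; lra.
  - intros t Ht. assert (P := lam_pos t Ht). assert (B := q0_bounds mu nu t Hmu Hnu Ht).
    rewrite Rabs_pos_eq; nra.
Qed.

Lemma kernel_lower_bound rho : 0 < rho < 1 ->
  int01 (fun t => lam t * q0 mu nu t) <= Re (CPSeries (kernel_coef x) (rho * zeta)%C).
Proof.
  intros Hr.
  assert (As : Rabs rho < 1) by (rewrite Rabs_pos_eq; lra).
  assert (MB := moment_bounds lam lam_pos lam_cont lam_int).
  assert (Cm : forall a, converges_on_unit a -> converges_on_unit (fun n => a n * moment lam n)).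
  { intros a. apply converges_on_unit_le with 1. intros n. assert (B := MB n).
    rewrite Rabs_mult, (Rabs_pos_eq (moment lam n)), Rmult_comm by lra.
    apply Rmult_le_compat_r; [apply Rabs_pos | lra]. }
  assert (Pos := averaged_ge_0 mu nu _ Hmu Hnu (Cm _ converges_delta) weighted_delta_ge_0 rho Hr).
  (* dilating by rho < 1 can only increase q0 *)
  assert (Low : int01 (fun t => lam t * q0 mu nu t)
     <= PSeries (averaged mu nu (fun n => alt n * moment lam n)) rho).
  { assert (A := is_RInt_gen_power_series lam lam_pos lam_cont lam_int (fun n => averaged mu nu alt n * rho ^ n)).
    lapply A; clear A; [intros A|].
    2:{ assert (B := converges_averaged mu nu alt Hmu Hnu converges_alt rho ltac:(lra)). revert B.
        apply ex_series_ext. intros n. now rewrite Rabs_mult, (Rabs_pos_eq (rho ^ n)) by (apply pow_le; lra). }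
    assert (D := is_RInt_gen_lincomb _ _ 1 (-1) _ _ A is_RInt_gen_q0).
    apply is_RInt_gen_ge_0_pointwise in D.
    - replace (PSeries (averaged mu nu (fun n => alt n * moment lam n)) rho)
        with (Series (fun n => averaged mu nu alt n * rho ^ n * moment lam n)); [lra|].
      unfold PSeries. apply Series_ext. intros n. unfold averaged. ring.
    - intros t Ht. rewrite PSeries_dilate. fold (q0 mu nu (rho * t)).
      assert (X := q0_antitone mu nu rho t Hmu Hnu Hr Ht). assert (P := lam_pos t Ht). nra. }
  replace (Re (CPSeries (kernel_coef x) (rho * zeta)%C))
    with (PSeries (averaged mu nu (fun n => delta n * moment lam n)) rho
       + PSeries (averaged mu nu (fun n => alt n * moment lam n)) rho); [lra|].
  unfold PSeries. rewrite <- Series_plus.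
  - unfold CPSeries, CSeries. cbn [Re fst]. apply Series_ext. intros n.
    unfold kernel_coef. rewrite Cpow_mult_l, <- RtoC_pow.
    replace (averaged mu nu (moment lam) n * test_coef x n * (RtoC (rho ^ n) * zeta ^ n))%C
      with (RtoC (averaged mu nu (moment lam) n * rho ^ n) * (test_coef x n * zeta ^ n))%C
      by (rewrite RtoC_mult; ring).
    rewrite re_scal_l. unfold averaged, delta. ring.
  - apply converges_on_unit_ex; [|exact As]. apply converges_averaged; auto. apply Cm, converges_delta.
  - apply converges_on_unit_ex; [|exact As]. apply converges_averaged; auto. apply Cm, converges_alt.
Qed.

End KernelBound.

(** * The solution of the differential equation *)

Lemma Rpower_minus_1 s kappa : 0 < s -> Rpower s (kappa - 1) = Rpower s kappa / s.
Proof. intros Hs. unfold Rminus. now rewrite Rpower_plus, Rpower_Ropp, Rpower_1. Qed.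

Lemma Rpower_small kappa eps : 0 < kappa -> 0 < eps -> exists d, 0 < d /\
  forall s, 0 < s < d -> Rpower s kappa < eps.
Proof.
  intros Hk He. exists (Rpower eps (/ kappa)). split; [apply exp_pos|].
  intros s Hs. replace eps with (Rpower (Rpower eps (/ kappa)) kappa) at 1.
  - apply Rlt_Rpower_l; [exact Hk | exact Hs].
  - rewrite Rpower_mult, Rinv_l by lra. now apply Rpower_1.
Qed.

(** Both sides are the derivative of [u / (1 + u)^2], whose series is [u] times that
    of [alt]. *)
Lemma PSeries_alt_square u : 0 < u < 1 ->
  PSeries (fun n => alt n * (INR n + 1)) u = (1 - u) / (1 + u) ^ 3.
Proof.
  intros Hu. assert (Hu' : Rabs u < 1) by (rewrite Rabs_pos_eq; lra).
  rewrite (PSeries_ext _ (fun n => (1 + INR n) * alt n)) by (intros n; ring).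
  rewrite PSeries_Euler by auto using converges_alt.
  assert (D1 := is_derive_PSeries alt u (converges_on_unit_radius alt u converges_alt Hu')).
  assert (D2 : is_derive (PSeries alt) u (- 2 / (1 + u) ^ 3)).
  { apply is_derive_ext_loc with (f := fun t => / (1 + t) ^ 2).
    - assert (Hd : 0 < Rmin u (1 - u)) by (apply Rmin_glb_lt; lra).
      assert (E1 := Rmin_l u (1 - u)). assert (E2 := Rmin_r u (1 - u)).
      exists (mkposreal _ Hd). intros t Ht.
      apply ball_R_elim in Ht; simpl in Ht.
      apply Rabs_def2 in Ht. symmetry. apply PSeries_alt. lra.
    - auto_derive; [nra|]. field. lra. }
  replace (PSeries (PS_derive alt) u) with (- 2 / (1 + u) ^ 3).
  - rewrite PSeries_alt by lra. field. lra.
  - apply is_derive_unique in D1. apply is_derive_unique in D2. congruence.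
Qed.

Lemma int01_kernel mu t : 1 <= mu -> 0 < t < 1 ->
  int01 (fun s => Rpower s (1 / mu - 1) * ((1 - s * t) / (1 + s * t) ^ 3))
  = PSeries (fun n => alt n * (INR n + 1) / (INR n + / mu)) t.
Proof.
  intros Hmu Ht. set (b := / mu).
  assert (Hb : 0 < b) by (apply Rinv_0_lt_compat; lra).
  set (e := fun n => alt n * (INR n + 1) / (INR n + b)).
  assert (Pn : forall n, 0 < INR n + b) by (intros n; assert (P := pos_INR n); lra).
  assert (He : converges_on_unit e).
  { apply converges_on_unit_bound with mu. intros n. assert (Q := Pn n). assert (P := pos_INR n).
    unfold e, Rdiv. rewrite !Rabs_mult, Rabs_alt, (Rabs_pos_eq (INR n + 1)) by lra.
    rewrite Rabs_pos_eq by (left; now apply Rinv_0_lt_compat).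
    assert ((INR n + 1) * / (INR n + b) <= mu).
    { apply Rmult_le_reg_r with (INR n + b); [exact Q|]. rewrite Rmult_assoc, Rinv_l, Rmult_1_r by lra.
      assert (mu * b = 1) by (unfold b; field; lra). nra. }
    replace ((INR n + 1) * (INR n + 1) * / (INR n + b)) with ((INR n + 1) * / (INR n + b) * (INR n + 1)) by ring.
    apply Rmult_le_compat_r; lra. }
  set (F := fun u => Rpower u b * PSeries e u).
  assert (DF : forall u, 0 < u < 1 -> is_derive F u (Rpower u b / u * ((1 - u) / (1 + u) ^ 3))).
  { intros u Hu. rewrite <- PSeries_alt_square by exact Hu.
    replace (PSeries (fun n => alt n * (INR n + 1)) u) with (PSeries (fun n => (b + INR n) * e n) u).
    - now apply is_derive_Rpower_PSeries.
    - apply PSeries_ext. intros n. unfold e. assert (Q := Pn n). field. lra. }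
  (* an antiderivative of the integrand in s, by the substitution u = s t *)
  set (W := fun s => / Rpower t b * F (s * t)).
  assert (Pt : 0 < Rpower t b) by apply exp_pos.
  assert (St : forall s, 0 < s -> s * t < 1 -> 0 < s * t < 1).
  { intros s Hs H1. split; [now apply Rmult_lt_0_compat | exact H1]. }
  assert (DW : forall s, 0 < s -> s * t < 1 -> is_derive W s (Rpower s (1 / mu - 1) * ((1 - s * t) / (1 + s * t) ^ 3))).
  { intros s Hs H1. assert (Q := St s Hs H1). unfold W.
    assert (D := is_derive_comp (V := R_NormedModule) F (fun s => s * t) s _ t (DF _ Q)
      ltac:(auto_derive; [trivial | ring])).
    assert (D' := is_derive_scal _ s (/ Rpower t b) _ D).
    replace (Rpower s (1 / mu - 1) * ((1 - s * t) / (1 + s * t) ^ 3))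
      with (/ Rpower t b * scal t (Rpower (s * t) b / (s * t) * ((1 - s * t) / (1 + s * t) ^ 3))); [exact D'|].
    unfold scal; simpl; unfold mult; simpl.
    rewrite <- Rpower_mult_distr by lra. rewrite Rpower_minus_1 by exact Hs.
    replace (1 / mu) with b by (unfold b; field; lra). field. repeat split; lra. }
  apply int01_unique. apply is_RInt_gen_01. intros eps Heps.
  assert (W1 : W 1 = PSeries e t).
  { unfold W, F. rewrite Rmult_1_l. field. lra. }
  assert (C1 : continuous W 1).
  { apply continuous_of_ex_derive. eexists. apply DW; lra. }
  destruct (proj1 (filterlim_locally _ _) C1 (mkposreal (eps / 2) ltac:(lra))) as [d1 Hd1].
  (* W tends to 0 at 0 owing to its factor s^(1/mu) *)
  assert (CE : continuous (PSeries e) 0).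
  { apply continuous_of_ex_derive. apply ex_derive_PSeries.
    apply converges_on_unit_radius; [exact He | rewrite Rabs_R0; lra]. }
  destruct (proj1 (filterlim_locally _ _) CE (mkposreal 1 Rlt_0_1)) as [d2 Hd2].
  set (M := Rabs (PSeries e 0) + 1). assert (PM : 0 < M) by (assert (A := Rabs_pos (PSeries e 0)); unfold M; lra).
  destruct (Rpower_small b (eps / (2 * M)) Hb ltac:(apply Rdiv_lt_0_compat; lra)) as [d3 [Pd3 Hd3]].
  assert (P1 := cond_pos d1). assert (P2 := cond_pos d2).
  exists (Rmin (Rmin d1 d2) (Rmin d3 (/ 2))).
  assert (B1 := Rmin_l (Rmin d1 d2) (Rmin d3 (/ 2))). assert (B2 := Rmin_r (Rmin d1 d2) (Rmin d3 (/ 2))).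
  assert (B3 := Rmin_l d1 d2). assert (B4 := Rmin_r d1 d2).
  assert (B5 := Rmin_l d3 (/ 2)). assert (B6 := Rmin_r d3 (/ 2)).
  split; [repeat apply Rmin_glb_lt; lra|].
  intros a c Ha Hc. exists (W c - W a). split.
  - apply (is_RInt_derive (V := R_CompleteNormedModule) W).
    + intros s. rewrite Rmin_left, Rmax_right by lra. intros Hs. apply DW; nra.
    + intros s. rewrite Rmin_left, Rmax_right by lra. intros Hs.
      apply continuous_of_ex_derive. unfold Rpower. auto_derive. split; [lra|]. 
      split; [|trivial]. assert (0 < s * t) by (apply Rmult_lt_0_compat; lra).
      repeat apply Rmult_integral_contrapositive_currified; lra.
  - assert (A1 : Rabs (W c - W 1) < eps / 2).
    { apply Hd1. apply ball_R_intro; simpl. apply Rabs_def1; lra. }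
    assert (A2 : Rabs (W a) < eps / 2).
    { assert (Qa : 0 < a * t < a) by (split; [apply Rmult_lt_0_compat; lra | nra]).
      unfold W, F. rewrite <- Rpower_mult_distr by lra.
      replace (/ Rpower t b * (Rpower a b * Rpower t b * PSeries e (a * t))) with (Rpower a b * PSeries e (a * t)) by (field; lra).
      assert (X : Rabs (PSeries e (a * t) - PSeries e 0) < 1).
      { apply Hd2. apply ball_R_intro; simpl.
        rewrite Rminus_0_r, Rabs_pos_eq; lra. }
      assert (Y : Rabs (PSeries e (a * t)) <= M).
      { unfold M. replace (PSeries e (a * t)) with (PSeries e 0 + (PSeries e (a * t) - PSeries e 0)) by ring.
        eapply Rle_trans; [apply Rabs_triang|]. lra. }
      assert (Z := Hd3 a ltac:(lra)). assert (Pa : 0 < Rpower a b) by apply exp_pos.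
      rewrite Rabs_mult, (Rabs_pos_eq (Rpower a b)) by lra.
      apply Rle_lt_trans with (Rpower a b * M); [apply Rmult_le_compat_l; lra|].
      apply Rlt_le_trans with (eps / (2 * M) * M); [now apply Rmult_lt_compat_r | right; field; lra]. }
    rewrite <- W1. replace (W c - W a - W 1) with ((W c - W 1) + - W a) by ring.
    eapply Rle_lt_trans; [apply Rabs_triang|]. rewrite Rabs_Ropp. lra.
Qed.

Lemma constant_of_derive (F : R -> R) a b : a <= b ->
  (forall t, a <= t <= b -> is_derive F t 0) -> F a = F b.
Proof.
  intros Hab H. apply Rle_antisym.
  - apply (nondecreasing_of_derive F (fun _ => 0)); auto. intros; lra.
  - assert (A : - F a <= - F b); [|lra].
    apply (nondecreasing_of_derive (fun t => - F t) (fun _ => 0)); [exact Hab | | intros; lra].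
    intros t Ht. rewrite <- Ropp_0. apply (is_derive_opp (V := R_NormedModule) F). now apply H.
Qed.

(** Two solutions differ by a multiple of [t^(-1/ν)], and only the zero multiple
    is compatible with a common limit at [0]. *)
Theorem is_q_unique mu nu q : 1 <= mu -> 0 < nu -> is_q mu nu q ->
  forall t, 0 < t < 1 -> q t = q0 mu nu t.
Proof.
  intros Hmu Hnu [Hq0 [Hlim Hder]] t Ht.
  assert (Ca := converges_averaged mu nu alt Hmu Hnu converges_alt).
  set (k := 1 / nu). assert (Hk : 0 < k) by (apply Rdiv_lt_0_compat; lra).
  assert (D0 : forall t, 0 < t < 1 -> is_derive (fun t => Rpower t k * q0 mu nu t) t
      (1 / (mu * nu) * Rpower t (k - 1) *
       int01 (fun s => Rpower s (1 / mu - 1) * ((1 - s * t) / (1 + s * t) ^ 3)))).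
  { intros s Hs. rewrite int01_kernel by assumption.
    assert (D := is_derive_Rpower_PSeries _ k s Ca Hs).
    replace (1 / (mu * nu) * Rpower s (k - 1) * PSeries (fun n => alt n * (INR n + 1) / (INR n + / mu)) s)
      with (Rpower s k / s * PSeries (fun n => (k + INR n) * averaged mu nu alt n) s); [exact D|].
    rewrite Rpower_minus_1 by lra.
    replace (PSeries (fun n => (k + INR n) * averaged mu nu alt n) s)
      with (1 / (mu * nu) * PSeries (fun n => alt n * (INR n + 1) / (INR n + / mu)) s); [unfold Rdiv; ring|].
    unfold PSeries. rewrite <- Series_scal_l. apply Series_ext. intros n.
    assert (P := pos_INR n). assert (0 <= nu * INR n) by (apply Rmult_le_pos; lra).
    assert (0 <= mu * INR n) by (apply Rmult_le_pos; lra).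
    unfold averaged, k. field. repeat split; lra. }
  set (F := fun t => Rpower t k * q t - Rpower t k * q0 mu nu t).
  assert (DF : forall t, 0 < t < 1 -> is_derive F t 0).
  { intros s Hs.
    assert (A := is_derive_minus (V := R_NormedModule) _ _ s _ _ (Hder s Hs) (D0 s Hs)).
    fold k in A. rewrite minus_eq_zero in A. exact A. }
  assert (EF : F t = 0).
  {
    assert (Z : Rabs (F t) <= 0); [|assert (A := Rabs_pos (F t)); destruct (Req_dec (F t) 0) as [|N]; [assumption | apply Rabs_pos_lt in N; lra]].
    apply le_epsilon. intros eps He. rewrite Rplus_0_l.
    destruct (Hlim (fun y => Rabs (y - q 0) < eps / 2)) as [d1 Hd1].
    { exists (mkposreal (eps / 2) ltac:(lra)). intros y Hy. exact Hy. }
    assert (C0 : continuous (q0 mu nu) 0) by (apply q0_continuous; auto; rewrite Rabs_R0; lra).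
    destruct (C0 (fun y => Rabs (y - q0 mu nu 0) < eps / 2)) as [d2 Hd2].
    { exists (mkposreal (eps / 2) ltac:(lra)). intros y Hy. exact Hy. }
    assert (P1 := cond_pos d1). assert (P2 := cond_pos d2).
    set (s := Rmin (Rmin d1 d2) t / 2).
    assert (B1 := Rmin_l (Rmin d1 d2) t). assert (B2 := Rmin_r (Rmin d1 d2) t).
    assert (B3 := Rmin_l d1 d2). assert (B4 := Rmin_r d1 d2).
    assert (B5 : 0 < Rmin (Rmin d1 d2) t) by (repeat apply Rmin_glb_lt; lra).
    assert (Hs : 0 < s < t /\ s < d1 /\ s < d2) by (unfold s; lra).
    assert (A1 : Rabs (q s - q 0) < eps / 2).
    { apply (Hd1 s); [|lra]. apply ball_R_intro; simpl.
      rewrite Rminus_0_r, Rabs_pos_eq; lra. }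
    assert (A2 : Rabs (q0 mu nu s - q0 mu nu 0) < eps / 2).
    { apply (Hd2 s). apply ball_R_intro; simpl.
      rewrite Rminus_0_r, Rabs_pos_eq; lra. }
    assert (Q0 : q0 mu nu 0 = 1).
    { unfold q0. rewrite PSeries_0. unfold averaged, alt. simpl. field. }
    rewrite Hq0 in A1. rewrite Q0 in A2.
    rewrite <- (constant_of_derive F s t ltac:(lra)) by (intros u Hu; apply DF; lra).
    unfold F. replace (Rpower s k * q s - Rpower s k * q0 mu nu s) with (Rpower s k * ((q s - 1) + - (q0 mu nu s - 1))) by ring.
    assert (Ps : 0 < Rpower s k <= 1).
    { split; [apply exp_pos|]. replace 1 with (Rpower 1 k) by (unfold Rpower; rewrite ln_1, Rmult_0_r; apply exp_0).
      apply Rle_Rpower_l; lra. }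
    rewrite Rabs_mult, (Rabs_pos_eq (Rpower s k)) by lra.
    assert (T := Rabs_triang (q s - 1) (- (q0 mu nu s - 1))). rewrite Rabs_Ropp in T.
    assert (T0 := Rabs_pos (q s - 1 + - (q0 mu nu s - 1))).
    apply Rle_trans with (1 * Rabs (q s - 1 + - (q0 mu nu s - 1))); [apply Rmult_le_compat_r; lra | lra]. }
  assert (Pt : 0 < Rpower t k) by apply exp_pos.
  apply Rmult_eq_reg_l with (Rpower t k); [|lra]. unfold F in EF. lra.
Qed.

(** * The operators on Taylor series *)

Lemma is_C_derive_ext_disk (f g : C -> C) r z l :
  (forall w, Cmod w < r -> f w = g w) -> Cmod z < r ->
  is_derive_CC g z l ->
  is_derive_CC f z l.
Proof.
  intros H Hz. apply is_derive_ext_loc.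
  exists (mkposreal (r - Cmod z) ltac:(lra)). intros w Hw.
  change (Cmod (w - z) < r - Cmod z) in Hw. symmetry. apply H.
  replace w with ((w - z) + z)%C by ring. eapply Rle_lt_trans; [apply Cmod_triangle | lra].
Qed.

(** Termwise the operator multiplies [a_(n+1)] by [1 + (α - γ) n + γ n^2], which
    factors because [μ + ν = α - γ] and [μ ν = γ]. *)
Lemma W_operator_series (f : C -> C) r c alpha gamma mu nu z :
  0 < r -> converges_in r c -> (forall w, Cmod w < r -> f w = CPSeries c w) -> c 0%nat = 0 ->
  mu + nu = alpha - gamma -> mu * nu = gamma -> Cmod z < r ->
  (RtoC (1 - alpha + 2 * gamma)%R * div_by_z f z + RtoC (alpha - 2 * gamma)%R * C_derive f z
     + RtoC gamma * z * C_derive (C_derive f) z)%C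
  = CPSeries (fun n => RtoC ((1 + mu * INR n) * (1 + nu * INR n)) * c (S n))%C z.
Proof.
  intros Hr Hc Hf Hc0 Hs Hp Hz.
  assert (D1 : forall w, Cmod w < r -> C_derive f w = CPSeries (CPS_derive c) w).
  { intros w Hw. apply is_C_derive_unique. apply is_C_derive_ext_disk with (CPSeries c) r; auto.
    now apply is_derive_CPSeries with r. }
  assert (Cd := converges_in_derive r c Hc).
  assert (D2 : C_derive (C_derive f) z = CPSeries (CPS_derive (CPS_derive c)) z).
  { apply is_C_derive_unique. apply is_C_derive_ext_disk with (CPSeries (CPS_derive c)) r; auto.
    now apply is_derive_CPSeries with r. }
  assert (Ci := converges_in_incr r c Hc).
  assert (D0 : div_by_z f z = CPSeries (fun n => c (S n)) z).
  { unfold div_by_z. destruct (Ceq_dec z 0) as [->|N].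
    - rewrite D1, !CPSeries_0 by (rewrite Cmod_0; exact Hr). unfold CPS_derive. simpl. ring.
    - rewrite Hf, (CPSeries_incr r), Hc0 by assumption. field. exact N. }
  set (c2 := fun n => (INR n * (INR (S n) * c (S n)))%C).
  assert (C2 : converges_in r c2) by (exact (converges_in_INR r _ Cd)).
  assert (E2 : (z * CPSeries (CPS_derive (CPS_derive c)) z)%C = CPSeries c2 z).
  { rewrite (CPSeries_incr r c2) by assumption. unfold c2 at 1. change (INR 0) with 0.
    rewrite Cmult_0_l, Cplus_0_l. reflexivity. }
  rewrite D0, D1, D2 by exact Hz.
  replace (gamma * z * CPSeries (CPS_derive (CPS_derive c)) z)%C
    with (gamma * CPSeries c2 z)%C by (rewrite <- E2; ring).
  rewrite <- (CPSeries_scal r _ (fun n => c (S n))), <- (CPSeries_scal r _ (CPS_derive c)), <- (CPSeries_scal r _ c2) by assumption.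
  rewrite <- (CPSeries_plus r), <- (CPSeries_plus r) by (auto using converges_in_plus, converges_in_scal).
  apply CPSeries_ext. intros n. unfold CPS_derive, c2.
  rewrite S_INR. 
  replace ((1 + mu * INR n) * (1 + nu * INR n))
    with ((1 - alpha + 2 * gamma) + (alpha - 2 * gamma) * (INR n + 1) + gamma * (INR n * (INR n + 1))).
  - rewrite !RtoC_plus, !RtoC_mult, RtoC_plus. ring.
  - replace alpha with (mu + nu + gamma) by lra. rewrite <- Hp. ring.
Qed.

Lemma lambda_derivative k A B C0 phi t : 0 < t < 1 -> ex_derive phi (1 - t) ->
  is_derive (lambda k A B C0 phi) t
    (lambda k A B C0 phi t * ((B - 1) / t - (C0 - A - B) / (1 - t))
     - k * (Rpower t (B - 1) * Rpower (1 - t) (C0 - A - B) * Derive phi (1 - t))).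
Proof.
  intros Ht Hphi. unfold lambda, weight, Rpower. auto_derive.
  - repeat split; try lra. exact Hphi.
  - change (1 + - t) with (1 - t). change (Derive (fun x : R => phi x)) with (Derive phi). field. lra.
Qed.

(** Termwise integration turns [V_λ] into multiplication of the Taylor
    coefficients by the moments of [λ]. *)
Lemma V_op_series k A B C0 phi f r c z :
  let lam := lambda k A B C0 phi in
  0 < k -> (forall t, 0 < t < 1 -> 0 < lam t) -> (forall t, 0 < t < 1 -> continuous lam t) ->
  is_int01 lam 1 ->
  converges_in r c -> (forall w, Cmod w < r -> f w = CPSeries c w) -> c 0%nat = 0 -> Cmod z < r ->
  V_op k A B C0 phi f z = (z * CPSeries (fun n => RtoC (moment lam n) * c (S n)) z)%C.
Proof.
  intros lam Hk lam_pos lam_cont lam_int Hc Hf Hc0 Hz.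
  set (a := fun n => (c (S n) * z ^ S n)%C).
  assert (Sa : abs_summable a).
  { apply (abs_summable_incr (fun n => c n * z ^ n)%C). now apply converges_in_abs with r. }
  set (l := CSeries (fun n => moment lam n * a n)%C).
  assert (Hl : is_RInt_gen (V := C_R_NormedModule)
     (fun t => RtoC (weight A B C0 phi t) * (f (RtoC t * z) / RtoC t))%C (at_right 0) (at_left 1) (RtoC (/ k) * l)%C).
  { assert (Ef : forall t, 0 < t < 1 -> (RtoC (weight A B C0 phi t) * (f (RtoC t * z) / RtoC t))%C
       = (RtoC (/ k * lam t) * CSeries (fun n => RtoC (t ^ n) * a n))%C).
    { intros t Ht. assert (Nt : RtoC t <> 0) by (intros E; apply RtoC_inj in E; lra).
      assert (Htz : Cmod (t * z) < r).
      { rewrite Cmod_mult, Cmod_R, Rabs_pos_eq by lra. assert (P := Cmod_ge_0 z). nra. }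
      replace (/ k * lam t) with (weight A B C0 phi t) by (unfold lam, lambda; field; lra).
      f_equal. rewrite Hf, (CPSeries_incr r), Hc0 by assumption.
      unfold CPSeries. rewrite <- CSeries_scal.
      2:{ apply converges_in_abs with r; [now apply converges_in_incr | exact Htz]. }
      replace ((0 + CSeries (fun n => t * z * (c (S n) * (t * z) ^ n))) / t)%C
        with (/ t * CSeries (fun n => t * z * (c (S n) * (t * z) ^ n)))%C by (field; exact Nt).
      rewrite <- CSeries_scal.
      2:{ apply abs_summable_scal. apply converges_in_abs with r; [now apply converges_in_incr | exact Htz]. }
      apply CSeries_ext. intros n. unfold a. rewrite Cpow_S, Cpow_mult_l, RtoC_pow. field. exact Nt. }
    assert (Part : forall u : nat -> R, ex_series (fun n => Rabs (u n)) ->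
      is_int01 (fun t => / k * (lam t * PSeries u t))
        (/ k * Series (fun n => u n * moment lam n))).
    { intros u Hu. apply (is_RInt_gen_scal (V := R_NormedModule) (fun t => lam t * PSeries u t)).
      now apply is_RInt_gen_power_series. }
    apply is_RInt_gen_pair.
    - rewrite re_scal_l.
      replace (Re l) with (Series (fun n => Re (a n) * moment lam n)).
      + apply is_RInt_gen_ext_01 with (2 := Part (fun n => Re (a n)) ltac:(
          apply ex_series_le_R with (2 := Sa); intros n; rewrite Rabs_Rabsolu; apply re_le_Cmod)).
        intros t Ht. rewrite Ef, re_scal_l by exact Ht. rewrite Rmult_assoc. f_equal. f_equal.
        unfold PSeries, CSeries. cbn [Re fst]. apply Series_ext. intros n. 
        change (fst (RtoC (t ^ n) * a n)%C) with (Re (RtoC (t ^ n) * a n)%C). rewrite re_scal_l.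
        apply Rmult_comm.
      + unfold l, CSeries. cbn [Re fst]. apply Series_ext. intros n.
        change (fst (RtoC (moment lam n) * a n)%C) with (Re (RtoC (moment lam n) * a n)%C).
        rewrite re_scal_l. apply Rmult_comm.
    - rewrite im_scal_l.
      replace (Im l) with (Series (fun n => Im (a n) * moment lam n)).
      + apply is_RInt_gen_ext_01 with (2 := Part (fun n => Im (a n)) ltac:(
          apply ex_series_le_R with (2 := Sa); intros n; rewrite Rabs_Rabsolu; apply im_le_Cmod)).
        intros t Ht. rewrite Ef, im_scal_l by exact Ht. rewrite Rmult_assoc. f_equal. f_equal.
        unfold PSeries, CSeries. cbn [Im snd]. apply Series_ext. intros n. 
        change (snd (RtoC (t ^ n) * a n)%C) with (Im (RtoC (t ^ n) * a n)%C). rewrite im_scal_l.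
        apply Rmult_comm.
      + unfold l, CSeries. cbn [Im snd]. apply Series_ext. intros n.
        change (snd (RtoC (moment lam n) * a n)%C) with (Im (RtoC (moment lam n) * a n)%C).
        rewrite im_scal_l. apply Rmult_comm. }
  unfold V_op, int01.
  rewrite (is_RInt_gen_unique (V := C_R_CompleteNormedModule) _ _ Hl).
  assert (Nk : RtoC k <> 0) by (intros E; apply RtoC_inj in E; lra).
  rewrite RtoC_inv by lra.
  replace (k * (/ k * l))%C with l by (field; exact Nk).
  unfold CPSeries. rewrite <- CSeries_scal.
  - unfold l. apply CSeries_ext. intros n. unfold a. rewrite Cpow_S. ring.
  - apply converges_in_abs with r; [|exact Hz].
    apply converges_in_le_mult with (2 := converges_in_incr r c Hc) (M := 1). intros n.
    assert (Bd := moment_bounds lam lam_pos lam_cont lam_int n).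
    rewrite Cmod_mult, Cmod_R, Rabs_pos_eq by lra.
    apply Rmult_le_compat_r; [apply Cmod_ge_0 | lra].
Qed.

(** * Positivity of the duality functionals *)

Lemma Re_quotient_pos (N g : C) :
  (forall x, Cmod x <= 1 -> ((1 + x) / 2 * N + (1 - x) / 2 * g)%C <> 0) -> 0 < Re (N / g)%C.
Proof.
  intros H.
  assert (Hg : g <> 0).
  { intros E. apply (H (- (1))%C); [rewrite Cmod_opp, Cmod_1; lra|]. rewrite E. field. }
  set (p := (N / g)%C).
  destruct (Rlt_or_le 0 (Re p)) as [|Hp]; [assumption|exfalso].
  assert (Np : (p - 1)%C <> 0).
  { intros E. apply Ceq_minus in E. rewrite E in Hp. change (1 <= 0) in Hp. lra. }
  (* the left half-plane is where [|p + 1| <= |p - 1|] *)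
  apply (H (- ((p + 1) / (p - 1)))%C).
  - rewrite Cmod_opp, Cmod_div by exact Np.
    assert (P := proj1 (Cmod_gt_0 _) Np).
    apply Rmult_le_reg_r with (Cmod (p - 1)); [exact P|].
    unfold Rdiv. rewrite Rmult_assoc, Rinv_l, Rmult_1_l, Rmult_1_r by lra.
    apply Rsqr_incr_0_var; [|lra]. unfold Rsqr.
    replace (Cmod (p + 1) * Cmod (p + 1)) with (Cmod (p + 1) ^ 2) by ring.
    replace (Cmod (p - 1) * Cmod (p - 1)) with (Cmod (p - 1) ^ 2) by ring.
    rewrite !Cmod2_alt. unfold Cminus. rewrite !re_plus, !im_plus, re_opp, im_opp. cbn [Re Im RtoC fst snd] in *.
    nra.
  - replace N with (p * g)%C by (unfold p; field; exact Hg). field. exact Np.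
Qed.

Lemma Re_geom_kernel sigma t : 0 < sigma < 1 ->
  / (1 + sigma) <= Re (CSeries (fun n => RtoC (sigma ^ n) * circle (- (INR n * t))))%C.
Proof.
  intros Hs. set (w := (sigma * circle (- t))%C).
  assert (Hw : Cmod w = sigma) by (apply Cmod_scaled_circle; lra).
  replace (CSeries _) with (CPSeries (fun _ => RtoC 1) w).
  - rewrite CPSeries_geom by lra.
    assert (N := Cmod_lt_1_neq w ltac:(lra)).
    set (v := (1 - w)%C) in *. assert (P := proj1 (Cmod_gt_0 v) N).
    assert (E : (Re v - 1) ^ 2 + Im v ^ 2 = sigma ^ 2).
    { rewrite <- Hw, Cmod2_alt. unfold v, Cminus. rewrite re_plus, im_plus, re_opp, im_opp. cbn [Re Im RtoC fst snd]. ring. }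
    assert (M2 : Cmod v ^ 2 = Re v ^ 2 + Im v ^ 2) by apply Cmod2_alt.
    assert (Q : 0 < Cmod v ^ 2) by (apply pow_lt; exact P).
    replace (Re (/ v)%C) with (Re v / Cmod v ^ 2) by (rewrite M2; reflexivity).
    apply Rmult_le_reg_r with ((1 + sigma) * Cmod v ^ 2); [apply Rmult_lt_0_compat; lra|].
    replace (/ (1 + sigma) * ((1 + sigma) * Cmod v ^ 2)) with (Cmod v ^ 2) by (field; lra).
    replace (Re v / Cmod v ^ 2 * ((1 + sigma) * Cmod v ^ 2)) with (Re v * (1 + sigma)) by (field; lra).
    rewrite M2. set (a := Re v) in *. assert (a <= 1 + sigma) by nra. assert (1 - sigma <= a) by nra. nra.
  - unfold CPSeries. apply CSeries_ext. intros n. unfold w.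
    rewrite Cpow_mult_l, circle_pow, <- RtoC_pow.
    replace (INR n * - t) with (- (INR n * t)) by ring. ring.
Qed.

Lemma contract r z : Cmod z < r ->
  exists (sigma : R) w, 0 < sigma < 1 /\ Cmod w < r /\ z = (sigma * w)%C.
Proof.
  intros Hz. assert (Pz := Cmod_ge_0 z).
  set (sigma := (Cmod z + r) / (2 * r)).
  assert (Hs : 0 < sigma < 1).
  { split; [apply Rdiv_lt_0_compat; lra|]. apply (Rdiv_lt_1 (Cmod z + r) (2 * r)). lra. }
  assert (Ns : RtoC sigma <> 0) by (intros E; apply RtoC_inj in E; lra).
  exists sigma, (z / sigma)%C. split; [exact Hs|]. split; [|field; exact Ns].
  rewrite Cmod_div, Cmod_R, Rabs_pos_eq by (exact Ns || lra).
  apply Rmult_lt_reg_r with sigma; [lra|]. unfold Rdiv. rewrite Rmult_assoc, Rinv_l by lra.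
  unfold sigma. replace (r * ((Cmod z + r) / (2 * r))) with ((Cmod z + r) / 2) by (field; lra). lra.
Qed.

(** Harnack's inequality, by pairing with the geometric kernel, the real part of
    which stays above [1 / 2]. *)
Lemma Re_CPSeries_pos (t : nat -> C) r z : converges_in r t -> 0 < Re (t 0%nat) ->
  (forall w, Cmod w < r -> 0 <= Re (CPSeries t w)) -> Cmod z < r -> 0 < Re (CPSeries t z).
Proof.
  intros Ht H0 Hpos Hz. assert (Pz := Cmod_ge_0 z).
  destruct (contract r z Hz) as (sigma & w & Hs & Hw & Ez).
  assert (A := hadamard_positivity (fun n => t n * w ^ n)%C (fun n => RtoC (sigma ^ n)) (/ (1 + sigma))).
  lapply A; clear A; [intros A | now apply converges_in_abs with r].
  lapply A; clear A; [intros A |].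
  2:{ unfold abs_summable. apply ex_series_ext with (fun n => sigma ^ n).
      - intros n. rewrite Cmod_R, Rabs_pos_eq; [reflexivity | apply pow_le; lra].
      - apply ex_series_geom. rewrite Rabs_pos_eq; lra. }
  specialize (A eq_refl).
  lapply A; clear A; [intros A |].
  2:{ intros s. replace (CSeries _) with (CPSeries t (w * circle s)).
      - apply Hpos. rewrite Cmod_mult, Cmod_circle, Rmult_1_r. exact Hw.
      - apply CSeries_ext. intros n. rewrite Cpow_mult_l, circle_pow. ring. }
  specialize (A (fun s => Re_geom_kernel sigma s Hs)).
  replace (CSeries (fun n => t n * w ^ n * RtoC (sigma ^ n))%C) with (CPSeries t z) in A.
  - eapply Rlt_le_trans; [|exact A]. cbv beta. replace (t 0%nat * w ^ 0)%C with (t 0%nat) by (cbn [Cpow]; ring).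
    apply Rmult_lt_0_compat; [|exact H0].
    assert (/ 2 < / (1 + sigma)); [|lra]. apply Rinv_lt_contravar; lra.
  - apply CSeries_ext. intros n. rewrite Ez, Cpow_mult_l, RtoC_pow. ring.
Qed.

(** [∑ t_n z^n] is the mean of [∑ (n + 1) t_n w^n] along the segment from [0] to [z]. *)
Lemma Re_primitive_pos (t : nat -> C) r z : converges_in r t ->
  (forall w, Cmod w < r -> 0 < Re (CPSeries (fun n => (INR n + 1) * t n)%C w)) ->
  Cmod z < r -> 0 < Re (CPSeries t z).
Proof.
  intros Ht Hpos Hz. assert (Pz := Cmod_ge_0 z).
  destruct (contract r z Hz) as (sigma & w & Hs & Hw & Ez).
  set (a := fun n => Re (t n * w ^ n)%C).
  assert (Ha : converges_on_unit a).
  { intros s Hs'. apply ex_series_le_R with (2 := converges_in_abs r t w Ht Hw). intros n.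
    assert (P := pow_le s n (proj1 Hs')).
    rewrite Rabs_mult, Rabs_Rabsolu, (Rabs_pos_eq (s ^ n)) by exact P.
    apply Rle_trans with (Rabs (a n) * 1); [apply Rmult_le_compat_l; [apply Rabs_pos|] |].
    - rewrite <- (pow1 n). apply pow_incr. lra.
    - rewrite Rmult_1_r. apply re_le_Cmod. }
  assert (Ea : forall (u : nat -> C) (s : R), Re (CPSeries u (s * w)%C) = PSeries (fun n => Re (u n * w ^ n)%C) s).
  { intros u s. unfold CPSeries, CSeries, PSeries. cbn [Re fst]. apply Series_ext. intros n.
    change (Re (u n * (s * w) ^ n)%C = Re (u n * w ^ n)%C * s ^ n).
    rewrite Cpow_mult_l, <- RtoC_pow, <- re_scal_r. f_equal. ring. }
  assert (D : forall s, 0 <= s < 1 -> is_derive (fun s => s * PSeries a s) s (PSeries (fun n => (1 + INR n) * a n) s)).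
  { intros s Hs'. assert (As : Rabs s < 1) by (rewrite Rabs_pos_eq; lra).
    rewrite PSeries_Euler by assumption.
    assert (D1 := is_derive_PSeries a s (converges_on_unit_radius a s Ha As)).
    assert (D2 := is_derive_mult (K := R_AbsRing) _ _ s _ _ (is_derive_id (K := R_AbsRing) s) D1 Rmult_comm).
    exact D2. }
  destruct (MVT_gen (fun s => s * PSeries a s) 0 sigma (PSeries (fun n => (1 + INR n) * a n))) as [s [Hs' E]].
  - intros s Hs'. rewrite Rmin_left, Rmax_right in Hs' by lra. apply D. lra.
  - intros s Hs'. rewrite Rmin_left, Rmax_right in Hs' by lra.
    apply derivable_continuous_pt. eexists. apply is_derive_Reals. apply D. lra.
  - rewrite Rmin_left, Rmax_right in Hs' by lra.
    rewrite Ez, Ea. fold a.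
    assert (P : 0 < PSeries (fun n => (1 + INR n) * a n) s).
    { rewrite (PSeries_ext _ (fun n => Re ((INR n + 1) * t n * w ^ n)%C)).
      - rewrite <- (Ea (fun n => (INR n + 1) * t n)%C). apply Hpos.
        rewrite Cmod_mult, Cmod_R, Rabs_pos_eq by lra. assert (Pw := Cmod_ge_0 w). nra.
      - intros n. unfold a. rewrite <- RtoC_plus, <- Cmult_assoc, re_scal_l. ring. }
    rewrite Rmult_0_l, !Rminus_0_r in E.
    assert (0 < sigma * PSeries a sigma) by (rewrite E; apply Rmult_lt_0_compat; lra).
    apply Rmult_lt_reg_l with sigma; lra.
Qed.

(** [eit] is the unimodular constant in the definition of the class and [c] lists the
    Taylor coefficients of [f]; then [W] lists those of [L f], [K] those of
    [eit * (L f - beta)], and [B] those of [V_λ(f)(z) / z]. *)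

Section Duality.

Variables lam dlam : R -> R.
Hypothesis lam_pos : forall t, 0 < t < 1 -> 0 < lam t.
Hypothesis lam_der : forall t, 0 < t < 1 -> is_derive lam t (dlam t).
Hypothesis dlam_le : forall t, 0 < t < 1 -> dlam t <= - (lam t / (1 - t)).
Hypothesis lam_int : is_int01 lam 1.
Variables mu nu beta : R.
Hypothesis Hmu : 1 <= mu.
Hypothesis Hnu : 0 < nu.
Hypothesis Hbeta : beta < 1.
Hypothesis Hq0 : int01 (fun t => lam t * q0 mu nu t) = - ((beta - 1 / 2) / (1 - beta)).
Variables (eit : C) (c : nat -> C) (r : R).
Hypothesis Hr : 0 < r.
Hypothesis Hc : converges_in r c.
Hypothesis Hc1 : c 1%nat = 1.
Hypothesis HW : forall w, Cmod w < r ->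
  0 < Re (eit * (CPSeries (fun n => RtoC ((1 + mu * INR n) * (1 + nu * INR n)) * c (S n)) w - beta))%C.

Let lam_cont := weight_cont lam dlam lam_der.
Let B (n : nat) : C := (RtoC (moment lam n) * c (S n))%C.
Let W (n : nat) : C := (RtoC ((1 + mu * INR n) * (1 + nu * INR n)) * c (S n))%C.

Lemma converges_B : converges_in r B.
Proof.
  apply converges_in_le_mult with (2 := converges_in_incr r c Hc) (M := 1). intros n.
  assert (Bd := moment_bounds lam lam_pos lam_cont lam_int n).
  unfold B. rewrite Cmod_mult, Cmod_R, Rabs_pos_eq by lra.
  apply Rmult_le_compat_r; [apply Cmod_ge_0 | lra].
Qed.

Lemma converges_test_mult (b : nat -> C) x : Cmod x <= 1 -> converges_in r b ->
  converges_in r (fun n => eit * (b n * test_coef x n))%C.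
Proof.
  intros Hx Hb.
  assert (Hb' : converges_in r (fun n => INR n * b n + b n)%C)
    by (apply converges_in_plus; [now apply converges_in_INR | exact Hb]).
  apply converges_in_le_mult with (2 := Hb') (M := Cmod eit). intros n.
  rewrite Cmod_mult. apply Rmult_le_compat_l; [apply Cmod_ge_0|].
  replace (INR n * b n + b n)%C with (b n * RtoC (INR n + 1))%C by (rewrite RtoC_plus; ring).
  rewrite !Cmod_mult, Cmod_R. apply Rmult_le_compat_l; [apply Cmod_ge_0|].
  assert (P := pos_INR n). rewrite Rabs_pos_eq by lra. now apply test_coef_bound.
Qed.

Lemma converges_W : converges_in r W.
Proof.
  assert (C0 := converges_in_incr r c Hc).
  assert (C1 := converges_in_INR r _ C0). assert (C2 := converges_in_INR r _ C1).
  assert (A := converges_in_plus r _ _ (converges_in_plus r _ _ C0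
    (converges_in_scal r (RtoC (mu + nu)) _ C1)) (converges_in_scal r (RtoC (mu * nu)) _ C2)).
  intros s Hs. generalize (A s Hs). apply ex_series_ext. intros n. do 2 f_equal. unfold W.
  rewrite !RtoC_mult, !RtoC_plus, !RtoC_mult. ring.
Qed.

Let K (n : nat) : C := (eit * (W n - match n with O => RtoC beta | _ => 0 end))%C.

Lemma converges_K : converges_in r K.
Proof.
  assert (A : converges_in r (fun n => match n with O => RtoC beta | _ => 0 end)).
  { intros s Hs. apply ex_series_incr_1. apply ex_series_ext with (fun n => 0 * 0 ^ n).
    - intros n. now rewrite Cmod_0, !Rmult_0_l.
    - apply ex_series_mult_l. apply ex_series_geom. rewrite Rabs_R0; lra. }
  assert (A' : converges_in r (fun n => - match n with O => RtoC beta | _ => 0 end)%C).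
  { apply converges_in_le_mult with (2 := A) (M := 1). intros n. rewrite Cmod_opp. lra. }
  assert (D := converges_in_plus r _ _ converges_W A').
  exact (converges_in_scal r eit _ D).
Qed.

Lemma CPSeries_K w : Cmod w < r -> CPSeries K w = (eit * (CPSeries W w - beta))%C.
Proof.
  intros Hw. rewrite (CPSeries_incr r) by (auto using converges_K).
  rewrite (CPSeries_incr r W) by (auto using converges_W).
  rewrite (CPSeries_ext (fun n => K (S n)) (fun n => eit * W (S n))%C) by (intros n; unfold K; ring).
  rewrite (CPSeries_scal r) by (auto using converges_in_incr, converges_W).
  unfold K. ring.
Qed.

Lemma W_0 : W 0%nat = 1.
Proof. unfold W. rewrite Hc1. change (INR 0) with 0. rewrite !Rmult_0_r, Rplus_0_r, Rmult_1_r. ring. Qed.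

Lemma Re_eit_pos : 0 < Re eit.
Proof.
  assert (A := HW 0 ltac:(rewrite Cmod_0; exact Hr)). fold W in A.
  rewrite CPSeries_0, W_0 in A.
  replace (eit * (1 - beta))%C with (eit * RtoC (1 - beta))%C in A by (rewrite RtoC_minus; ring).
  rewrite re_scal_r in A. nra.
Qed.

(** The functional is [eit * beta] plus the pairing of [K], whose real part is
    positive, with the kernel of [kernel_lower_bound].  By the equation for [beta]
    the lower bound of [hadamard_positivity] is exactly [- Re eit * beta]. *)
Lemma convex_functional_ge_0 x rho z : Cmod x <= 1 -> 0 < rho < 1 -> Cmod z < rho * r ->
  0 <= Re (CPSeries (fun n => eit * ((INR n + 1) * B n * test_coef x n))%C z).
Proof.
  intros Hx Hrho Hz.
  assert (Nr : RtoC rho <> 0) by (intros E; apply RtoC_inj in E; lra).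
  set (w := (z / rho)%C).
  assert (Hw : Cmod w < r).
  { unfold w. rewrite Cmod_div by exact Nr. rewrite Cmod_R, Rabs_pos_eq by lra.
    apply Rmult_lt_reg_r with rho; [lra|]. unfold Rdiv. rewrite Rmult_assoc, Rinv_l; lra. }
  assert (MB := moment_bounds lam lam_pos lam_cont lam_int).
  assert (H := hadamard_positivity (fun n => K n * w ^ n)%C
    (fun n => kernel_coef lam mu nu x n * rho ^ n)%C (int01 (fun t => lam t * q0 mu nu t))).
  lapply H; clear H; [intros H | apply converges_in_abs with r; [apply converges_K | exact Hw]].
  lapply H; clear H; [intros H |].
  2:{ apply converges_in_abs with 1; [|rewrite Cmod_R, Rabs_pos_eq; lra].
      apply converges_in_1 with 1. intros n. unfold kernel_coef.
      rewrite Cmod_mult, Cmod_R. apply Rmult_le_compat; [apply Rabs_pos | apply Cmod_ge_0 | | now apply test_coef_bound].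
      eapply Rle_trans; [now apply Rabs_averaged_le|]. assert (X := MB n). rewrite Rabs_pos_eq; lra. }
  lapply H; clear H; [intros H |].
  2:{ unfold kernel_coef, averaged, test_coef. rewrite (moment_0 lam lam_int). change (INR 0) with 0.
      replace (1 * ((0 + 1) / ((1 + mu * 0) * (1 + nu * 0)))) with 1 by field. cbn [Cpow]. ring. }
  lapply H; clear H; [intros H |].
  2:{ intros t. replace (CSeries _) with (CPSeries K (w * circle t)).
      - rewrite CPSeries_K by (rewrite Cmod_mult, Cmod_circle, Rmult_1_r; exact Hw).
        left. apply HW. rewrite Cmod_mult, Cmod_circle, Rmult_1_r. exact Hw.
      - apply CSeries_ext. intros n. rewrite Cpow_mult_l, circle_pow. ring. }
  lapply H; clear H; [intros H |].
  2:{ intros t.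
      assert (A := kernel_lower_bound lam dlam lam_pos lam_der dlam_le lam_int mu nu Hmu Hnu x (circle (- t)) Hx
        (Cmod_circle _) rho Hrho).
      replace (CSeries _) with (CPSeries (kernel_coef lam mu nu x) (rho * circle (- t))); [exact A|].
      apply CSeries_ext. intros n. rewrite Cpow_mult_l, circle_pow.
      replace (INR n * - t) with (- (INR n * t)) by ring. ring. }
  cbv beta in H.
  set (t := fun n => (eit * ((INR n + 1) * B n * test_coef x n))%C).
  assert (Ct : converges_in r t).
  { apply (converges_test_mult (fun n => (INR n + 1) * B n)%C x Hx).
    apply converges_in_succ, converges_B. }
  assert (Hzr : Cmod z < r) by nra.
  assert (P1 : forall k n, 0 < k -> 1 <= 1 + k * INR n).
  { intros k n Hk. assert (P := pos_INR n). assert (0 <= k * INR n) by (apply Rmult_le_pos; lra). lra. }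
  (* the coefficients agree except at n = 0, where K contains - beta *)
  assert (E : CSeries (fun n => K n * w ^ n * (kernel_coef lam mu nu x n * rho ^ n))%C
      = (CPSeries t z - eit * beta)%C).
  { rewrite <- (CSeries_single (eit * beta)%C). unfold CPSeries. rewrite <- CSeries_minus.
    - apply CSeries_ext. intros n. replace z with (w * rho)%C by (unfold w; field; exact Nr).
      rewrite Cpow_mult_l.
      assert (X := P1 mu n ltac:(lra)). assert (Y := P1 nu n Hnu).
      assert (F : ((1 + mu * INR n) * (1 + nu * INR n)) * averaged mu nu (moment lam) n = moment lam n * (INR n + 1)).
      { unfold averaged. field. split; lra. }
      apply (f_equal RtoC) in F. rewrite RtoC_mult, (RtoC_mult (moment lam n)), (RtoC_plus (INR n)) in F.
      destruct n as [|n].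
      + unfold K, t, W, B, kernel_coef. unfold W in *.
        replace (averaged mu nu (moment lam) 0) with 1.
        2:{ unfold averaged. rewrite (moment_0 lam lam_int). change (INR 0) with 0. field. }
        unfold test_coef. rewrite (moment_0 lam lam_int), Hc1. change (INR 0) with 0. cbn [Cpow].
        replace ((1 + mu * 0) * (1 + nu * 0)) with 1 by ring. ring.
      + unfold K, t, W, B, kernel_coef.
        replace (eit * (((1 + mu * INR (S n)) * (1 + nu * INR (S n)))%R * c (S (S n)) - 0) * w ^ S n
            * (averaged mu nu (moment lam) (S n) * test_coef x (S n) * rho ^ S n))%C
          with (eit * (((1 + mu * INR (S n)) * (1 + nu * INR (S n)))%R * averaged mu nu (moment lam) (S n)
            * c (S (S n)) * test_coef x (S n)) * (w ^ S n * rho ^ S n))%C by ring.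
        rewrite F. ring.
    - now apply converges_in_abs with r.
    - apply abs_summable_le with (fun n => Cmod (eit * beta) * 0 ^ n).
      + intros [|n]; [simpl; lra | rewrite Cmod_0; simpl; lra].
      + apply ex_series_mult_l. apply ex_series_geom. rewrite Rabs_R0; lra. }
  rewrite E in H. unfold Cminus in H. rewrite re_plus, re_opp, re_scal_r in H.
  replace (K 0%nat * w ^ 0)%C with (eit * RtoC (1 - beta))%C in H
    by (unfold K; rewrite W_0, RtoC_minus; cbn [Cpow]; ring).
  rewrite re_scal_r, Hq0 in H.
  replace ((2 * - ((beta - 1 / 2) / (1 - beta)) - 1) * (Re eit * (1 - beta))) with (- (Re eit * beta)) in H
    by (field; lra).
  unfold Rdiv in *. lra.
Qed.

Lemma convex_functional_pos x rho z : Cmod x <= 1 -> 0 < rho < 1 -> Cmod z < rho * r ->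
  0 < Re (CPSeries (fun n => eit * ((INR n + 1) * B n * test_coef x n))%C z).
Proof.
  intros Hx Hrho Hz. set (t := fun n => (eit * ((INR n + 1) * B n * test_coef x n))%C).
  assert (Ct : converges_in r t).
  { apply (converges_test_mult (fun n => (INR n + 1) * B n)%C x Hx).
    apply converges_in_succ, converges_B. }
  apply Re_CPSeries_pos with (rho * r); [| | | exact Hz].
  - intros s Hs. apply Ct. nra.
  - unfold t, B, test_coef. rewrite (moment_0 lam lam_int), Hc1. change (INR 0) with 0.
    replace (eit * ((0 + 1) * (1 * 1) * (1 + 0 * ((1 + x) / 2))))%C with eit by ring. apply Re_eit_pos.
  - intros w Hw. now apply convex_functional_ge_0 with rho.
Qed.

Lemma starlike_functional_pos x rho z : Cmod x <= 1 -> 0 < rho < 1 -> Cmod z < rho * r ->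
  0 < Re (CPSeries (fun n => eit * (B n * test_coef x n))%C z).
Proof.
  intros Hx Hrho Hz. apply Re_primitive_pos with (rho * r); [| | exact Hz].
  - intros s Hs. apply (converges_test_mult B x Hx converges_B). nra.
  - intros w Hw. rewrite (CPSeries_ext _ (fun n => eit * ((INR n + 1) * B n * test_coef x n))%C) by (intros n; ring).
    now apply convex_functional_pos with rho.
Qed.

(** Starlikeness of [ξ z F' + (1 - ξ) F] for [F = z ∑ B_n z^n]: both functionals
    lie in the same open half-plane, so no convex combination vanishes. *)
Lemma pascu_quotient_pos xi rho z : 0 <= xi <= 1 -> 0 < rho < 1 -> Cmod z < rho * r -> z <> 0 ->
  let S0 := CPSeries B z in
  let S1 := CPSeries (fun n => (INR n + 1) * B n)%C z in
  let S2 := CPSeries (fun n => (INR n + 1) * ((INR n + 1) * B n))%C z in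
  0 < Re ((xi * z * S2 + RtoC (1 - xi)%R * z * S1) / (xi * z * S1 + RtoC (1 - xi)%R * (z * S0)))%C.
Proof.
  intros Hxi Hrho Hz Nz S0 S1 S2. apply Re_quotient_pos. intros x Hx Z.
  assert (Hzr : Cmod z < r) by nra.
  assert (C0 := converges_B).
  assert (C1 := converges_in_succ r _ C0). assert (C2 := converges_in_succ r _ C1).
  assert (Split : forall b, converges_in r b ->
    CPSeries (fun n => eit * (b n * test_coef x n))%C z
    = (eit * ((1 - x) / 2 * CPSeries b z + (1 + x) / 2 * CPSeries (fun n => (INR n + 1) * b n)%C z))%C).
  { intros b Hb.
    rewrite (CPSeries_ext _ (fun n => eit * ((1 - x) / 2 * b n + (1 + x) / 2 * ((INR n + 1) * b n)))%C)
      by (intros n; unfold test_coef; field).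
    rewrite (CPSeries_scal r) by (auto using converges_in_plus, converges_in_scal, converges_in_succ).
    rewrite (CPSeries_plus r) by (auto using converges_in_scal, converges_in_succ).
    rewrite !(CPSeries_scal r) by (auto using converges_in_succ). reflexivity. }
  assert (P0 := starlike_functional_pos x rho z Hx Hrho Hz). rewrite (Split B C0) in P0.
  assert (P1 := convex_functional_pos x rho z Hx Hrho Hz). rewrite (Split _ C1) in P1.
  fold S0 S1 in P0. fold S1 S2 in P1.
  set (T0 := ((1 - x) / 2 * S0 + (1 + x) / 2 * S1)%C) in *.
  set (T1 := ((1 - x) / 2 * S1 + (1 + x) / 2 * S2)%C) in *.
  assert (E : (RtoC xi * (eit * T1) + RtoC (1 - xi) * (eit * T0))%C = 0).
  { replace (RtoC xi * (eit * T1) + RtoC (1 - xi) * (eit * T0))%C with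
      (eit / z * ((1 + x) / 2 * (xi * z * S2 + RtoC (1 - xi)%R * z * S1)
       + (1 - x) / 2 * (xi * z * S1 + RtoC (1 - xi)%R * (z * S0))))%C by (unfold T0, T1; field; exact Nz).
    rewrite Z. ring. }
  apply (f_equal Re) in E. rewrite re_plus, !re_scal_l in E. change (Re 0) with 0 in E.
  destruct (Req_dec xi 0) as [->|N]; [lra|].
  assert (0 < xi * Re (eit * T1)) by (apply Rmult_lt_0_compat; lra).
  assert (0 <= (1 - xi) * Re (eit * T0)) by (apply Rmult_le_pos; lra).
  lra.
Qed.

End Duality.

Theorem theorem3p4 (alpha gamma xi mu nu : R)
  (halpha : 0 <= alpha) (hgamma : 0 < gamma) (hxi : 0 <= xi <= 1)
  (hmu : 1 <= mu) (hnu : 0 < nu)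
  (hsum : mu + nu = alpha - gamma) (hprod : mu * nu = gamma)
  (A B C0 : R) (hB1 : B < 1) (hB : B < Rmin (2 + 1 / mu) (C0 - A - 1))
  (phi : R -> R)
  (hphi_diff : forall x : R, 0 < x < 1 -> ex_derive phi x /\ ex_derive (Derive phi) x)
  (hphi_pos : forall x : R, 0 < x < 1 ->
     0 < phi x /\ 0 < Derive phi x /\ 0 < Derive (Derive phi) x)
  (k : R) (hk : 0 < k)
  (hlambda : is_RInt_gen (lambda k A B C0 phi) (at_right 0) (at_left 1) 1)
  (q : R -> R) (hq : is_q mu nu q)
  (beta : R) (hbeta1 : beta < 1)
  (hbeta : (beta - 1 / 2) / (1 - beta) = - int01 (fun t => lambda k A B C0 phi t * q t))
  (f : C -> C) (hf : class_W alpha gamma beta f) :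
  class_M xi (V_op k A B C0 phi f).
Proof.
  set (lam := lambda k A B C0 phi) in *.
  set (dlam := fun t => lam t * ((B - 1) / t - (C0 - A - B) / (1 - t))
     - k * (Rpower t (B - 1) * Rpower (1 - t) (C0 - A - B) * Derive phi (1 - t))).
  assert (lam_pos : forall t, 0 < t < 1 -> 0 < lam t).
  { intros t Ht. destruct (hphi_pos (1 - t) ltac:(lra)) as [P _].
    unfold lam, lambda, weight. repeat apply Rmult_lt_0_compat; try apply exp_pos; assumption. }
  assert (lam_der : forall t, 0 < t < 1 -> is_derive lam t (dlam t)).
  { intros t Ht. apply lambda_derivative; [exact Ht|]. apply hphi_diff. lra. }
  assert (dlam_le : forall t, 0 < t < 1 -> dlam t <= - (lam t / (1 - t))).
  { intros t Ht. assert (P := lam_pos t Ht). unfold dlam.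
    assert (D : 0 <= k * (Rpower t (B - 1) * Rpower (1 - t) (C0 - A - B) * Derive phi (1 - t))).
    { left. destruct (hphi_pos (1 - t) ltac:(lra)) as [_ [P' _]].
      repeat apply Rmult_lt_0_compat; try apply exp_pos; assumption. }
    assert (E : B < C0 - A - 1) by (eapply Rlt_le_trans; [exact hB | apply Rmin_r]).
    assert (X : (B - 1) / t - (C0 - A - B) / (1 - t) <= - / (1 - t)).
    { assert ((B - 1) / t <= 0).
      { apply Rmult_le_reg_r with t; [lra|]. unfold Rdiv. rewrite Rmult_assoc, Rinv_l; lra. }
      assert (/ (1 - t) <= (C0 - A - B) / (1 - t)); [|lra].
      rewrite <- (Rmult_1_l (/ (1 - t))) at 1. apply Rmult_le_compat_r; [left; apply Rinv_0_lt_compat; lra | lra]. }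
    assert (lam t * ((B - 1) / t - (C0 - A - B) / (1 - t)) <= lam t * - / (1 - t)) by (apply Rmult_le_compat_l; lra).
    unfold Rdiv in *. lra. }
  assert (lam_cont := weight_cont lam dlam lam_der).
  destruct hf as [[Hf [Hf0 Hf1]] [theta HW]].
  assert (Hq0 : int01 (fun t => lam t * q0 mu nu t) = - ((beta - 1 / 2) / (1 - beta))).
  { rewrite hbeta, Ropp_involutive. symmetry. apply int01_unique.
    apply is_RInt_gen_ext_01 with (fun t => lam t * q0 mu nu t).
    - intros t Ht. now rewrite (is_q_unique mu nu q).
    - now apply is_RInt_gen_q0 with dlam. }
  (* Taylor's formula near z, on a disc whose radius r satisfies Cmod z < r * r so
     that the dilation by rho = r in the duality argument still covers z *)
  assert (Data : forall z, in_disk z -> exists r c, 0 < r /\ Cmod z < r * r /\ r < 1 /\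
     converges_in r c /\ (forall w, Cmod w < r -> f w = CPSeries c w) /\ c 0%nat = 0 /\ c 1%nat = 1).
  { intros z Hz. unfold in_disk in Hz. assert (Pz := Cmod_ge_0 z).
    set (r := (3 + Cmod z) / 4). assert (Hr : 0 < r < 1) by (unfold r; lra).
    destruct (taylor f r Hf Hr) as [c [Hc Ec]].
    exists r, c. split; [lra|]. split; [unfold r; nra|]. split; [lra|]. split; [exact Hc|]. split; [exact Ec|].
    assert (M0 : Cmod 0 < r) by (rewrite Cmod_0; lra).
    split.
    - rewrite <- Hf0, (Ec 0 M0). symmetry. apply CPSeries_0.
    - rewrite <- Hf1. symmetry. apply is_C_derive_unique.
      replace (c 1%nat) with (CPSeries (CPS_derive c) 0) by (rewrite CPSeries_0; unfold CPS_derive; simpl; ring).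
      apply is_C_derive_ext_disk with (CPSeries c) r; auto. now apply is_derive_CPSeries with r. }
  set (F := V_op k A B C0 phi f).
  set (b := fun (c : nat -> C) n => (RtoC (moment lam n) * c (S n))%C).
  assert (DF : forall r c, 0 < r -> converges_in r c -> (forall w, Cmod w < r -> f w = CPSeries c w) -> c 0%nat = 0 ->
    forall w, Cmod w < r -> F w = (w * CPSeries (b c) w)%C /\
      is_derive_CC F w (CPSeries (fun n => (INR n + 1) * b c n)%C w)).
  { intros r c Hr Hc Ec Hc0.
    assert (Cb : converges_in r (b c)) by (apply (converges_B lam dlam); auto).
    assert (EF : forall w, Cmod w < r -> F w = (w * CPSeries (b c) w)%C).
    { intros w Hw. now apply V_op_series with r. }
    intros w Hw. split; [now apply EF|].
    apply is_C_derive_ext_disk with (fun w => w * CPSeries (b c) w)%C r; [exact EF | exact Hw|].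
    assert (D := is_C_derive_mult _ _ w _ _ (is_C_derive_id w) (is_derive_CPSeries r (b c) w Cb Hw)).
    replace (CPSeries (fun n => (INR n + 1) * b c n)%C w) with (1 * CPSeries (b c) w + w * CPSeries (CPS_derive (b c)) w)%C;
      [exact D|].
    assert (Cn := converges_in_INR r _ Cb).
    rewrite (CPSeries_ext (fun n => (INR n + 1) * b c n)%C (fun n => INR n * b c n + b c n)%C) by (intros n; ring).
    rewrite (CPSeries_plus r) by assumption.
    rewrite (CPSeries_incr r (fun n => INR n * b c n)%C) by assumption.
    change (INR 0) with 0. unfold CPS_derive. ring. }
  split; [split; [|split]|].
  - intros z Hz. destruct (Data z Hz) as (r & c & Hr & Hzr & Hr1 & Hc & Ec & Hc0 & Hc1).
    eexists. apply (DF r c); auto. nra.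
  - destruct (Data 0) as (r & c & Hr & Hzr & Hr1 & Hc & Ec & Hc0 & Hc1); [unfold in_disk; rewrite Cmod_0; lra|].
    rewrite (proj1 (DF r c Hr Hc Ec Hc0 0 ltac:(rewrite Cmod_0; exact Hr))). ring.
  - destruct (Data 0) as (r & c & Hr & Hzr & Hr1 & Hc & Ec & Hc0 & Hc1); [unfold in_disk; rewrite Cmod_0; lra|].
    rewrite (is_C_derive_unique _ _ _ (proj2 (DF r c Hr Hc Ec Hc0 0 ltac:(rewrite Cmod_0; exact Hr)))).
    rewrite CPSeries_0. unfold b. rewrite Hc1, (moment_0 lam hlambda). change (INR 0) with 0. ring.
  - intros z Hz Nz. destruct (Data z Hz) as (r & c & Hr & Hzr & Hr1 & Hc & Ec & Hc0 & Hc1).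
    assert (Hzr' : Cmod z < r) by nra.
    assert (D := DF r c Hr Hc Ec Hc0).
    assert (Cb : converges_in r (b c)) by (apply (converges_B lam dlam); auto).
    set (S1 := fun n => ((INR n + 1) * b c n)%C) in *.
    assert (C1 : converges_in r S1) by (now apply converges_in_succ).
    assert (D2 : C_derive (fun w => w * C_derive F w)%C z = CPSeries (fun n => (INR n + 1) * S1 n)%C z).
    { apply is_C_derive_unique.
      apply is_C_derive_ext_disk with (fun w => w * CPSeries S1 w)%C r; [| exact Hzr' |].
      - intros w Hw. now rewrite (is_C_derive_unique _ _ _ (proj2 (D w Hw))).
      - assert (D3 := is_C_derive_mult _ _ z _ _ (is_C_derive_id z) (is_derive_CPSeries r S1 z C1 Hzr')).
        replace (CPSeries (fun n => (INR n + 1) * S1 n)%C z) with (1 * CPSeries S1 z + z * CPSeries (CPS_derive S1) z)%C;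
          [exact D3|].
        assert (Cn := converges_in_INR r _ C1).
        rewrite (CPSeries_ext (fun n => (INR n + 1) * S1 n)%C (fun n => INR n * S1 n + S1 n)%C) by (intros n; ring).
        rewrite (CPSeries_plus r) by assumption.
        rewrite (CPSeries_incr r (fun n => INR n * S1 n)%C) by assumption.
        change (INR 0) with 0. unfold CPS_derive. ring. }
    fold F. rewrite D2, (is_C_derive_unique _ _ _ (proj2 (D z Hzr'))), (proj1 (D z Hzr')).
    assert (HW' : forall w, Cmod w < r -> 0 < Re ((cos theta, sin theta) *
      (CPSeries (fun n => RtoC ((1 + mu * INR n) * (1 + nu * INR n)) * c (S n)) w - beta))%C).
    { intros w Hw. assert (P := HW w ltac:(unfold in_disk; lra)).
      now rewrite (W_operator_series f r c alpha gamma mu nu w Hr Hc Ec Hc0 hsum hprod Hw) in P. }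
    exact (pascu_quotient_pos lam dlam lam_pos lam_der dlam_le hlambda mu nu beta hmu hnu hbeta1 Hq0
      (cos theta, sin theta) c r Hr Hc Hc1 HW' xi r z hxi (conj Hr Hr1) Hzr Nz).
Qed.
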